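(* Let $T>0$, let $f\in \mathrm{BL}([0,1])$, let $\mu_0\in\mathcal{M}^+([0,1])$, and let $v:\mathcal{M}([0,1])\times[0,1]\to\mathbb{R}$ satisfy the Velocity Assumption (see context). Endow $C([0,T];\mathcal{M}([0,1]))$ with the metric $(\mu,\nu)\mapsto\sup_{t\in[0,T]}\|\mu_t-\nu_t\|_{\mathrm{BL}}^*$. Then there is a unique element of $C([0,T];\mathcal{M}^+([0,1]))$ with initial condition $\mu_0$ that is a mild solution on $[0,T]$ of $$\frac{\partial}{\partial t}\mu_t+\frac{\partial}{\partial x}\bigl(v[\mu_t]\,\mu_t\bigr)=f\cdot\mu_t .$$ That is, for each admissible sequence of partitions $(\alpha_k)_{k\in\mathbb{N}}$ of $[0,T]$, the corresponding sequence $(\mu^k)_{k\in\mathbb{N}}$ of Euler approximations with initial value $\mu_0$ is a sequence in $C([0,T];\mathcal{M}^+([0,1]))$ and has a unique limit as $k\to\infty$. Moreover, this limit is independent of the choice of the admissible sequence $(\alpha_k)_{k\in\mathbb{N}}$.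
   Context: **Norms.** $\mathcal{M}([0,1])$ is the space of finite (signed) Borel measures on $[0,1]$, $\mathcal{M}^+([0,1])$ the cone of positive ones, $\|\cdot\|_{\mathrm{TV}}$ the total variation norm. $\mathrm{BL}([0,1])$ is the space of real-valued bounded Lipschitz functions on $[0,1]$ with norm $\|\phi\|_{\mathrm{BL}}=\|\phi\|_\infty+|\phi|_{\mathrm{L}}$, where $|\phi|_{\mathrm{L}}$ is the (smallest) Lipschitz constant. $\|\mu\|_{\mathrm{BL}}^*:=\sup\{|\int\phi\,d\mu| : \phi\in\mathrm{BL}([0,1]),\ \|\phi\|_{\mathrm{BL}}\le 1\}$. $C([0,T];\mathcal{M}([0,1]))$ (resp. $C([0,T];\mathcal{M}^+([0,1]))$) denotes maps $t\mapsto\mu_t$ into $\mathcal{M}([0,1])$ (resp. $\mathcal{M}^+([0,1])$) that are continuous for $\|\cdot\|_{\mathrm{BL}}^*$. **Stopped flow.** For $w\in\mathrm{BL}([0,1])$ and $x_0\in[0,1]$, let $x(\cdot;x_0)$ be the unique maximal solution, for $t\ge 0$ and with values in $[0,1]$, of $\dot x=w(x)$, $x(0)=x_0$, with maximal interval of existence $I_{x_0}\subset[0,\infty)$, and let $\tau_\partial(x_0)=\sup I_{x_0}\in[0,\infty]$ (so $\tau_\partial(x_0)=0$ if $x_0$ is a boundary point where $w$ points outwards). Define $\Phi^w_t(x_0)=x(t;x_0)$ if $t\in I_{x_0}$ and $\Phi^w_t(x_0)=x(\tau_\partial(x_0);x_0)$ otherwise, and $P^w_t\mu:=\Phi^w_t\#\mu=\mu\circ(\Phi^w_t)^{-1}$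 for $\mu\in\mathcal{M}([0,1])$. **Solution operator for fixed velocity.** For $w,f\in\mathrm{BL}([0,1])$ and each $\nu\in\mathcal{M}([0,1])$ it is known that on every interval $[0,T]$ there is a unique map $t\mapsto\mu_t\in\mathcal{M}([0,1])$ that is $\|\cdot\|_{\mathrm{BL}}^*$-continuous, $\|\cdot\|_{\mathrm{TV}}$-bounded and satisfies $\mu_t=P^w_t\nu+\int_0^tP^w_{t-s}(f\cdot\mu_s)\,ds$ for all $t\in[0,T]$ (Bochner integral in the completion of $\mathcal{M}([0,1])$ for $\|\cdot\|_{\mathrm{BL}}^*$); here $f\cdot\mu$ is the measure with density $f$ with respect to $\mu$. Put $Q^w_t\nu:=\mu_t$. (The function $f$ is fixed and suppressed in the notation.) **Velocity Assumption.** Write $v[\mu]:=v(\mu,\cdot)$. (i) $v[\mu]\in\mathrm{BL}([0,1])$ for each $\mu\in\mathcal{M}([0,1])$; and for any $R>0$ there are constants $K_R,L_R,M_R$ such that for all $\mu,\nu\in\mathcal{M}([0,1])$ with $\|\mu\|_{\mathrm{TV}}\le R$, $\|\nu\|_{\mathrm{TV}}\le R$: (ii) $\|v[\mu]\|_\infty\le K_R$; (iii) $|v[\mu]|_{\mathrm{L}}\le L_R$; (iv) $\|v[\mu]-v[\nu]\|_\infty\le M_R\|\mu-\nu\|_{\mathrm{BL}}^*$. **Euler approximation.** A partition of $[0,T]$ is a finite set $\alpha=\{t_0,\dots,t_N\}$, $N\ge1$, with $0=t_0<t_1<\dots<t_N=T$. The Euler approximation with partition $\alpha$ and initial value $\mu_0$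 is the trajectory $\mu\in C([0,T];\mathcal{M}([0,1]))$ that equals $\mu_0$ at $t=0$ and is given by $\mu_t:=Q^{v_j}_{t-t_j}\mu_{t_j}$ for $t\in(t_j,t_{j+1}]$, where $v_j:=v[\mu_{t_j}]$, $j=0,\dots,N-1$. **Admissible sequence of partitions.** A sequence $(\alpha_k)_{k\in\mathbb{N}}$ of partitions $\alpha_k=\{t^k_0<\dots<t^k_{N_k}\}$ of $[0,T]$ is admissible if $M^{(k)}:=\max_{0\le j\le N_k-1}(t^k_{j+1}-t^k_j)$ is nonincreasing in $k$ and $M^{(k)}\to0$ as $k\to\infty$. (Successive partitions need not be refinements.) **Mild solution (nonlinear equation).** For any admissible sequence $(\alpha_k)_{k\in\mathbb{N}}$ of partitions of $[0,T]$, let $\mu^k$ be the Euler approximation with partition $\alpha_k$ and initial value $\mu_0$. Any limit, in the metric $\sup_{t\in[0,T]}\|\mu_t-\nu_t\|_{\mathrm{BL}}^*$, of a subsequence of $(\mu^k)_{k\in\mathbb{N}}$, for any such $(\alpha_k)$, is called a mild solution on $[0,T]$ with initial value $\mu_0$. *)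

(* Defs.v *)
From HB Require Import structures.
From mathcomp Require Import all_boot all_order all_algebra.
From mathcomp Require Import all_classical all_reals all_analysis.

Set Implicit Arguments.
Unset Strict Implicit.
Unset Printing Implicit Defensive.

Import Order.TTheory GRing.Theory Num.Theory.
Import numFieldNormedType.Exports.

Local Open Scope classical_set_scope.
Local Open Scope ring_scope.

(* some element of [P], or [x0] if [P] is empty *)
Definition the {T : Type} (x0 : T) (P : set T) : T :=
  xget (T := {classic T}) x0 P.

Definition itv01 (R : realType) : Type := {x : R | x \in `[0, 1]}.

Lemma itv01_0 (R : realType) : (0 : R) \in `[0, 1].
Proof. by rewrite in_itv /= lexx ler01. Qed.

HB.instance Definition _ (R : realType) := Choice.on (itv01 R).
HB.instance Definition _ (R : realType) :=
  isPointed.Build (itv01 R) (exist _ 0 (itv01_0 R)).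

Definition itv01_val (R : realType) (x : itv01 R) : R := val x.

(* [0,1] with its Borel sigma-algebra, i.e. the trace of that of R *)
Notation I01 R := (g_sigma_algebra_preimageType (@itv01_val R)).

(* Charges are also functions on the nonmeasurable sets, where their values are
   meaningless: elements of M([0,1]) are compared with [eqM]. *)
Definition Meas (R : realType) := {charge set (I01 R) -> \bar R}.

Section measures.
Context {R : realType}.
Implicit Types (mu nu : Meas R) (phi w f : I01 R -> R).

Definition eqM mu nu := forall A, measurable A -> mu A = nu A.

Definition positiveM mu := forall A, measurable A -> (0 <= mu A)%E.

Definition zeroM : Meas R := czero.

Lemma hahn_exists mu : exists PN, hahn_decomposition mu PN.1 PN.2.
Proof. by have [P [N PN]] := Hahn_decomposition mu; exists (P, N). Qed.

Definition hahnP mu := projT2 (cid (hahn_exists mu)).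

Definition posM mu : {finite_measure set (I01 R) -> \bar R} :=
  jordan_pos (hahnP mu).

Definition negM mu : {finite_measure set (I01 R) -> \bar R} :=
  jordan_neg (hahnP mu).

Definition normTV mu : \bar R := charge_variation (hahnP mu) setT.

Definition integralM mu (A : set (I01 R)) phi : R :=
  \int[posM mu]_(x in A) phi x - \int[negM mu]_(x in A) phi x.

(* the measure with prescribed values on the measurable sets *)
Definition mkMeas (m : set (I01 R) -> \bar R) : Meas R :=
  the zeroM [set rho | forall A, measurable A -> rho A = m A].

Definition densityM f mu : Meas R :=
  mkMeas (fun A => (integralM mu A f)%:E).

Definition norm_sup phi : \bar R := ereal_sup [set `|phi x|%:E | x in setT].

Definition lip phi : \bar R :=
  ereal_inf [set L%:E | L in [set L : R | 0 <= L /\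
    forall x y, `|phi x - phi y| <= L * `|itv01_val x - itv01_val y|]].

Definition norm_BL phi : \bar R := (norm_sup phi + lip phi)%E.

Definition BL phi := (norm_BL phi < +oo)%E.

(* Elements of the dual of BL([0,1]), in which M([0,1]) is embedded by
   [pairing] and where its completion for the dual norm is its closure.  The
   norm [dual_norm] only sees the values on the unit ball of BL([0,1]): two
   functionals denote the same element when their difference has norm 0. *)
Definition dualBL := (I01 R -> R) -> R.

Definition pairing mu : dualBL := fun phi => integralM mu setT phi.

Definition dual_norm (L : dualBL) : \bar R :=
  ereal_sup [set `|L phi|%:E | phi in [set phi | (norm_BL phi <= 1)%E]].

Definition distBL mu nu : \bar R := dual_norm (pairing mu \- pairing nu).

Definition in_completion (L : dualBL) :=
  forall e : R, 0 < e -> exists mu, (dual_norm (L \- pairing mu)%R < e%:E)%E.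

End measures.

Section bochner.
Context {R : realType}.

(* sum of the [sf_val i] times the indicators of the [sf_set i] *)
Record simple_fun := SimpleFun {
  sf_size : nat ;
  sf_set : 'I_sf_size -> set R ;
  sf_val : 'I_sf_size -> @dualBL R ;
  sf_setP : forall i, measurable (sf_set i) ;
  sf_valP : forall i, in_completion (sf_val i) }.

Arguments sf_set : clear implicits.
Arguments sf_val : clear implicits.

Definition sf_eval (s : simple_fun) (r : R) : @dualBL R :=
  fun phi => \sum_i \1_(sf_set s i) r * sf_val s i phi.

Definition sf_integral (t : R) (s : simple_fun) : @dualBL R :=
  fun phi =>
    \sum_i fine (lebesgue_measure (sf_set s i `&` `[0, t])) * sf_val s i phi.

(* [g] is strongly measurable and Bochner integrable on [0,t], with integral
   [L], in the completion of M([0,1]) *)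
Definition is_bochner_integral (t : R) (g : R -> @dualBL R) (L : @dualBL R) :=
  exists s : nat -> simple_fun,
  [/\ {ae lebesgue_measure, forall r : R, r \in `[0, t] ->
        dual_norm (g r \- sf_eval (s n) r) @[n --> \oo] --> 0%E},
      (\int[lebesgue_measure]_(r in `[0%R, t])
        dual_norm (g r \- sf_eval (s n) r)%R)%E @[n --> \oo] --> 0%E
    & dual_norm (sf_integral t (s n) \- L) @[n --> \oo] --> 0%E].

End bochner.

Arguments sf_set {R} s i.
Arguments sf_val {R} s i phi.

Section flow.
Context {R : realType}.
Implicit Types w : I01 R -> R.

(* The derivative is relative to [I]; it is no condition when [I] is {0}. *)
Definition is_solution w (x0 : I01 R) (I : set R) (x : R -> I01 R) :=
  [/\ is_interval I, I `<=` `[0, +oo[, I 0, x 0 = x0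
    & forall t : R, I t ->
      (itv01_val (x s) - itv01_val (x t)) / (s - t) @[s --> within I t^']
        --> w (x t)].

Definition is_maximal_solution w (x0 : I01 R) (I : set R) (x : R -> I01 R) :=
  is_solution w x0 I x /\
  forall J y, is_solution w x0 J y -> I `<=` J -> {in I, x =1 y} -> J `<=` I.

Definition maximal_solution w (x0 : I01 R) : set R * (R -> I01 R) :=
  the ([set 0], fun=> x0) [set Ix | is_maximal_solution w x0 Ix.1 Ix.2].

Definition exit_time w (x0 : I01 R) : \bar R :=
  ereal_sup [set t%:E | t in (maximal_solution w x0).1].

Definition stopped_flow w (t : R) (x0 : I01 R) : I01 R :=
  let: (J, x) := maximal_solution w x0 in
  if t \in J then x t else x (fine (exit_time w x0)).

Definition transport w (t : R) (mu : Meas R) : Meas R :=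
  mkMeas (pushforward mu (stopped_flow w t)).

End flow.

Section trajectories.
Context {R : realType}.
Implicit Types (T : R) (mu nu : R -> Meas R).

(* Trajectories on [0,T] are functions on R, restricted to [0,T]. *)
Definition continuousBL T mu := forall t : R, t \in `[0, T] ->
  distBL (mu s) (mu t) @[s --> within `[0, T] (nbhs t)] --> 0%E.

Definition in_Cplus T mu :=
  continuousBL T mu /\ forall t : R, t \in `[0, T] -> positiveM (mu t).

Definition eq_traj T mu nu := forall t : R, t \in `[0, T] -> eqM (mu t) (nu t).

Definition dist_traj T mu nu : \bar R :=
  ereal_sup [set distBL (mu t) (nu t) | t in `[0, T]].

End trajectories.

Section solution_operator.
Context {R : realType}.
Implicit Types w f : I01 R -> R.

Definition is_fixed_velocity_solution w f (nu : Meas R) (T : R) (mu : R -> Meas R) :=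
  [/\ continuousBL T mu,
      exists B : R, forall t : R, t \in `[0, T] -> (normTV (mu t) <= B%:E)%E
    & forall t : R, t \in `[0, T] -> exists2 L,
        is_bochner_integral t
          (fun s => pairing (transport w (t - s) (densityM f (mu s)))) L
      & dual_norm (pairing (mu t) \- (pairing (transport w t nu) \+ L)) = 0%E].

Definition Q w f (t : R) (nu : Meas R) : Meas R :=
  the (fun=> zeroM) [set mu | forall T : R, 0 < T ->
    is_fixed_velocity_solution w f nu T mu] t.

End solution_operator.

Section euler.
Context {R : realType}.
Implicit Types (v : Meas R -> I01 R -> R) (f : I01 R -> R) (T : R).

Definition velocity_assumption v :=
  (forall mu, BL (v mu)) /\
  forall r : R, 0 < r -> exists K L M : R, forall mu nu,
    (normTV mu <= r%:E)%E -> (normTV nu <= r%:E)%E ->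
    [/\ (norm_sup (v mu) <= K%:E)%E,
        (lip (v mu) <= L%:E)%E
      & (norm_sup (v mu \- v nu)%R <= M%:E * distBL mu nu)%E].

(* the increasing list of the points of the partition *)
Definition is_partition T (a : seq R) :=
  [/\ (1 < size a)%N, sorted <%R a, head 0 a = 0 & last 0 a = T].

Definition mesh (a : seq R) : R :=
  \big[Num.max/0]_(j < (size a).-1) (a`_j.+1 - a`_j).

Definition admissible T (alpha : nat -> seq R) :=
  [/\ forall k, is_partition T (alpha k),
      nonincreasing_seq (fun k => mesh (alpha k))
    & mesh (alpha k) @[k --> \oo] --> (0 : R)].

(* the trajectory after time [tj], where it has the value [m]; [s] is the list
   of the partition points after [tj] *)
Fixpoint euler_from v f (m : Meas R) (tj : R) (s : seq R) (t : R) : Meas R :=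
  if s is tj1 :: s' then
    if t <= tj1 then Q (v m) f (t - tj) m
    else euler_from v f (Q (v m) f (tj1 - tj) m) tj1 s' t
  else m.

Definition euler v f (mu0 : Meas R) (a : seq R) (t : R) : Meas R :=
  if t <= 0 then mu0 else euler_from v f mu0 0 (behead a) t.

Definition is_mild_solution v f (mu0 : Meas R) T (mu : R -> Meas R) :=
  continuousBL T mu /\
  exists alpha (n : nat -> nat),
    [/\ admissible T alpha, {homo n : i j / (i < j)%N}
      & dist_traj T (euler v f mu0 (alpha (n k))) mu @[k --> \oo] --> 0%E].

End euler.

(* Main.v *)
From HB Require Import structures.
Require Import Defs.
From mathcomp Require Import all_boot all_order all_algebra.
From mathcomp Require Import all_classical all_reals all_analysis.
From mathcomp Require Import measurable_realfun ring lra.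

Import Order.TTheory GRing.Theory Num.Theory.
Import numFieldNormedType.Exports.

Local Open Scope classical_set_scope.
Local Open Scope ring_scope.

(** Everything is explicit along characteristics.  The stopped flow of a bounded
    Lipschitz field w is the projection on [0,1] of the flow on R of w composed
    with that projection, because a trajectory that has left [0,1] never comes
    back.  By the semigroup property of the stopped flow Phi, the measures
    Phi_t # (exp(a_t) nu) with a_t(x) = int_0^t f(Phi_s x) ds solve the
    variation of constants equation, and a Gronwall argument in the dual norm
    shows that they are the only solution; hence Q_t nu is this measure.
    An Euler approximation is therefore Psi_t # (exp(A_t) mu0), where the pair
    of functions (Psi_t, A_t) is obtained by composing finitely many such flows.
    For two partitions alpha and beta, a discrete Gronwall argument on the union
    of the partitions bounds the uniform distance of the two pairs by
    C (mesh alpha + mesh beta).  So the pairs have a uniform limit (Psi_t, A_t),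
    which does not depend on the partitions, and the mild solution is
    Psi_t # (exp(A_t) mu0). *)

Set Implicit Arguments.
Unset Strict Implicit.
Unset Printing Implicit Defensive.

(** * Bounded measurable functions *)

(** All measures are push-forwards of one and the same weighted [mu0] because transports along two
    different fields can be compared only under a bound on the total variation, and because M([0,1])
    is not complete for the dual norm. Pairs of functions are compared pointwise and have uniform
    limits; measurability and the bound on the weights pass to these limits, so that each limit pair
    still defines a measure, positive if [mu0] is.

    Differential equations are handled through quadratic defects: X follows w when [|X r - X s - (r
    - s) * w (X s)| <= C * (r - s) ^+ 2]. A single discrete Gronwall inequality for such curves
    gives uniqueness, the semigroup property, stability in w and the additivity of the weights.

    In the comparison of two partitions, velocities are frozen at the last partition points, while
    the distance of the pairs is known at the current time. Pairs move at speed at most K + F, so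
    this delay costs a multiple of the two meshes.

    Charges matter only up to [eqM], hence identities between measures are obtained by pairing with
    test functions. *)

Section bounded_measurable.
Context d (T : measurableType d) (R : realType).
Implicit Types (phi psi : T -> R) (l : (T -> R) -> R).

Definition bounded_mfun phi :=
  measurable_fun setT phi /\ exists B, forall x, `|phi x| <= B.

Lemma bounded_mfun_cst c : bounded_mfun (cst c).
Proof. by split; [exact: measurable_cst|exists `|c|]. Qed.

Lemma bounded_mfunD phi psi : bounded_mfun phi -> bounded_mfun psi ->
  bounded_mfun (fun x => phi x + psi x).
Proof.
move=> [mf [B Bf]] [mg [C Cg]]; split; first exact: measurable_funD.
by exists (B + C) => x; rewrite (le_trans (ler_normD _ _))// lerD.
Qed.

Lemma bounded_mfunM phi psi : bounded_mfun phi -> bounded_mfun psi ->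
  bounded_mfun (fun x => phi x * psi x).
Proof.
move=> [mf [B Bf]] [mg [C Cg]]; split; first exact: measurable_funM.
by exists (B * C) => x; rewrite normrM ler_pM.
Qed.

Lemma bounded_mfunZ c phi : bounded_mfun phi -> bounded_mfun (fun x => c * phi x).
Proof. exact/bounded_mfunM/bounded_mfun_cst. Qed.

Lemma bounded_mfunB phi psi : bounded_mfun phi -> bounded_mfun psi ->
  bounded_mfun (fun x => phi x - psi x).
Proof.
move=> bf /(bounded_mfunZ (-1)) bg; have := bounded_mfunD bf bg.
by under eq_fun do rewrite mulN1r.
Qed.

Lemma bounded_mfun_indic (A : set T) : measurable A -> bounded_mfun (\1_A : T -> R).
Proof.
move=> mA; split; first exact: measurable_indic.
by exists 1 => x; rewrite indicE normr_nat; case: (_ \in _); rewrite ?ler01.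
Qed.

Lemma bounded_mfun_sum n (F : 'I_n -> T -> R) : (forall i, bounded_mfun (F i)) ->
  bounded_mfun (fun x => \sum_(i < n) F i x).
Proof.
elim: n F => [|n IH] F bF.
  by under eq_fun do rewrite big_ord0; exact: bounded_mfun_cst.
by under eq_fun do rewrite big_ord_recl; apply: bounded_mfunD => //; exact: IH.
Qed.

(** The range [-B, B] is cut into half-open slices of height [e]; [c i] is the bottom of slice i and
    [A i] the preimage of this slice. *)
Lemma bounded_mfun_approx phi e : bounded_mfun phi -> 0 < e ->
  exists n (A : 'I_n -> set T) (c : 'I_n -> R),
    (forall i, measurable (A i)) /\
    forall x, `|phi x - \sum_(i < n) c i * \1_(A i) x| <= e.
Proof.
move=> [mf [B Bf]] e0.
(* The successor keeps a slice for the value [B] itself, whose index is [truncn (2 * B / e)]. *)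
pose n := (Num.truncn (2 * B / e)).+1.
pose c (i : 'I_n) := - B + i%:R * e.
exists n, (fun i => phi @^-1` `[c i, c i + e[), c; split=> [i|x].
  by rewrite -[X in measurable X]setTI; exact: mf.
have B0 : 0 <= B by apply: le_trans (Bf x).
pose k := Num.truncn ((phi x + B) / e).
have phiB : 0 <= (phi x + B) / e.
  by apply: divr_ge0 (ltW e0); move: (Bf x); rewrite ler_norml; lra.
have /andP[k1 k2] : k%:R <= (phi x + B) / e < k.+1%:R by exact: truncn_itv.
have kn : (k < n)%N.
  rewrite ltnS /k; apply: le_truncn; rewrite ler_pM2r ?invr_gt0//.
  by move: (Bf x); rewrite ler_norml; lra.
move: k1 k2; rewrite ler_pdivlMr// ltr_pdivrMr// -natr1 mulrDl mul1r => k1 k2.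
rewrite (bigD1 (Ordinal kn))//= big1 ?addr0 => [|i /eqP ik].
  rewrite indicE mem_set ?mulr1/=; last by rewrite /c in_itv/=; apply/andP; split; lra.
  by rewrite /c/= ler_norml; apply/andP; split; lra.
rewrite indicE memNset ?mulr0//= /c in_itv/= => /andP[i1 i2].
apply: ik; apply: val_inj => /=; apply/eqP; rewrite eqn_leq -ltnS -[(k <= i)%N]ltnS.
have : i%:R * e < k.+1%:R * e by rewrite -natr1 mulrDl mul1r; lra.
have : k%:R * e < i.+1%:R * e by rewrite -natr1 mulrDl mul1r; lra.
by rewrite !ltr_pM2r// !ltr_nat => -> ->.
Qed.

(** Linearity is asked only on bounded measurable functions, where integrals against finite measures
    are additive; the last clause is continuity for the sup norm. *)
Definition bounded_linear_on l :=
  [/\ forall phi psi, bounded_mfun phi -> bounded_mfun psi ->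
        l (fun x => phi x + psi x) = l phi + l psi,
      forall c phi, bounded_mfun phi -> l (fun x => c * phi x) = c * l phi
    & exists C, forall phi B, bounded_mfun phi -> (forall x, `|phi x| <= B) ->
        `|l phi| <= C * B].

Lemma bounded_linear_onB l phi psi : bounded_linear_on l ->
  bounded_mfun phi -> bounded_mfun psi ->
  l (fun x => phi x - psi x) = l phi - l psi.
Proof.
move=> [lD lZ _] bf bg; rewrite -mulN1r -lZ// -lD//.
  by under eq_fun do rewrite -mulN1r.
exact: bounded_mfunZ.
Qed.

Lemma bounded_linear_on_sum l n (c : 'I_n -> R) (F : 'I_n -> T -> R) :
  bounded_linear_on l -> (forall i, bounded_mfun (F i)) ->
  l (fun x => \sum_(i < n) c i * F i x) = \sum_(i < n) c i * l (F i).
Proof.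
move=> [lD lZ _]; elim: n c F => [|n IH] c F bF.
  rewrite big_ord0 -[RHS](mul0r (l (cst 0))) -lZ; last exact: bounded_mfun_cst.
  by congr (l _); apply/funext => x; rewrite big_ord0 mul0r.
under eq_fun do rewrite big_ord_recl.
rewrite lD ?big_ord_recl; last 2 first.
  exact: bounded_mfunZ.
  by apply: bounded_mfun_sum => i; exact: bounded_mfunZ.
by rewrite lZ// IH.
Qed.

(** Simple functions are dense for the sup norm, for which both functionals are continuous. Formulas
    for pairings with push-forwards and densities follow from it without computing Jordan
    decompositions. *)
Lemma eq_bounded_linear_on l1 l2 phi :
  bounded_linear_on l1 -> bounded_linear_on l2 ->
  (forall A, measurable A -> l1 \1_A = l2 \1_A) ->
  bounded_mfun phi -> l1 phi = l2 phi.
Proof.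
move=> L1 L2 l12 bf.
have [[_ _ [C1 HC1]] [_ _ [C2 HC2]]] := (L1, L2).
(* The sign of the constant is read off from the zero function with the bound 1. *)
have C10 : 0 <= C1.
  have := HC1 _ 1 (bounded_mfun_cst 0); rewrite mulr1 => H.
  by apply: le_trans (H _) => // x; rewrite /cst normr0.
have C20 : 0 <= C2.
  have := HC2 _ 1 (bounded_mfun_cst 0); rewrite mulr1 => H.
  by apply: le_trans (H _) => // x; rewrite /cst normr0.
apply/eqP; rewrite -subr_eq0 -normr_le0; apply/ler_addgt0Pl => e e0.
rewrite addr0; pose e' := e / (C1 + C2 + 1).
have e'0 : 0 < e' by apply: divr_gt0 => //; lra.
have [n [A [c [mA Ae]]]] := bounded_mfun_approx bf e'0.
have bA i : bounded_mfun (\1_(A i) : T -> R) by exact: bounded_mfun_indic.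
pose s x := \sum_(i < n) c i * \1_(A i) x.
have bs : bounded_mfun s by apply: bounded_mfun_sum => i; exact: bounded_mfunZ.
have s12 : l1 s = l2 s.
  by rewrite /s !bounded_linear_on_sum//; apply: eq_bigr => i _; rewrite l12.
have E1 := HC1 _ e' (bounded_mfunB bf bs) Ae.
have E2 := HC2 _ e' (bounded_mfunB bf bs) Ae.
rewrite bounded_linear_onB// in E1; rewrite bounded_linear_onB// in E2.
have -> : l1 phi - l2 phi = (l1 phi - l1 s) - (l2 phi - l2 s) by rewrite s12; ring.
apply: (le_trans (ler_normB _ _)); apply: (le_trans (lerD E1 E2)).
rewrite -mulrDl /e' mulrCA; apply: ler_piMr; first exact: ltW.
rewrite ler_pdivrMr; lra.
Qed.

End bounded_measurable.

(** * Integration against signed measures *)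

Section signed_integral.
Context {R : realType}.
Implicit Types (mu nu : Meas R) (phi psi : I01 R -> R).

Lemma bounded_mfun_integrable (m : {finite_measure set (I01 R) -> \bar R}) phi :
  bounded_mfun phi -> m.-integrable setT (EFin \o phi).
Proof.
move=> [mf [B Bf]]; apply: measurable_bounded_integrable => //.
  by rewrite -ge0_fin_numE// fin_num_measure.
exists B; split; first exact: num_real.
by move=> M BM x _; apply: le_trans (Bf x) _; exact: ltW.
Qed.

Lemma le_normr_Rintegral_cst (m : {finite_measure set (I01 R) -> \bar R}) phi (B : R) :
  bounded_mfun phi -> (forall x, `|phi x| <= B) ->
  `|\int[m]_x phi x| <= fine (m setT) * B.
Proof.
move=> bf Bf; rewrite mulrC -Rintegral_cst//.
apply: le_trans.
  by apply: le_normr_Rintegral => //; exact: bounded_mfun_integrable.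
apply: le_Rintegral => [//|||x _]; last exact: Bf.
- have [mf [C Cf]] := bf.
  apply: (@bounded_mfun_integrable m (fun x => `|phi x|)); split.
    exact: measurableT_comp.
  by exists C => x; rewrite normr_id.
- exact: (bounded_mfun_integrable m (@bounded_mfun_cst _ (I01 R) R B)).
Qed.

Lemma bounded_linear_Rintegral (m : {finite_measure set (I01 R) -> \bar R}) :
  bounded_linear_on (fun phi => \int[m]_x phi x).
Proof.
split.
- by move=> phi psi bf bg; rewrite RintegralD//; exact: bounded_mfun_integrable.
- by move=> c phi bf; rewrite RintegralZl//; exact: bounded_mfun_integrable.
- by exists (fine (m setT)) => phi B; exact: le_normr_Rintegral_cst.
Qed.

Lemma le_normr_pairing mu phi (B : R) : bounded_mfun phi -> (forall x, `|phi x| <= B) ->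
  `|pairing mu phi| <= fine (normTV mu) * B.
Proof.
move=> bf Bf.
have pf : posM mu setT \is a fin_num by exact: fin_num_measure.
have nf : negM mu setT \is a fin_num by exact: fin_num_measure.
rewrite /pairing /integralM /normTV /charge_variation/= fineD// mulrDl.
by apply: (le_trans (ler_normB _ _)); apply: lerD; exact: le_normr_Rintegral_cst.
Qed.

Lemma bounded_linear_pairing mu : bounded_linear_on (pairing mu).
Proof.
have [pD pZ _] := bounded_linear_Rintegral (posM mu).
have [nD nZ _] := bounded_linear_Rintegral (negM mu).
split=> [phi psi bf bg|c phi bf|].
- by rewrite /pairing /integralM pD// nD//; ring.
- by rewrite /pairing /integralM pZ// nZ//; ring.
- by exists (fine (normTV mu)) => phi B; exact: le_normr_pairing.
Qed.

Lemma pairing_indic mu A : measurable A -> pairing mu \1_A = fine (mu A).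
Proof.
move=> mA; rewrite /pairing /integralM /Rintegral !integral_indic// !setIT.
suff -> : mu A = (posM mu A - negM mu A)%E by rewrite fineB ?fin_num_measure.
by rewrite (jordan_decomp (hahnP mu) mA) /cadd/= cscaleN1.
Qed.

Lemma integralM_pairing mu A phi : measurable A ->
  integralM mu A phi = pairing mu (fun x => phi x * \1_A x).
Proof.
move=> mA; rewrite /pairing /integralM !(Rintegral_mkcond _ A).
by congr (_ - _); apply: eq_Rintegral => x _; rewrite patchE indicE; case: ifP;
  rewrite ?mulr1 ?mulr0.
Qed.

Lemma normTV_fin mu : normTV mu \is a fin_num.
Proof. by rewrite /normTV /charge_variation/= fin_numD !fin_num_measure. Qed.

Lemma normTV_ge0 mu : (0 <= normTV mu)%E.
Proof. by rewrite /normTV /charge_variation/= adde_ge0. Qed.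

(** The total variation is the pairing with the sign function [\1_P - \1_N] of the Hahn
    decomposition, which is an allowed test function. *)
Lemma normTV_le mu (C : R) :
  (forall psi, bounded_mfun psi -> (forall x, `|psi x| <= 1) -> pairing mu psi <= C) ->
  (normTV mu <= C%:E)%E.
Proof.
move=> H; rewrite -(fineK (normTV_fin mu)) lee_fin.
pose P := (projT1 (cid (hahn_exists mu))).1; pose N := (projT1 (cid (hahn_exists mu))).2.
have [[mP _] [mN _] _ PN0] : hahn_decomposition mu P N := hahnP mu.
have -> : fine (normTV mu) = pairing mu (fun x => \1_P x - \1_N x).
  rewrite bounded_linear_onB//; last 3 first.
  - exact: bounded_linear_pairing.
  - exact: bounded_mfun_indic.
  - exact: bounded_mfun_indic.
  rewrite !pairing_indic// /normTV /charge_variation/= fineD ?fin_num_measure//.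
  rewrite jordan_posE jordan_negE cjordan_posE cjordan_negE /crestr0 !mem_set//.
  by rewrite /crestr !setTI fineN.
apply: H; first by apply: bounded_mfunB; exact: bounded_mfun_indic.
move=> x; rewrite !indicE.
have [xP|xP] := boolP (x \in P); have [xN|xN] := boolP (x \in N).
- suff : (P `&` N) x by rewrite PN0.
  by split; exact: set_mem.
all: by rewrite ?subr0 ?sub0r ?subrr ?normrN ?normr1 ?normr0.
Qed.

(** The negative part has mass [- mu N], with N the negative Hahn set; this mass is 0 when [mu] is
    positive. *)
Lemma positive_pairing_ge0 mu phi : positiveM mu -> bounded_mfun phi ->
  (forall x, 0 <= phi x) -> 0 <= pairing mu phi.
Proof.
move=> pm bf f0; have [_ [B Bf]] := bf.
have neg0 : fine (negM mu setT) = 0.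
  pose N := (projT1 (cid (hahn_exists mu))).2.
  have [_ [mN _] _ _] := hahnP mu.
  apply/eqP; rewrite eq_le fine_ge0 ?measure_ge0// andbT.
  suff -> : negM mu setT = (- mu N)%E by rewrite fineN oppr_le0 fine_ge0// pm.
  rewrite -[LHS]/(jordan_neg (hahnP mu) setT) jordan_negE cjordan_negE.
  by rewrite /crestr0 mem_set// /crestr setTI.
have := le_normr_Rintegral_cst (negM mu) bf Bf.
rewrite neg0 mul0r normr_le0 => /eqP n0.
by rewrite /pairing /integralM n0 subr0 Rintegral_ge0.
Qed.

Lemma eq_pairing mu nu phi : eqM mu nu -> bounded_mfun phi ->
  pairing mu phi = pairing nu phi.
Proof.
move=> munu; apply: eq_bounded_linear_on; try exact: bounded_linear_pairing.
by move=> A mA; rewrite !pairing_indic// munu.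
Qed.

Lemma charge_exists (m : set (I01 R) -> \bar R) : m set0 = 0%E ->
  (forall A, measurable A -> m A \is a fin_num) -> semi_sigma_additive m ->
  exists rho : Meas R, forall A, rho A = m A.
Proof.
move=> m0 mfin ms; pose isC := isCharge.Build _ _ _ m m0 mfin ms.
by pose rho : Meas R := HB.pack m isC; exists rho.
Qed.

(** [mkMeas] is a choice with default value [zeroM]; the charge [rho] certifies that there is
    something to choose. *)
Lemma mkMeasE (m : set (I01 R) -> \bar R) (rho : Meas R) A :
  (forall A, measurable A -> rho A = m A) -> measurable A -> mkMeas m A = m A.
Proof.
move=> rhom; apply: (@xgetPex {classic (Meas R)} zeroM
  [set rho : Meas R | forall A, measurable A -> rho A = m A]).
by exists rho.
Qed.

Lemma pushforwardME mu (F : I01 R -> I01 R) A : measurable_fun setT F ->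
  measurable A -> mkMeas (pushforward mu F) A = mu (F @^-1` A).
Proof.
move=> mF mA.
have mpre B : measurable B -> measurable (F @^-1` B).
  by move=> mB; rewrite -[X in measurable X]setTI; exact: mF.
have [|||rho rhoE] := @charge_exists (pushforward mu F).
- by rewrite /pushforward preimage_set0 charge0.
- by move=> B mB; rewrite /pushforward; apply: (fin_num_measure mu); exact: mpre.
- move=> B mB tB mUB; rewrite /pushforward preimage_bigcup.
  apply: charge_semi_sigma_additive.
  + by move=> n; exact: mpre.
  + apply/trivIsetP => /= i j _ _ ij; rewrite -preimage_setI.
    by move/trivIsetP : tB => /(_ _ _ _ _ ij) ->//; rewrite preimage_set0.
  + by rewrite -preimage_bigcup; exact: mpre.
by rewrite (mkMeasE (rho := rho)).
Qed.

Lemma densityME f mu A : bounded_mfun f -> measurable A ->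
  densityM f mu A = (integralM mu A f)%:E.
Proof.
move=> bf mA.
have ip := bounded_mfun_integrable (posM mu) bf.
have in_ := bounded_mfun_integrable (negM mu) bf.
pose rho : Meas R := cadd (induced_charge ip) (cscale (-1) (induced_charge in_)).
rewrite /densityM (mkMeasE (rho := rho))// => B mB.
transitivity (\int[posM mu]_(x in B) (f x)%:E
  + (-1)%:E * \int[negM mu]_(x in B) (f x)%:E)%E; first by [].
rewrite EFinN mulN1e /integralM /Rintegral EFinB.
rewrite !fineK//; first by apply: integrable_fin_num => //; exact: (integrableS _ _ _ in_).
by apply: integrable_fin_num => //; exact: (integrableS _ _ _ ip).
Qed.

Lemma bounded_mfun_comp phi (F : I01 R -> I01 R) : bounded_mfun phi ->
  measurable_fun setT F -> bounded_mfun (phi \o F).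
Proof.
move=> [mf [B Bf]] mF; split; first exact: measurableT_comp.
by exists B => x; exact: Bf.
Qed.

(** A push-forward may cancel mass, so its Jordan decomposition need not be the image of that of
    [mu]. The change of variables is therefore checked on indicators and extended by linearity and
    continuity. *)
Lemma pairing_pushforward mu F phi : measurable_fun setT F -> bounded_mfun phi ->
  pairing (mkMeas (pushforward mu F)) phi = pairing mu (phi \o F).
Proof.
move=> mF bf.
apply: (eq_bounded_linear_on (l2 := fun phi => pairing mu (phi \o F))) bf => //.
- exact: bounded_linear_pairing.
- have [lD lZ [C HC]] := bounded_linear_pairing mu.
  split=> [phi1 phi2 b1 b2|c phi1 b1|].
  + by rewrite -lD//; exact: bounded_mfun_comp.
  + by rewrite -lZ//; exact: bounded_mfun_comp.
  + by exists C => phi1 B b1 B1; apply: HC => [|x]; [exact: bounded_mfun_comp|exact: B1].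
- move=> A mA; rewrite pairing_indic// pushforwardME//.
  have -> : \1_A \o F = \1_(F @^-1` A) :> (I01 R -> R).
    by apply/funext => x /=; rewrite !indicE.
  by rewrite pairing_indic// -[X in measurable X]setTI; exact: mF.
Qed.

Lemma pairing_density mu f phi : bounded_mfun f -> bounded_mfun phi ->
  pairing (densityM f mu) phi = pairing mu (fun x => f x * phi x).
Proof.
move=> bf bphi.
apply: (eq_bounded_linear_on (l2 := fun phi => pairing mu (fun x => f x * phi x))) bphi => //.
- exact: bounded_linear_pairing.
- have [lD lZ [C HC]] := bounded_linear_pairing mu.
  split=> [phi1 phi2 b1 b2|c phi1 b1|].
  + rewrite -lD; try exact: bounded_mfunM.
    by congr pairing; apply/funext => x; rewrite mulrDr.
  + rewrite -lZ; try exact: bounded_mfunM.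
    by congr pairing; apply/funext => x; rewrite mulrCA.
  + have [mf [D Df]] := bf; exists (C * D) => phi1 B b1 B1; rewrite -mulrA.
    by apply: HC => [|x]; [exact: bounded_mfunM|rewrite normrM ler_pM].
- move=> A mA; rewrite pairing_indic// densityME//= integralM_pairing//.
Qed.

End signed_integral.

(** * Bounded Lipschitz functions and the dual norm *)

Section bounded_lipschitz.
Context {R : realType}.
Implicit Types (mu nu : Meas R) (phi psi : I01 R -> R) (a b : R).

Lemma itv01_ge0 (x : itv01 R) : 0 <= itv01_val x.
Proof. by have := valP x; rewrite in_itv/= => /andP[]. Qed.

Lemma itv01_le1 (x : itv01 R) : itv01_val x <= 1.
Proof. by have := valP x; rewrite in_itv/= => /andP[]. Qed.

Definition clamp (r : R) : R := Num.max 0 (Num.min r 1).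

Lemma clamp_itv r : clamp r \in `[0, 1].
Proof. by rewrite in_itv/= /clamp le_max lexx/= ge_max ler01 ge_min lexx orbT. Qed.

Definition proj01 (r : R) : itv01 R := exist _ (clamp r) (clamp_itv r).

Lemma clampK r : r \in `[0, 1] -> clamp r = r.
Proof. by rewrite in_itv/= => /andP[r0 r1]; rewrite /clamp min_l// max_r. Qed.

Lemma proj01K : cancel (@itv01_val R) proj01.
Proof. by move=> x; apply: val_inj => /=; rewrite clampK//; exact: valP. Qed.

Lemma clamp_dist r s : `|clamp r - clamp s| <= `|r - s|.
Proof.
rewrite /clamp; wlog rs : r s / r <= s.
  by move=> H; have [/H//|/ltW/H] := leP r s; rewrite distrC [leRHS]distrC.
rewrite (ler0_norm (x := r - s)) ?subr_le0//.
by rewrite /Num.max /Num.min; do ! case: ifPn; rewrite -?leNgt => *; rewrite ler_norml; lra.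
Qed.

Definition lip_with b phi :=
  forall x y, `|phi x - phi y| <= b * `|itv01_val x - itv01_val y|.

Lemma norm_BL_le phi a b : (forall x, `|phi x| <= a) -> 0 <= b -> lip_with b phi ->
  (norm_BL phi <= (a + b)%:E)%E.
Proof.
move=> fa b0 fb; rewrite EFinD; apply: leeD.
  by apply: ge_ereal_sup => _ [x _ <-]; rewrite lee_fin.
by apply: ereal_inf_lbound; exists b.
Qed.

Lemma norm_sup_ge0 phi : (0 <= norm_sup phi)%E.
Proof.
apply: (@le_trans _ _ (`|phi point|)%:E); first by rewrite lee_fin.
by apply: ereal_sup_ubound; exists point.
Qed.

Lemma lip_ge0 phi : (0 <= lip phi)%E.
Proof. by apply: le_ereal_inf_tmp => _ [L [L0 _] <-]; rewrite lee_fin. Qed.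

Lemma norm_supP phi a : (norm_sup phi <= a%:E)%E -> forall x, `|phi x| <= a.
Proof.
move=> H x; rewrite -lee_fin; apply: le_trans H.
by apply: ereal_sup_ubound; exists x.
Qed.

(** The infimum in [lip] is approached within [e]; the excess [e * d] is at most [e] since [0,1] has
    diameter 1. *)
Lemma lipP phi b : (lip phi <= b%:E)%E -> lip_with b phi.
Proof.
move=> H x y; apply/ler_addgt0Pl => e e0.
pose d := `|itv01_val x - itv01_val y|.
have d1 : d <= 1.
  by rewrite ler_norml; move: (itv01_ge0 x) (itv01_le1 x) (itv01_ge0 y) (itv01_le1 y); lra.
have [|_ [L [L0 HL] <-]] := @ereal_inf_lt _ [set L%:E | L in [set L : R | 0 <= L /\
    forall x y, `|phi x - phi y| <= L * `|itv01_val x - itv01_val y|]] (b + e)%:E.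
  by apply: le_lt_trans H _; rewrite lte_fin; lra.
rewrite lte_fin => Lbe; apply: le_trans (HL x y) _.
have d0 : 0 <= d by exact: normr_ge0.
rewrite -/d; nra.
Qed.

Lemma BLP phi : BL phi -> exists a b, [/\ 0 <= a, 0 <= b, forall x, `|phi x| <= a,
  lip_with b phi & norm_BL phi = (a + b)%:E].
Proof.
rewrite /BL /norm_BL => H.
have s0 := norm_sup_ge0 phi; have l0 := lip_ge0 phi.
have sf : norm_sup phi \is a fin_num.
  by rewrite ge0_fin_numE//; apply: le_lt_trans H; rewrite leeDl.
have lf : lip phi \is a fin_num.
  by rewrite ge0_fin_numE//; apply: le_lt_trans H; rewrite leeDr.
exists (fine (norm_sup phi)), (fine (lip phi)); split; rewrite ?fine_ge0//.
- by apply: norm_supP; rewrite fineK.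
- by apply: lipP; rewrite fineK.
- by rewrite EFinD !fineK.
Qed.

Lemma BL_le1P phi : (norm_BL phi <= 1)%E -> exists a b,
  [/\ 0 <= a, 0 <= b, a + b <= 1, forall x, `|phi x| <= a & lip_with b phi].
Proof.
move=> H; have [|a [b [a0 b0 fa fb E]]] := @BLP phi.
  by apply: le_lt_trans H _; rewrite ltry.
by exists a, b; split => //; rewrite -lee_fin -E.
Qed.

Lemma lipschitz_continuous (g : R -> R) b :
  (forall r s, `|g r - g s| <= b * `|r - s|) -> continuous g.
Proof.
move=> gb x; apply/cvgrPdist_le => /= e e0.
have b0 : 0 < `|b| + 1 by rewrite ltr_wpDl.
near=> y; apply: (le_trans (gb x y)).
have yx : `|x - y| < e / (`|b| + 1).
  near: y; apply: (@nbhsx_ballx R R x (e / (`|b| + 1))); exact: divr_gt0.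
rewrite ltr_pdivlMr// in yx.
have := normr_ge0 (x - y); have := ler_norm b; nra.
Unshelve. all: by end_near. Qed.

Lemma measurable_itv01_val : measurable_fun setT (@itv01_val R : I01 R -> R).
Proof. by move=> _ A mA; exists A. Qed.

Lemma measurable_to_itv01 d (T : measurableType d) (F : T -> I01 R) :
  measurable_fun setT (@itv01_val R \o F) -> measurable_fun setT F.
Proof.
by move=> mF _ _ [B mB <-]; rewrite setTI -comp_preimage; exact: mF.
Qed.

(** The sigma-algebra of [I01 R] is a trace, so [phi] is factored through its continuous extension
    [phi \o proj01] to the line. *)
Lemma measurable_lip phi b : lip_with b phi -> measurable_fun setT phi.
Proof.
move=> fb; have -> : phi = (phi \o proj01) \o @itv01_val R.
  by apply/funext => x /=; rewrite proj01K.
apply: measurableT_comp; last exact: measurable_itv01_val.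
have b0 r s : `|phi (proj01 r) - phi (proj01 s)| <= `|b| * `|r - s|.
  apply: (le_trans (fb _ _)); apply: (@le_trans _ _ (`|b| * `|clamp r - clamp s|)).
    by apply: ler_wpM2r; rewrite ?ler_norm.
  by apply: ler_wpM2l; rewrite ?normr_ge0// clamp_dist.
apply: continuous_measurable_fun; exact: lipschitz_continuous b0.
Qed.

Lemma lip_bounded_mfun phi a b : (forall x, `|phi x| <= a) -> lip_with b phi ->
  bounded_mfun phi.
Proof. by move=> fa fb; split; [exact: measurable_lip fb|exists a]. Qed.

Lemma dual_norm_le (L : @dualBL R) (c : R) :
  (forall phi, (norm_BL phi <= 1)%E -> `|L phi| <= c) -> (dual_norm L <= c%:E)%E.
Proof. by move=> H; apply: ge_ereal_sup => _ [phi p1 <-]; rewrite lee_fin H. Qed.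

Lemma le_dual_norm (L : @dualBL R) phi : (norm_BL phi <= 1)%E ->
  (`|L phi|%:E <= dual_norm L)%E.
Proof. by move=> H; apply: ereal_sup_ubound; exists phi. Qed.

Lemma norm_BL0 : (norm_BL (cst 0%R : I01 R -> R) <= 1)%E.
Proof.
rewrite (le_trans (@norm_BL_le _ 0 0 _ _ _))//= ?addr0//.
- by move=> x; rewrite normr0.
- by move=> x y; rewrite subrr normr0 mul0r.
Qed.

Lemma dual_norm_ge0 (L : @dualBL R) : (0 <= dual_norm L)%E.
Proof. by apply: le_trans (le_dual_norm L norm_BL0); rewrite lee_fin. Qed.

Lemma distBL_fin mu nu : distBL mu nu \is a fin_num.
Proof.
rewrite ge0_fin_numE; last exact: dual_norm_ge0.
apply: (@le_lt_trans _ _ (fine (normTV mu) + fine (normTV nu))%:E); last exact: ltry.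
apply: dual_norm_le => phi /BL_le1P[a [b [a0 b0 ab fa fb]]].
have bf := lip_bounded_mfun fa fb.
have f1 x : `|phi x| <= 1 by apply: (le_trans (fa x)); lra.
rewrite -[leRHS]mulr1 mulrDl (le_trans (ler_normB _ _))//.
by apply: lerD; exact: le_normr_pairing.
Qed.

Lemma distBL_pairing mu nu phi a b : (forall x, `|phi x| <= a) -> 0 <= b ->
  lip_with b phi -> 
  `|pairing mu phi - pairing nu phi| <= (a + b) * fine (distBL mu nu).
Proof.
move=> fa b0 fb.
have a0 : 0 <= a by apply: le_trans (fa point).
have bf := lip_bounded_mfun fa fb.
apply/ler_addgt0Pl => e e0.
have D0 : 0 <= fine (distBL mu nu) by rewrite fine_ge0// dual_norm_ge0.
(* The last summand keeps the normalising constant positive when a + b = 0, and costs at most [e]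
   once multiplied by the distance. *)
pose c := a + b + e / (fine (distBL mu nu) + 1).
have e'0 : 0 < e / (fine (distBL mu nu) + 1) by rewrite divr_gt0//; lra.
have c0 : 0 < c by rewrite /c; lra.
have : (norm_BL (fun x => c^-1 * phi x)%R <= 1)%E.
  apply: le_trans (@norm_BL_le _ (c^-1 * a) (c^-1 * b) _ _ _) _.
  - by move=> x; rewrite normrM gtr0_norm ?invr_gt0// ler_pM2l ?invr_gt0.
  - by rewrite mulr_ge0// invr_ge0 ltW.
  - move=> x y; rewrite -mulrBr normrM gtr0_norm ?invr_gt0// -mulrA.
    by rewrite ler_pM2l ?invr_gt0.
  - by rewrite lee_fin -mulrDr mulrC ler_pdivrMr// mul1r /c; lra.
move/(le_dual_norm (pairing mu \- pairing nu)).
rewrite -[dual_norm _]/(distBL mu nu) -(fineK (distBL_fin mu nu)) lee_fin /=.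
have [_ pZ _] := bounded_linear_pairing mu; have [_ nZ _] := bounded_linear_pairing nu.
rewrite pZ// nZ// -mulrBr normrM gtr0_norm ?invr_gt0// mulrC ler_pdivrMr//.
move=> /le_trans; apply; rewrite /c mulrDr [X in X + _]mulrC addrC lerD2r.
by rewrite mulrCA ler_piMr ?ltW// ltr_pdivrMr; lra.
Qed.

End bounded_lipschitz.

(** * Measures are determined by bounded Lipschitz test functions *)

Section determination.
Context {R : realType}.
Implicit Types (mu nu : Meas R) (phi : I01 R -> R).

Lemma Rintegral_bounded_cvg (m : {finite_measure set (I01 R) -> \bar R})
    (phi_ : nat -> I01 R -> R) phi (B : R) :
  (forall n, measurable_fun setT (phi_ n)) -> (forall n x, `|phi_ n x| <= B) ->
  (forall x, phi_ n x @[n --> \oo] --> phi x) ->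
  \int[m]_x phi_ n x @[n --> \oo] --> \int[m]_x phi x.
Proof.
move=> mphi phiB cphi.
have mp : measurable_fun setT phi by apply: (measurable_fun_cvg mphi) => x _; exact: cphi.
have phB x : `|phi x| <= B.
  apply: (ler_cvg_to (cvg_norm (cphi x)) (cvg_cst B)).
  by apply: nearW => n; exact: phiB.
have [] := @dominated_convergence _ _ _ m setT measurableT
  (fun n x => (phi_ n x)%:E) (fun x => (phi x)%:E) (cst B%:E).
- by move=> n; exact/measurable_EFinP.
- exact/measurable_EFinP.
- by apply: aeW => x _; apply: cvg_EFin; [exact: nearW|exact: cphi].
- exact: (bounded_mfun_integrable m (@bounded_mfun_cst _ (I01 R) R B)).
- by apply: aeW => x n _; rewrite lee_fin.
move=> ip _ H; apply: fine_cvg => /=.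
rewrite /Rintegral fineK; last exact: integrable_fin_num.
exact: H.
Qed.

Lemma pairing_bounded_cvg mu (phi_ : nat -> I01 R -> R) phi (B : R) :
  (forall n, measurable_fun setT (phi_ n)) -> (forall n x, `|phi_ n x| <= B) ->
  (forall x, phi_ n x @[n --> \oo] --> phi x) ->
  pairing mu (phi_ n) @[n --> \oo] --> pairing mu phi.
Proof.
move=> mphi phiB cphi; rewrite /pairing /integralM.
by apply: cvgB; exact: Rintegral_bounded_cvg cphi.
Qed.

Lemma eq_pairing_lip mu nu phi a b :
  (forall phi, (norm_BL phi <= 1)%E -> pairing mu phi = pairing nu phi) ->
  (forall x, `|phi x| <= a) -> 0 <= b -> lip_with b phi ->
  pairing mu phi = pairing nu phi.
Proof.
move=> H fa b0 fb.
have d0 : distBL mu nu = 0%E.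
  apply/eqP; rewrite eq_le dual_norm_ge0 andbT; apply: dual_norm_le => psi p1 /=.
  by rewrite H// subrr normr0.
by have := distBL_pairing mu nu fa b0 fb; rewrite d0 mulr0 normr_le0 subr_eq0 => /eqP.
Qed.

(** Indicators of half-lines are pointwise limits of bounded Lipschitz ramps, and the traces of
    half-lines form a generating system stable under intersection. *)
Lemma eqM_pairing mu nu :
  (forall phi, (norm_BL phi <= 1)%E -> pairing mu phi = pairing nu phi) ->
  eqM mu nu.
Proof.
move=> H.
have Hitv (c : R) : pairing mu \1_(@itv01_val R @^-1` `[c, +oo[) =
                    pairing nu \1_(@itv01_val R @^-1` `[c, +oo[).
  (* Ramp of slope n: it is 1 from c on and, for positive n, vanishes below c - 1/n. *)
  pose h (n : nat) (r : R) := Num.max 0 (1 - n%:R * Num.max 0 (c - r)).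
  pose phi_ (n : nat) (x : I01 R) := h n (itv01_val x).
  have h01 n r : `|h n r| <= 1.
    have : 0 <= n%:R * Num.max 0 (c - r) by rewrite mulr_ge0// le_max lexx.
    by rewrite /h {2}/Num.max; case: ifPn; rewrite -?leNgt => *; rewrite ler_norml; lra.
  have hL n : lip_with n%:R (phi_ n).
    move=> x y; rewrite /phi_ /h; move: (itv01_val x) (itv01_val y) => r s {x y}.
    apply: (@le_trans _ _ `|n%:R * Num.max 0 (c - r) - n%:R * Num.max 0 (c - s)|).
      rewrite /Num.max; move: (n%:R * _) (n%:R * _) => p q.
      by do ! case: ifPn; rewrite -?leNgt => *; rewrite ler_norml;
        apply/andP; split; have := ler_norm (p - q); have := ler_norm (q - p);
        rewrite (distrC q p); lra.
    rewrite -mulrBr normrM normr_nat ler_wpM2l//.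
    rewrite /Num.max; do ! case: ifPn; rewrite -?leNgt => *; rewrite ler_norml;
        apply/andP; split; have := ler_norm (r - s); have := ler_norm (s - r);
        rewrite (distrC s r); lra.
  have hc x : phi_ n x @[n --> \oo] --> (\1_(@itv01_val R @^-1` `[c, +oo[) x : R).
    rewrite indicE; have [cx|xc] := leP c (itv01_val x).
      rewrite mem_set/= ?in_itv/= ?cx//.
      apply: cvg_near_cst; apply: nearW => n.
      by rewrite /phi_ /h (max_l (x := 0) (y := c - _)) ?mulr0 ?subr0 ?max_r// subr_le0.
    rewrite memNset/= ?in_itv/= ?andbT; last by apply/negP; rewrite -ltNge.
    apply: cvg_near_cst; near=> n.
    rewrite /phi_ /h (max_r (x := 0) (y := c - _)) ?subr_ge0 1?ltW//.
    apply/max_l; rewrite subr_le0 -ler_pdivrMr ?subr_gt0//.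
    by near: n; exact: nbhs_infty_ger.
  have pe n : pairing mu (phi_ n) = pairing nu (phi_ n).
    by apply: (eq_pairing_lip H (a := 1) (b := n%:R)) => // x; exact: h01.
  have m_ n : measurable_fun setT (phi_ n) by exact: measurable_lip (hL n).
  have c1 := @pairing_bounded_cvg mu _ _ _ m_ (fun n x => h01 n _) hc.
  have c2 := @pairing_bounded_cvg nu _ _ _ m_ (fun n x => h01 n _) hc.
  have c3 : pairing mu (phi_ n) @[n --> \oo] --> pairing nu \1_(@itv01_val R @^-1` `[c, +oo[).
    by under eq_fun do rewrite pe.
  by apply: cvg_unique c1 c3.
have decomp mu' A : measurable A -> mu' A = (posM mu' A - negM mu' A)%E.
  by move=> mA; rewrite (jordan_decomp (hahnP mu') mA) /cadd/= cscaleN1.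
have aux (x y z t : \bar R) : x \is a fin_num -> y \is a fin_num ->
    z \is a fin_num -> t \is a fin_num ->
    fine x - fine y = fine z - fine t -> (x + t = z + y)%E.
  by case: x y z t => [x||] [y||] [z||] [t||]//= _ _ _ _ E; rewrite -!EFinD; congr (_%:E); lra.
have aux' (x y z t : \bar R) : x \is a fin_num -> y \is a fin_num ->
    z \is a fin_num -> t \is a fin_num -> (x + t = z + y -> x - y = z - t)%E.
  case: x y z t => [x||] [y||] [z||] [t||]//= _ _ _ _ [E].
  by rewrite -!EFinB; congr (_%:E); lra.
pose G := preimage_set_system setT (@itv01_val R) (@RGenCInfty.G R).
have mG : @measurable _ (I01 R) = <<s G >>.
  rewrite g_sigma_preimageE -RGenCInfty.measurableE; reflexivity.
have Gm (A : set (I01 R)) : G A -> measurable A by move=> GA; rewrite mG; exact: sub_sigma_algebra.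
(* Uniqueness of measures concerns positive measures, so the negative parts change sides: the sum of
   mu+ and nu- is compared with the sum of nu+ and mu-. *)
have key (A : set (I01 R)) : measurable A ->
    measure_add (posM mu) (negM nu) A = measure_add (posM nu) (negM mu) A.
  apply: (@measure_unique _ R (I01 R) G (fun=> setT) mG).
  - move=> _ _ [B [c ->] <-] [C [d ->] <-].
    exists (`[Num.max c d, +oo[)%classic; first by exists (Num.max c d).
    rewrite !setTI -preimage_setI; congr (_ @^-1` _).
    apply/seteqP; split => r /=; rewrite !in_itv/= !andbT ge_max.
      by move=> /andP[].
    by move=> [-> ->].
  - move=> _; exists (`[0, +oo[)%classic; first by exists 0.
    by rewrite setTI; apply/seteqP; split => // x _ /=; rewrite in_itv/= itv01_ge0.
  - by apply/seteqP; split => // x _; exists 0%N.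
  - move=> B GB; have mB := Gm _ GB.
    have [_ [c ->] cB] := GB; rewrite setTI in cB; have E := Hitv c; rewrite cB in E.
    rewrite !pairing_indic// (decomp mu B mB) (decomp nu B mB) !fineB ?fin_num_measure// in E.
    rewrite -[LHS]/(measure_add (posM mu) (negM nu) B).
    rewrite -[RHS]/(measure_add (posM nu) (negM mu) B).
    by rewrite !measure_addE; apply: aux; rewrite ?fin_num_measure.
  - move=> _; rewrite -[X in (X < _)%E]/(measure_add (posM mu) (negM nu) setT).
    by rewrite measure_addE ltey_eq fin_numD !fin_num_measure.
move=> A mA; rewrite (decomp mu A mA) (decomp nu A mA); have := key A mA.
by rewrite !measure_addE; apply: aux'; rewrite ?fin_num_measure.
Unshelve. all: by end_near. Qed.

Lemma distBL0_eqM mu nu : distBL mu nu = 0%E -> eqM mu nu.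
Proof.
move=> d0; apply: eqM_pairing => phi p1; apply/eqP; rewrite -subr_eq0 -normr_le0.
have := le_dual_norm (pairing mu \- pairing nu) p1.
by rewrite -[dual_norm _]/(distBL mu nu) d0 lee_fin.
Qed.

End determination.

(** * Primitives and the flow of a Lipschitz field on the line *)

Section sequences_limits.
Context {R : realType}.

Lemma cauchy_rate_lim (u e : nat -> R) :
  (forall n m, `|u n - u m| <= e n + e m) -> e n @[n --> \oo] --> 0 ->
  exists l, u n @[n --> \oo] --> l /\ forall n, `|u n - l| <= e n.
Proof.
move=> ue e0.
have cu : cvg (u n @[n --> \oo]).
  apply/cauchy_cvgP/cauchy_ballP => eps eps0.
  have e2 : 0 < eps / 2 by rewrite divr_gt0.
  have [N _ HN] : \forall n \near \oo, `|e n| < eps / 2.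
    by move/cvgr0_norm_lt : e0; exact.
  exists (u @` [set n | (N <= n)%N], u @` [set n | (N <= n)%N]).
    by split; exists N => // n Nn; exists n.
  move=> [_ _] [/= [n Nn <-] [m Nm <-]].
  apply: (le_lt_trans (ue n m)); have := HN n Nn; have := HN m Nm => /=.
  by have := ler_norm (e n); have := ler_norm (e m); lra.
exists (lim (u n @[n --> \oo])); split => // n.
have c1 : `|u n - u m| @[m --> \oo] --> `|u n - lim (u n @[n --> \oo])|.
  by apply: cvg_norm; apply: cvgB => //; exact: cvg_cst.
have c2 : e n + e m @[m --> \oo] --> e n + 0 by apply: cvgD => //; exact: cvg_cst.
rewrite -[leRHS]addr0; apply: (ler_cvg_to c1 c2).
by apply: nearW => m; exact: ue.
Qed.

(** Passage to the limit after a discretisation into [n.+1] steps, whose error is of order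
    1/(n+1). *)
Lemma ler_harmonicP (a b c : R) : (forall n, a <= b + c * n.+1%:R^-1) -> a <= b.
Proof.
move=> H; have := @cvg_harmonic R => c0.
have c2 : b + c * n.+1%:R^-1 @[n --> \oo] --> b + c * 0.
  by apply: cvgD; [exact: cvg_cst|apply: cvgM => //; exact: cvg_cst].
rewrite mulr0 addr0 in c2.
by apply: (ler_cvg_to (cvg_cst a) c2); apply: nearW.
Qed.

End sequences_limits.

Section primitive.
Context {R : realType}.
Notation mu := (@lebesgue_measure R).
Implicit Types (g h : R -> R) (s t : R).

(** For negative t the interval is empty and the value 0, so a primitive lives on the whole line and
    is globally Lipschitz when [g] is continuous and bounded. *)
Definition prim g t : R := \int[mu]_(s in `[0, t]) g s.

Lemma continuous_integrable_itv g a b : continuous g ->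
  mu.-integrable `[a, b] (EFin \o g).
Proof.
move=> cg; apply: continuous_compact_integrable; first exact: segment_compact.
exact: continuous_subspaceT.
Qed.

Lemma prim_lt0 g t : t < 0 -> prim g t = 0.
Proof.
move=> t0; rewrite /prim set_itv_ge ?Rintegral_set0//.
by rewrite bnd_simp -ltNge.
Qed.

Lemma prim0 g : prim g 0 = 0.
Proof. by rewrite /prim set_itv1 Rintegral_set1. Qed.

(** With c = 0 this gives Lipschitz bounds, and with c = [g s] the quadratic defects of integral
    curves. *)
Lemma prim_dist g s t c e : continuous g -> 0 <= s -> s <= t ->
  (forall r, s <= r <= t -> `|g r - c| <= e) ->
  `|prim g t - prim g s - (t - s) * c| <= (t - s) * e.
Proof.
move=> cg s0 st ge.
have isub (a b : itv_bound R) : (BLeft s <= a)%O -> (b <= BRight t)%O ->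
    mu.-integrable [set` Interval a b] (EFin \o g).
  move=> sa bt; apply: (@integrableS _ _ _ mu `[s, t]) => //.
    by apply: subset_itv.
  exact: continuous_integrable_itv.
rewrite /prim Rintegral_itvB ?bnd_simp//; last exact: continuous_integrable_itv.
have mst : fine (mu `]s, t]) = t - s.
  rewrite lebesgue_measure_itv/= lte_fin; case: ltP => //= ts.
  by apply/eqP; rewrite eq_sym subr_eq0 eq_le ts st.
have ic (k : R) : mu.-integrable `]s, t] (EFin \o cst k).
  by apply: (@integrableS _ _ _ mu `[s, t]) => //;
    [exact: subset_itv_oc_cc|apply: continuous_integrable_itv; exact: cst_continuous].
have ig : mu.-integrable `]s, t] (EFin \o g) by apply: isub; rewrite bnd_simp.
have H : `|\int[mu]_(x in `]s, t]) (g x - c)| <= (t - s) * e.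
  have igc : mu.-integrable `]s, t] (EFin \o (fun x => g x - c)).
    by have := integrableB _ ig (ic c); exact.
  apply: (le_trans (le_normr_Rintegral _ igc)) => //.
  rewrite mulrC -mst -Rintegral_cst//; apply: le_Rintegral => //.
  - exact: integrable_norm.
  - by have := ic e.
  - by move=> x /=; rewrite in_itv/= => /andP[sx xt]; apply: ge; rewrite ltW.
rewrite RintegralB// ?Rintegral_cst// ?mst in H; last by have := ic c.
by rewrite [_ * c]mulrC.
Qed.

Lemma prim_lip g K : continuous g -> (forall r, `|g r| <= K) ->
  forall s t, `|prim g s - prim g t| <= K * `|s - t|.
Proof.
move=> cg gK; have K0 : 0 <= K by apply: le_trans (gK 0).
suff H s t : s <= t -> `|prim g s - prim g t| <= K * `|s - t|.
  move=> s t; have [/H//|/ltW/H] := leP s t.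
  by rewrite distrC [X in _ <= _ * X]distrC.
move=> st; have [s0|s0] := ltP s 0.
  rewrite (prim_lt0 _ s0) sub0r normrN; have [t0|t0] := ltP t 0.
    by rewrite (prim_lt0 _ t0) normr0 mulr_ge0.
  have := @prim_dist g 0 t 0 K cg (lexx _) t0 _; rewrite prim0 mulr0 !subr0.
  move=> /(_ _)/le_trans; apply; first by move=> r _; rewrite subr0.
  by rewrite mulrC ler_wpM2l// distrC ger0_norm; lra.
rewrite distrC; have := @prim_dist g s t 0 K cg s0 st _; rewrite mulr0 subr0.
move=> /(_ _)/le_trans; apply; first by move=> r _; rewrite subr0.
by rewrite mulrC ler_wpM2l// distrC ger0_norm; lra.
Qed.

Lemma prim_le g h t : continuous g -> continuous h ->
  (forall r, 0 <= r <= t -> `|g r| <= h r) -> `|prim g t| <= prim h t.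
Proof.
move=> cg ch gh; rewrite /prim.
have ig := continuous_integrable_itv 0 t cg.
have ih := continuous_integrable_itv 0 t ch.
apply: (le_trans (le_normr_Rintegral _ ig)) => //.
apply: le_Rintegral => //; first exact: integrable_norm.
Qed.

Lemma primB g h t : continuous g -> continuous h ->
  prim (fun s => g s - h s) t = prim g t - prim h t.
Proof.
move=> cg ch.
by rewrite /prim RintegralB//; exact: continuous_integrable_itv.
Qed.

Lemma continuous_expRM (a : R) : continuous (fun s => expR (a * s)).
Proof.
move=> x; apply: (@continuous_comp _ _ _ (fun s => a * s) expR).
  exact: mulrl_continuous.
exact: continuous_expR.
Qed.

Lemma prim_expR (c a t : R) : 0 < a -> 0 <= t ->
  prim (fun s => c * expR (a * s)) t = c * (expR (a * t) - 1) / a.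
Proof.
move=> a0; rewrite le_eqVlt => /predU1P[<-|t0].
  by rewrite prim0 mulr0 expR0 subrr mulr0 mul0r.
pose F := (c / a) \*: (expR \o (a \*: (id : R -> R))).
have dF (x : R) : is_derive x (1 : R) (F : R -> R) (c * expR (a * x)).
  have d1 : is_derive x (1 : R) (a \*: (id : R -> R)) (a *: 1) by apply: is_deriveZ.
  have d2 := is_derive1_comp (is_derive_expR ((a \*: (id : R -> R)) x)) d1.
  apply: (is_derive_eq (is_deriveZ (c / a) d2)).
  by rewrite /GRing.scale/= mulr1; field; rewrite gt_eqF.
have cF : continuous F.
  by move=> x; apply: differentiable_continuous; apply/derivable1_diffP; have [] := dF x.
have cf : continuous (fun s => c * expR (a * s)).
  move=> x; apply: (@continuousM _ _ (cst c) (fun s => expR (a * s))).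
    exact: cst_continuous.
  exact: continuous_expRM.
rewrite /prim /Rintegral (@continuous_FTC2 _ _ F)//.
- by rewrite -EFinB/= /F/= /GRing.scale/= mulr0 expR0; field; rewrite gt_eqF.
- exact: continuous_subspaceT.
- split.
  + by move=> x _; have [] := dF x.
  + exact/cvg_at_right_filter/cF.
  + exact/cvg_at_left_filter/cF.
- by move=> x _; rewrite derive1E; have [_ ->] := dF x.
Qed.

End primitive.

(** * Picard iteration and a Gronwall inequality for quadratic defects *)

Section picard.
Context {R : realType}.
Implicit Types (w : R -> R) (x t : R).

Fixpoint picard w x (n : nat) : R -> R :=
  if n is n'.+1 then fun t => x + prim (w \o picard w x n') t else cst x.

Definition flow w x t : R := lim (picard w x n t @[n --> \oo]).

Section bounded_lipschitz_field.
Variables (w : R -> R) (K L : R).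
Hypotheses (wK : forall x, `|w x| <= K) (wL : forall x y, `|w x - w y| <= L * `|x - y|).

Let K0 : 0 <= K. Proof. exact: le_trans (wK 0). Qed.

Let L0 : 0 <= L.
Proof. by have := wL 1 0; rewrite subr0 normr1 mulr1; exact: le_trans. Qed.

Let cw : continuous w. Proof. exact: lipschitz_continuous wL. Qed.

Let picard_lip x n s t : `|picard w x n s - picard w x n t| <= K * `|s - t|.
Proof.
elim: n s t => [|n IH] s t /=; first by rewrite subrr normr0 mulr_ge0.
rewrite opprD addrACA subrr add0r; apply: prim_lip => [|r]; last exact: wK.
have cp := lipschitz_continuous IH.
by move=> r; apply: continuous_comp; [exact: cp|exact: cw].
Qed.

Let cpicard x n : continuous (w \o picard w x n).
Proof.
move=> r; apply: continuous_comp; last exact: cw.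
exact: (lipschitz_continuous (@picard_lip x n)).
Qed.

(** Exponent of the weighted norm sup exp(- a t) |x(t)|, for which the Picard map contracts by L / a
    <= 1/2; the summand 1 keeps it positive when L = 0. *)
Let a := 2 * (L + 1).

Let a0 : 0 < a. Proof. by have := L0; rewrite /a; lra. Qed.

Let picard_step x n t : 0 <= t ->
  `|picard w x n.+1 t - picard w x n t| <= K * (2^-1) ^+ n * expR (a * t).
Proof.
elim: n t => [|n IH] t t0.
  rewrite /= addrC addKr expr0 mulr1.
  have := @prim_dist _ (w \o cst x) 0 t 0 K _ (lexx _) t0 _.
  rewrite prim0 mulr0 !subr0 => /(_ _ _)/le_trans; apply.
  - exact: (@cpicard x 0%N).
  - by move=> r _; rewrite subr0 wK.
  - rewrite mulrC ler_wpM2l//; apply: le_trans (expR_ge1Dx _); have := mulr_ge0 L0 t0; rewrite /a; lra.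
rewrite [in X in `|X|]/= opprD addrACA subrr add0r -primB; [|exact: (@cpicard x n.+1)|exact: cpicard].
pose h s := L * K * 2^-1 ^+ n * expR (a * s).
have ch : continuous h.
  move=> r; apply: (@continuousM _ _ (cst (L * K * 2^-1 ^+ n)) (fun s => expR (a * s))).
    exact: cst_continuous.
  exact: continuous_expRM.
have cd : continuous (fun s => (w \o picard w x n.+1) s - (w \o picard w x n) s).
  by move=> r; apply: continuousB; [exact: (@cpicard x n.+1)|exact: cpicard].
have E r : 0 <= r <= t -> `|(w \o picard w x n.+1) r - (w \o picard w x n) r| <= h r.
  move=> /andP[r0 _]; apply: (le_trans (wL _ _)).
  by rewrite /h -(mulrA L K) -(mulrA L) ler_wpM2l//; exact: IH.
apply: (le_trans (prim_le cd ch E)); rewrite /h prim_expR// exprS ler_pdivrMr//.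
have e0 := expR_ge0 (a * t).
have p0 : 0 <= 2^-1 ^+ n :> R by rewrite exprn_ge0// invr_ge0.
rewrite /a; set q := 2^-1 ^+ n in p0 *; set e := expR _ in e0 *.
have Kq : 0 <= K * q by rewrite mulr_ge0.
have -> : K * (2^-1 * q) * e * (2 * (L + 1)) = (K * q) * (e * (L + 1)) by field.
have -> : L * K * q * (e - 1) = (K * q) * (L * (e - 1)) by ring.
by rewrite ler_wpM2l//; have := L0; lra.
Qed.

(** The geometric series is kept as a difference of powers, a form in which the induction step
    closes with equality. *)
Let picard_cauchy x t n k : 0 <= t ->
  `|picard w x (n + k) t - picard w x n t| <=
    2 * K * expR (a * t) * (2^-1 ^+ n - 2^-1 ^+ (n + k)).
Proof.
move=> t0; elim: k => [|k IH]; first by rewrite addn0 !subrr normr0 mulr0.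
rewrite addnS -(subrKA (picard w x (n + k) t)).
apply: (le_trans (ler_normD _ _)); apply: (le_trans (lerD (picard_step x (n + k) t0) IH)).
rewrite exprS; set p := 2^-1 ^+ (n + k); set q := 2^-1 ^+ n; set e := expR _.
by rewrite le_eqVlt; apply/orP; left; apply/eqP; field.
Qed.

Let picard_flow x t n : 0 <= t ->
  `|picard w x n t - flow w x t| <= 2 * K * expR (a * t) * 2^-1 ^+ n
  /\ picard w x n t @[n --> \oo] --> flow w x t.
Proof.
move=> t0; pose c := 2 * K * expR (a * t).
have c0 : 0 <= c by rewrite !mulr_ge0// expR_ge0.
have p0 m : 0 <= 2^-1 ^+ m :> R by rewrite exprn_ge0// invr_ge0.
have [| |l [cl Hl]] := @cauchy_rate_lim _ (fun n => picard w x n t) (fun n => c * 2^-1 ^+ n).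
- move=> i j; wlog ij : i j / (i <= j)%N.
    move=> H; have [/H//|/ltnW/H] := leqP i j.
    by rewrite distrC [leRHS]addrC.
  rewrite distrC -(subnKC ij); apply: (le_trans (picard_cauchy _ _ _ t0)).
  by rewrite -/c -mulrDr ler_wpM2l// lerD2l; have := p0 (i + (j - i))%N; lra.
- rewrite -(mulr0 c); apply: cvgM; first exact: cvg_cst.
  by apply: cvg_expr; rewrite ger0_norm; lra.
by rewrite /flow (cvg_lim _ cl).
Qed.

Lemma flow_lt0 x t : t <= 0 -> flow w x t = x.
Proof.
move=> t0; rewrite /flow; apply: cvg_lim => //; apply: cvg_near_cst; apply: nearW => -[//|n] /=.
by move: t0; rewrite le_eqVlt => /predU1P[->|t0]; rewrite ?prim0 ?prim_lt0// addr0.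
Qed.

Lemma flow_lip x s t : `|flow w x s - flow w x t| <= K * `|s - t|.
Proof.
have cf r : picard w x n r @[n --> \oo] --> flow w x r.
  have [r0|r0] := leP 0 r; first by have [] := picard_flow x 0 r0.
  rewrite flow_lt0 ?ltW//; apply: cvg_near_cst; apply: nearW => -[//|n] /=.
  by rewrite prim_lt0// addr0.
have c1 : `|picard w x n s - picard w x n t| @[n --> \oo] --> `|flow w x s - flow w x t|.
  by apply: cvg_norm; apply: cvgB; exact: cf.
by apply: (ler_cvg_to c1 (cvg_cst (K * `|s - t|))); apply: nearW => n; exact: picard_lip.
Qed.

(** The geometric rate is uniform on [0, t], so the limit can be taken under the integral of the
    Picard recursion. *)
Lemma flowE x t : 0 <= t -> flow w x t = x + prim (w \o flow w x) t.
Proof.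
move=> t0; have cwf : continuous (w \o flow w x).
  move=> r; apply: continuous_comp; last exact: cw.
  exact: (lipschitz_continuous (flow_lip x)).
have [_ cf] := picard_flow x 0 t0.
have cf' : picard w x n.+1 t @[n --> \oo] --> flow w x t by rewrite (cvg_shiftS (fun n => picard w x n t)).
apply: cvg_unique cf' _ => //=.
apply: cvgD; first exact: cvg_cst.
apply/cvgrPdist_le => e e0.
pose c := t * (L * (2 * K * expR (a * t))).
have cc : c * 2^-1 ^+ n @[n --> \oo] --> (0 : R).
  rewrite -(mulr0 c); apply: cvgM; first exact: cvg_cst.
  by apply: cvg_expr; rewrite ger0_norm; lra.
near=> n.
have cwp := @cpicard x n.
have cd : continuous (fun s => (w \o flow w x) s - (w \o picard w x n) s).
  by move=> r; apply: continuousB; [exact: cwf|exact: cpicard].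
rewrite -primB//.
have := @prim_dist _ _ 0 t 0 (L * (2 * K * expR (a * t)) * 2^-1 ^+ n) cd (lexx _) t0 _.
rewrite prim0 mulr0 !subr0 => /(_ _)/le_trans; apply.
  move=> r /andP[r0 rt]; rewrite subr0; apply: (le_trans (wL _ _)).
  rewrite -mulrA ler_wpM2l// distrC; have [H _] := picard_flow x n r0.
  apply: (le_trans H); rewrite ler_wpM2r ?exprn_ge0 ?invr_ge0// ler_wpM2l ?mulr_ge0//.
  by rewrite ler_expR ler_wpM2l// ltW.
rewrite mulrA -/c; apply: le_trans (ler_norm _) _.
by near: n; move/cvgr0_norm_le : cc; exact.
Unshelve. all: by end_near. Qed.

(** Along the trajectory the field is [L * K]-Lipschitz in time, so freezing it at time s costs a
    quadratic error. From here on the differential equation of the flow is used only in this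
    form. *)
Lemma flow_defect x s t : 0 <= s -> s <= t ->
  `|flow w x t - flow w x s - (t - s) * w (flow w x s)| <= L * K * (t - s) ^+ 2.
Proof.
move=> s0 st; have cwf : continuous (w \o flow w x).
  move=> r; apply: continuous_comp; last exact: cw.
  exact: (lipschitz_continuous (flow_lip x)).
have -> : flow w x t - flow w x s = prim (w \o flow w x) t - prim (w \o flow w x) s.
  by rewrite [X in X - _ = _](flowE x (le_trans s0 st)) [X in _ - X = _](flowE x s0); ring.
have -> : L * K * (t - s) ^+ 2 = (t - s) * (L * (K * (t - s))) by ring.
apply: prim_dist => // r /andP[sr rt]; apply: (le_trans (wL _ _)).
rewrite ler_wpM2l//; apply: (le_trans (flow_lip x _ _)).
by rewrite ler_wpM2l// ger0_norm; lra.
Qed.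

End bounded_lipschitz_field.

(* Euler steps of length t / n turn the quadratic defects into an error O(1 / n). *)
Lemma defect_gronwall (w w' X Y : R -> R) (L C d t : R) :
  0 <= L -> 0 <= t ->
  (forall x y, `|w x - w y| <= L * `|x - y|) ->
  (forall s r, 0 <= s -> s <= r -> r <= t ->
    `|X r - X s - (r - s) * w (X s)| <= C * (r - s) ^+ 2) ->
  (forall s r, 0 <= s -> s <= r -> r <= t ->
    `|Y r - Y s - (r - s) * w' (Y s)| <= C * (r - s) ^+ 2) ->
  (forall s, 0 <= s <= t -> `|w (Y s) - w' (Y s)| <= d) ->
  `|X t - Y t| <= expR (L * t) * (`|X 0 - Y 0| + t * d).
Proof.
move=> L0 t0 wL HX HY Hd.
apply: (@ler_harmonicP _ _ _ (expR (L * t) * (2 * C * t ^+ 2))) => n.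
pose h := t / n.+1%:R.
have n0 : 0 < n.+1%:R :> R by rewrite ltr0n.
have h0 : 0 <= h by rewrite divr_ge0// ltW.
have hn : h * n.+1%:R = t by rewrite /h mulfVK ?gt_eqF.
suff H k : (k <= n.+1)%N -> `|X (h * k%:R) - Y (h * k%:R)| <=
    expR (L * (h * k%:R)) * (`|X 0 - Y 0| + (h * k%:R) * (d + 2 * C * h)).
  have := H _ (leqnn _); rewrite hn => /le_trans; apply.
  by rewrite le_eqVlt; apply/orP; left; apply/eqP; rewrite /h; field; rewrite gt_eqF.
have d0 : 0 <= d by apply: le_trans (Hd 0 _); rewrite // lexx.
(* No sign is assumed for C; nonnegativity comes from the defect of X on [0, h]. *)
have h2 : 0 <= C * h ^+ 2.
  have -> : C * h ^+ 2 = C * (h - 0) ^+ 2 by rewrite subr0.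
  apply: le_trans (HX 0 h _ _ _) => //.
  by rewrite -hn ler_peMr// ler1n.
elim: k => [|k IH] kn; first by rewrite !mulr0 expR0 mul0r mul1r addr0.
have {IH} := IH (ltnW kn).
have khn : h * k.+1%:R <= t by rewrite -hn ler_wpM2l// ler_nat.
have kh : h * k%:R <= h * k.+1%:R by rewrite ler_wpM2l// ler_nat.
have kh0 : 0 <= h * k%:R by rewrite mulr_ge0.
have step : h * k.+1%:R - h * k%:R = h by rewrite -mulrBr -natrB// subSnn mulr1.
have := HX _ _ kh0 kh khn; have := HY _ _ kh0 kh khn; rewrite step.
have := Hd (h * k%:R); rewrite kh0 (le_trans kh khn) => /(_ isT).
have := wL (X (h * k%:R)) (Y (h * k%:R)).
have -> : L * (h * k.+1%:R) = L * h + L * (h * k%:R) by rewrite -natr1; ring.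
have -> : h * k.+1%:R = h + h * k%:R by rewrite -natr1; ring.
have e1 : 1 + L * h <= expR (L * h) by exact: expR_ge1Dx.
have e2 : 1 <= expR (L * (h * k%:R)).
  by apply: le_trans (expR_ge1Dx _); rewrite lerDl mulr_ge0.
rewrite expRD; set s := h * k%:R in kh0 *; set p := expR (L * h) in e1 *.
set q := expR _ in e2 *.
set xs := X s; set ys := Y s; set xr := X _; set yr := Y _ => Hw Hdd HYY HXX Hu.
have lh : 0 <= L * h by rewrite mulr_ge0.
have B0 := normr_ge0 (X 0 - Y 0).
set B := `|X 0 - Y 0| in B0 *; set u := `|xs - ys| in Hw Hu.
(* One Euler step: the Lipschitz bound turns u into (1 + L h) u, the discrepancy of the fields along
   Y adds h d, and the two defects add 2 C h^2. *)
have E : `|xr - yr| <= (1 + L * h) * u + h * d + 2 * (C * h ^+ 2).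
  have -> : xr - yr = (xr - xs - h * w xs) - (yr - ys - h * w' ys) + (xs - ys) +
     (h * (w xs - w ys) + h * (w ys - w' ys)) by ring.
  apply: (le_trans (ler_normD _ _)).
  have := le_trans (ler_normD _ _) (lerD (le_trans (ler_normB _ _) (lerD HXX HYY)) (lexx u)).
  have n1 : `|h * (w xs - w ys)| <= h * (L * u) by rewrite normrM (ger0_norm h0) ler_wpM2l.
  have n2 : `|h * (w ys - w' ys)| <= h * d by rewrite normrM (ger0_norm h0) ler_wpM2l.
  by have := le_trans (ler_normD _ _) (lerD n1 n2); lra.
apply: (le_trans E).
have hd0 : 0 <= h * d by rewrite mulr_ge0.
have S0 : 0 <= s * (d + 2 * C * h).
  rewrite /s; have -> : h * k%:R * (d + 2 * C * h) = k%:R * (h * d + 2 * (C * h ^+ 2)) by ring.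
  by rewrite mulr_ge0//; lra.
have pq : 1 <= p * q by nra.
have u0 : 0 <= u by exact: normr_ge0.
apply: (@le_trans _ _ (p * (q * (B + s * (d + 2 * C * h))) + p * q * (h * d + 2 * (C * h ^+ 2)))); last first.
  by rewrite le_eqVlt; apply/orP; left; apply/eqP; ring.
have : (1 + L * h) * u <= p * (q * (B + s * (d + 2 * C * h))).
  by apply: ler_pM => //; lra.
have : h * d + 2 * (C * h ^+ 2) <= p * q * (h * d + 2 * (C * h ^+ 2)) by rewrite ler_peMl//; lra.
by lra.
Qed.

End picard.

(** * The stopped flow *)

Section flow_theory.
Context {R : realType}.
Variables (w : R -> R) (K L : R).
Hypotheses (wK : forall x, `|w x| <= K) (wL : forall x y, `|w x - w y| <= L * `|x - y|).

Let K0 : 0 <= K. Proof. exact: le_trans (wK 0). Qed.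

Let L0 : 0 <= L.
Proof. by have := wL 1 0; rewrite subr0 normr1 mulr1; exact: le_trans. Qed.

Lemma flow0 x : flow w x 0 = x.
Proof. exact: flow_lt0. Qed.

(** Gronwall with equal fields and equal starting points. A curve is recognised as the flow by
    computing its defect; the semigroup property and the affine trajectories are obtained so. *)
Lemma flow_unique x (Y : R -> R) (C t : R) : 0 <= t -> Y 0 = x ->
  (forall s r, 0 <= s -> s <= r -> r <= t ->
    `|Y r - Y s - (r - s) * w (Y s)| <= C * (r - s) ^+ 2) ->
  flow w x t = Y t.
Proof.
move=> t0 Yx YC; apply/eqP; rewrite -subr_eq0 -normr_le0.
have LK0 := mulr_ge0 L0 K0.
have := @defect_gronwall _ w w (flow w x) Y L (L * K + `|C|) 0 t L0 t0 wL.
rewrite flow0 Yx subrr normr0 mulr0 addr0 mulr0; apply.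
- move=> s r s0 sr rt; apply: (le_trans (flow_defect wK wL x s0 sr)).
  by rewrite ler_wpM2r ?sqr_ge0// lerDl.
- move=> s r s0 sr rt; apply: (le_trans (YC s r s0 sr rt)).
  by rewrite ler_wpM2r ?sqr_ge0//; have := ler_norm C; lra.
- by move=> s _; rewrite subrr normr0.
Qed.

Lemma flowD (x s t : R) : 0 <= s -> 0 <= t -> flow w x (s + t) = flow w (flow w x s) t.
Proof.
move=> s0 t0; apply/esym.
apply: (@flow_unique _ (fun r => flow w x (s + r)) (L * K)) => //; first by rewrite addr0.
move=> r q r0 rq qt; have := @flow_defect _ _ _ _ wK wL x (s + r) (s + q).
by rewrite opprD addrACA subrr add0r; apply; rewrite ?addr_ge0// lerD2l.
Qed.

(** Meant for the outside of [0,1], where the extended field is constant on either side. *)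
Lemma flow_affine (x c t : R) : 0 <= t -> (forall r, 0 <= r <= t -> w (x + r * c) = c) ->
  flow w x t = x + t * c.
Proof.
move=> t0 wc; apply: (@flow_unique _ (fun r => x + r * c) 0) => //.
  by rewrite mul0r addr0.
move=> s r s0 sr rt; rewrite wc; last by rewrite s0 (le_trans sr rt).
by rewrite mul0r normr_le0; apply/eqP; ring.
Qed.

Lemma flow_dist (w' : R -> R) (x y d t : R) : 0 <= t -> (forall x, `|w' x| <= K) ->
  (forall x y, `|w' x - w' y| <= L * `|x - y|) ->
  (forall x, `|w x - w' x| <= d) ->
  `|flow w x t - flow w' y t| <= expR (L * t) * (`|x - y| + t * d).
Proof.
move=> t0 w'K w'L ww'.
have := @defect_gronwall _ w w' (flow w x) (flow w' y) L (L * K) d t L0 t0 wL.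
rewrite flow0 (@flow_lt0 _ w' y 0)//; apply.
- by move=> s r s0 sr _; exact: flow_defect.
- by move=> s r s0 sr _; exact: flow_defect.
- by move=> s _; exact: ww'.
Qed.

End flow_theory.

Section barrier.
Context {R : realType}.

(** For x < b, the sign of w at b and the Lipschitz bound give w x <= L (b - x), so an exact Euler
    step with L h <= 1 does not cross b; from x >= b it does not increase the excess. Only the
    defects push X above b, and n + 1 defects C h^2 add up to O(1/n). *)
Lemma barrier (w X : R -> R) (L C b t : R) : 0 <= L -> 0 <= t ->
  (forall x y, `|w x - w y| <= L * `|x - y|) ->
  (forall y, b <= y -> w y <= 0) ->
  (forall s r, 0 <= s -> s <= r -> r <= t ->
    `|X r - X s - (r - s) * w (X s)| <= C * (r - s) ^+ 2) ->
  X 0 <= b -> X t <= b.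
Proof.
move=> L0 t0 wL wb HX X0.
have [N LN] : exists N : nat, L * t <= N.+1%:R.
  by exists (Num.truncn (L * t)); apply/ltW/truncnS_gt.
have C0 : 0 < t -> 0 <= C.
  move=> tp; have := HX 0 t (lexx _) (ltW tp) (lexx _); move/(le_trans (normr_ge0 _)).
  by rewrite subr0 pmulr_lge0// exprn_gt0.
move: t0; rewrite le_eqVlt => /predU1P[<-//|tp]; have {}C0 := C0 tp.
apply: (@ler_harmonicP _ _ _ (C * t ^+ 2)) => n0.
(* Adding N ensures L h <= 1, because L t <= N + 1. *)
pose n := (n0 + N)%N.
have n_gt0 : 0 < n.+1%:R :> R by rewrite ltr0n.
pose h := t / n.+1%:R.
have h0 : 0 <= h by rewrite divr_ge0// ltW.
have hn : h * n.+1%:R = t by rewrite /h mulfVK ?gt_eqF.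
have Lh : L * h <= 1.
  rewrite /h mulrA ler_pdivrMr// mul1r; apply: (le_trans LN).
  by rewrite ler_nat ltnS leq_addl.
have H k : (k <= n.+1)%N -> X (h * k%:R) <= b + k%:R * (C * h ^+ 2).
  elim: k => [|k IH] kn; first by rewrite mulr0 mul0r addr0.
  have {}IH := IH (ltnW kn).
  have khn : h * k.+1%:R <= t by rewrite -hn ler_wpM2l// ler_nat.
  have kh : h * k%:R <= h * k.+1%:R by rewrite ler_wpM2l// ler_nat.
  have kh0 : 0 <= h * k%:R by rewrite mulr_ge0.
  have step : h * k.+1%:R - h * k%:R = h by rewrite -mulrBr -natrB// subSnn mulr1.
  have := HX _ _ kh0 kh khn; rewrite step ler_norml => /andP[_].
  set xs := X (h * k%:R) in IH *; set xr := X _ => E.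
  have Ch : 0 <= C * h ^+ 2 by rewrite mulr_ge0// sqr_ge0.
  have kCh : 0 <= k%:R * (C * h ^+ 2) by rewrite mulr_ge0.
  rewrite -natr1 mulrDl mul1r.
  have [xb|xb] := leP b xs.
    have : h * w xs <= 0 by rewrite mulr_ge0_le0// wb.
    by lra.
  have wx : w xs <= L * (b - xs).
    have := wL xs b; rewrite (@ltr0_norm _ (xs - b)) ?subr_lt0// opprB ler_norml => /andP[_].
    by have := wb b (lexx _); lra.
  have : h * w xs <= h * (L * (b - xs)) by rewrite ler_wpM2l.
  have : L * h * (b - xs) <= 1 * (b - xs) by rewrite ler_wpM2r// subr_ge0 ltW.
  by lra.
have := H n.+1 (leqnn _); rewrite hn => /le_trans; apply; rewrite lerD2l /h.
have -> : n.+1%:R * (C * (t / n.+1%:R) ^+ 2) = C * t ^+ 2 * n.+1%:R^-1.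
  by field; rewrite gt_eqF.
apply: ler_wpM2l; first by rewrite mulr_ge0// sqr_ge0.
rewrite lef_pV2 ?posrE ?ltr0n// ler_nat.
by rewrite ltnS leq_addr.
Qed.

End barrier.

(** * The flow projected on the unit interval *)

Section projected_flow.
Context {R : realType}.
Variables (w : I01 R -> R) (K L : R).
Hypotheses (wK : forall x, `|w x| <= K) (wL : lip_with L w).

Definition ext (w : I01 R -> R) : R -> R := w \o @proj01 R.

Definition pflow (w : I01 R -> R) (t : R) (x : I01 R) : I01 R :=
  proj01 (flow (ext w) (itv01_val x) t).

Let L0 : 0 <= L.
Proof.
have := wL (proj01 1) (proj01 0); rewrite [itv01_val _]clampK ?[itv01_val (proj01 0)]clampK ?in_itv/= ?lexx ?ler01//.
by rewrite subr0 normr1 mulr1; exact: le_trans.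
Qed.

Lemma ext_bound x : `|ext w x| <= K. Proof. exact: wK. Qed.

Lemma ext_lip x y : `|ext w x - ext w y| <= L * `|x - y|.
Proof. by apply: (le_trans (wL _ _)); rewrite ler_wpM2l//; exact: clamp_dist. Qed.

Let fdef := flow_defect ext_bound ext_lip.

Lemma clamp_ge1 (r : R) : 1 <= r -> clamp r = 1.
Proof. by move=> r1; rewrite /clamp min_r// max_r. Qed.

Lemma clamp_le0 (r : R) : r <= 0 -> clamp r = 0.
Proof. by move=> r0; rewrite /clamp min_l ?max_l// (le_trans r0). Qed.

Lemma flow_gt1 (x : I01 R) (t : R) : 0 <= t -> 1 < flow (ext w) (itv01_val x) t ->
  0 < w (proj01 1).
Proof.
move=> t0; rewrite [0 < _]ltNge; apply: contraTN => w1; rewrite -leNgt.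
apply: (@barrier _ (ext w) _ L (L * K) 1 t L0 t0 ext_lip).
- move=> y y1; rewrite /ext/= (_ : proj01 y = proj01 1)//.
  by apply: val_inj; rewrite /= !clamp_ge1.
- by move=> s r s0 sr _; exact: fdef.
- by rewrite flow0 itv01_le1.
Qed.

Lemma flow_lt0_itv (x : I01 R) (t : R) : 0 <= t -> flow (ext w) (itv01_val x) t < 0 ->
  w (proj01 0) < 0.
Proof.
move=> t0 y0; rewrite ltNge; apply/negP => w0.
move: y0; rewrite ltNge => /negP; apply.
(* Reflecting the line turns the lower barrier at 0 into an upper one. *)
rewrite -oppr_le0.
apply: (@barrier _ (fun y => - ext w (- y)) (fun t => - flow (ext w) (itv01_val x) t)
   L (L * K) 0 t L0 t0).
- by move=> r s; rewrite -opprD normrN (le_trans (ext_lip _ _))// -opprD normrN.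
- move=> y y0; rewrite oppr_le0 /ext/= (_ : proj01 (- y) = proj01 0)//.
  by apply: val_inj; rewrite /= !clamp_le0// oppr_le0.
- move=> s r s0 sr _; rewrite !opprK -normrN; set F := flow _ _.
  have -> : - (- F r + F s - (r - s) * - ext w (F s)) = F r - F s - (r - s) * ext w (F s) by ring.
  exact: fdef.
- by rewrite flow0 oppr_le0 itv01_ge0.
Qed.

Lemma flow_from_ge1 (y t : R) : 1 <= y -> 0 <= t -> 0 <= w (proj01 1) ->
  flow (ext w) y t = y + t * w (proj01 1).
Proof.
move=> y1 t0 w1; apply: (flow_affine ext_bound ext_lip) => // r /andP[r0 _].
rewrite /ext/=; congr w; apply: val_inj; rewrite /= !clamp_ge1//.
by rewrite (le_trans y1)// lerDl mulr_ge0.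
Qed.

Lemma flow_from_le0 (y t : R) : y <= 0 -> 0 <= t -> w (proj01 0) <= 0 ->
  flow (ext w) y t = y + t * w (proj01 0).
Proof.
move=> y1 t0 w1; apply: (flow_affine ext_bound ext_lip) => // r /andP[r0 _].
rewrite /ext/=; congr w; apply: val_inj; rewrite /= !clamp_le0//.
by rewrite (le_trans _ y1)// gerDl mulr_ge0_le0.
Qed.

Lemma pflow0 x : pflow w 0 x = x.
Proof. by rewrite /pflow flow0 proj01K. Qed.

(** The unprojected trajectory leaves [0,1] only through an endpoint where the field points strictly
    outwards; this sign controls what happens after the projection. *)
Lemma pflow_out (s : R) (x : I01 R) : 0 <= s ->
  [\/ itv01_val (pflow w s x) = flow (ext w) (itv01_val x) s,
      [/\ 1 < flow (ext w) (itv01_val x) s, itv01_val (pflow w s x) = 1 & 0 < w (proj01 1)]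
    | [/\ flow (ext w) (itv01_val x) s < 0, itv01_val (pflow w s x) = 0 & w (proj01 0) < 0]].
Proof.
move=> s0; rewrite /pflow/=; set y := flow _ _ _.
have [y1|y1] := ltP 1 y.
  by apply: Or32; split=> //; [exact: clamp_ge1 (ltW _)|exact: flow_gt1 y1].
have [y0|y0] := ltP y 0.
  by apply: Or33; split=> //; [exact: clamp_le0 (ltW _)|exact: flow_lt0_itv y0].
by apply: Or31; rewrite [LHS]clampK// in_itv/= y0 y1.
Qed.

(** After an exit, the unprojected trajectory and the one restarted at the endpoint both move
    affinely outwards, so both are projected on that endpoint. *)
Lemma pflowD (s t : R) x : 0 <= s -> 0 <= t -> pflow w (s + t) x = pflow w t (pflow w s x).
Proof.
move=> s0 t0; apply: val_inj; rewrite {1 2}/pflow/= (flowD ext_bound ext_lip)//.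
have [->//|[y1 -> w1]|[y1 -> w1]] := pflow_out x s0.
- rewrite (flow_from_ge1 (ltW y1) t0 (ltW w1)) (flow_from_ge1 (lexx 1) t0 (ltW w1)).
  rewrite !clamp_ge1//.
  + by rewrite lerDl mulr_ge0// ltW.
  + by rewrite (le_trans (ltW y1))// lerDl mulr_ge0// ltW.
- rewrite (flow_from_le0 (ltW y1) t0 (ltW w1)) (flow_from_le0 (lexx 0) t0 (ltW w1)).
  rewrite !clamp_le0//.
  + by rewrite gerDl mulr_ge0_le0// ltW.
  + by rewrite (le_trans _ (ltW y1))// gerDl mulr_ge0_le0// ltW.
Qed.

Lemma pflow_time_lip s t x :
  `|itv01_val (pflow w s x) - itv01_val (pflow w t x)| <= K * `|s - t|.
Proof. exact: le_trans (clamp_dist _ _) (flow_lip ext_bound ext_lip _ _ _). Qed.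

Lemma pflow_dist w' x y (d t : R) : 0 <= t -> (forall x, `|w' x| <= K) -> lip_with L w' ->
  (forall x, `|w x - w' x| <= d) ->
  `|itv01_val (pflow w t x) - itv01_val (pflow w' t y)| <=
    expR (L * t) * (`|itv01_val x - itv01_val y| + t * d).
Proof.
move=> t0 w'K w'L ww'; apply: le_trans (clamp_dist _ _) _.
apply: (flow_dist ext_bound ext_lip) => //.
- by move=> z; exact: w'K.
- by move=> a b; apply: (le_trans (w'L _ _)); rewrite ler_wpM2l//; exact: clamp_dist.
- by move=> z; exact: ww'.
Qed.

Lemma measurable_pflow (t : R) : 0 <= t -> measurable_fun setT (pflow w t).
Proof.
move=> t0; apply: measurable_to_itv01; apply: (@measurable_lip _ _ (expR (L * t))).
move=> x y /=; have := @pflow_dist w x y 0 t t0 wK wL.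
by rewrite mulr0 addr0; apply => z; rewrite subrr normr0.
Qed.

End projected_flow.

(** * Maximal solutions, exit time and identification of the stopped flow *)

Section stopped_flow.
Context {R : realType}.
Variables (w : I01 R -> R) (K L : R).
Hypotheses (wK : forall x, `|w x| <= K) (wL : lip_with L w).

Let K0 : 0 <= K. Proof. exact: le_trans (wK point). Qed.

Let L0 : 0 <= L.
Proof.
have := wL (proj01 1) (proj01 0); rewrite [itv01_val _]clampK ?[itv01_val (proj01 0)]clampK ?in_itv/= ?lexx ?ler01//.
by rewrite subr0 normr1 mulr1; exact: le_trans.
Qed.

Local Notation X x := (flow (ext w) (itv01_val x)).

Lemma is_solution_quotient x0 I x (t e : R) : is_solution w x0 I x -> I t -> 0 < e ->
  \forall s \near t, s != t -> I s ->
    `|itv01_val (x s) - itv01_val (x t) - (s - t) * w (x t)| <= e * `|s - t|.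
Proof.
move=> [_ _ _ _ dx] It e0.
have : \forall s \near t, s != t -> I s ->
    `|w (x t) - (itv01_val (x s) - itv01_val (x t)) / (s - t)| <= e.
  have /cvgrPdist_le/(_ e e0) := dx t It.
  exact.
apply: filterS => s H st Is; have {H} := H st Is.
have st0 : s - t != 0 by rewrite subr_eq0.
have -> : itv01_val (x s) - itv01_val (x t) - (s - t) * w (x t) =
   - ((w (x t) - (itv01_val (x s) - itv01_val (x t)) / (s - t)) * (s - t)) by field.
by rewrite normrN normrM => H; rewrite ler_wpM2r.
Qed.

(** The derivative relative to I is two-sided at the interior points of [s, t]. Continuity at s and
    t comes from the difference quotients, which are locally bounded by K + 1. *)
Lemma is_solution_MVT x0 I x (s t : R) : is_solution w x0 I x -> I s -> I t -> s < t ->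
  exists2 c, c \in `]s, t[ &
    itv01_val (x t) - itv01_val (x s) = w (x c) * (t - s).
Proof.
move=> sol Is It st; have [Iitv _ _ _ _] := sol.
have Icc c : s <= c <= t -> I c by apply: Iitv.
have near_lip c : I c -> \forall z \near c, I z ->
    `|itv01_val (x z) - itv01_val (x c)| <= (K + 1) * `|z - c|.
  move=> Ic; apply: filterS (is_solution_quotient sol Ic ltr01) => z H Iz.
  have [->|zc] := eqVneq z c; first by rewrite !subrr normr0 mulr0.
  rewrite -(subrK ((z - c) * w (x c)) (_ - _)).
  apply: (le_trans (ler_normD _ _)); rewrite addrC [(K + 1) * _]mulrDl; apply: lerD; last exact: H.
  by rewrite normrM mulrC ler_wpM2r.
have dxc c : c \in `]s, t[ -> is_derive c (1 : R) (fun z => itv01_val (x z)) (w (x c)).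
  rewrite in_itv/= => /andP[sc ct].
  have Ic : I c by apply: Icc; rewrite !ltW.
  apply/is_derive1_caratheodory.
  pose g z := if z == c then w (x c) else (itv01_val (x z) - itv01_val (x c)) / (z - c).
  exists g; split; last by rewrite /g eqxx.
    move=> z; rewrite /g; have [->|zc] := eqVneq z c; first by rewrite !subrr mulr0.
    by rewrite mulfVK// subr_eq0.
  apply/cvgrPdist_le => /= e e0; near=> z; rewrite /g eqxx.
  have [zc|zc] := eqVneq z c; first by rewrite subrr normr0 ltW.
  have zc0 : z - c != 0 by rewrite subr_eq0.
  have : `|itv01_val (x z) - itv01_val (x c) - (z - c) * w (x c)| <= e * `|z - c|.
    suff : I z by move: zc; near: z; exact: (is_solution_quotient sol Ic e0).
    apply: Icc; rewrite !ltW//; near: z; [exact: lt_nbhsl|exact: lt_nbhsr].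
  have -> : itv01_val (x z) - itv01_val (x c) - (z - c) * w (x c) =
    - ((w (x c) - (itv01_val (x z) - itv01_val (x c)) / (z - c)) * (z - c)) by field.
  by rewrite normrN normrM ler_pM2r// normr_gt0.
have K1 : 0 < K + 1 by rewrite ltr_wpDl.
have [] := @MVT _ (fun z => itv01_val (x z)) (fun z => w (x z)) s t st dxc; last first.
  by move=> c cst E; exists c.
apply/continuous_within_itvP => //; split.
- move=> c cst; apply: differentiable_continuous; apply/derivable1_diffP.
  by have [] := dxc c cst.
- apply/cvgrPdist_le => /= e e0; near=> z.
  have Iz : I z by apply: Icc; rewrite !ltW.
  have H : `|itv01_val (x z) - itv01_val (x s)| <= (K + 1) * `|z - s|.
    move: Iz; near: z; apply: cvg_within; exact: near_lip.
  rewrite distrC (le_trans H)// mulrC -ler_pdivlMr// ltW// distrC.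
  near: z; apply: cvg_within.
  by apply: (@nbhsx_ballx R R s (e / (K + 1))); rewrite divr_gt0.
- apply/cvgrPdist_le => /= e e0; near=> z.
  have Iz : I z by apply: Icc; rewrite !ltW.
  have H : `|itv01_val (x z) - itv01_val (x t)| <= (K + 1) * `|z - t|.
    move: Iz; near: z; apply: cvg_within; exact: near_lip.
  rewrite distrC (le_trans H)// mulrC -ler_pdivlMr// ltW// distrC.
  near: z; apply: cvg_within.
  by apply: (@nbhsx_ballx R R t (e / (K + 1))); rewrite divr_gt0.
Unshelve. all: by end_near. Qed.

(** By the mean value theorem a solution is K-Lipschitz, hence has quadratic defects with constant
    [L * K], and uniqueness applies. *)
Lemma is_solution_flow x0 I x (t : R) : is_solution w x0 I x -> I t ->
  X x0 t = itv01_val (x t).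
Proof.
move=> sol It; have [Iitv Ige I0 x00 _] := sol.
have t0 : 0 <= t by have := Ige t It; rewrite /= in_itv/= andbT.
have Icc c : 0 <= c -> c <= t -> I c by move=> c0 ct; apply: (Iitv 0 t); rewrite // c0.
have lipx s r : 0 <= s -> s <= r -> r <= t ->
    `|itv01_val (x r) - itv01_val (x s)| <= K * (r - s).
  move=> s0; rewrite le_eqVlt => /predU1P[->|sr rt]; first by rewrite !subrr normr0 mulr0.
  have Is : I s by apply: Icc => //; rewrite (le_trans (ltW sr)).
  have Ir : I r by apply: Icc => //; rewrite (le_trans s0)// ltW.
  have [c _ ->] := is_solution_MVT sol Is Ir sr.
  have rs0 : 0 <= r - s by rewrite subr_ge0 ltW.
  by rewrite normrM (ger0_norm rs0) ler_wpM2r.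
apply: (@flow_unique _ (ext w) K L (ext_bound wK) (ext_lip wL) _ (fun s => itv01_val (x s)) (L * K)) => //.
  by rewrite x00.
move=> s r s0; rewrite le_eqVlt => /predU1P[->|sr rt].
  by rewrite !subrr mul0r subrr normr0 expr2 !mulr0.
have Is : I s by apply: Icc => //; rewrite (le_trans (ltW sr)).
have Ir : I r by apply: Icc => //; rewrite (le_trans s0)// ltW.
have [c] := is_solution_MVT sol Is Ir sr; rewrite in_itv/= => /andP[sc cr] ->.
rewrite /ext/= proj01K -[Z in `|_ - Z|]mulrC -mulrBl normrM.
have rs0 : 0 <= r - s by rewrite subr_ge0 ltW.
rewrite (ger0_norm rs0) expr2 mulrA ler_wpM2r//; apply: (le_trans (wL _ _)).
rewrite -mulrA ler_wpM2l//; apply: (le_trans (lipx s c s0 (ltW sc) (le_trans (ltW cr) rt))).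
by rewrite ler_wpM2l// lerD2r ltW.
Qed.

(** This set turns out to be the maximal interval of existence from [x0]. *)
Definition stay (x0 : I01 R) : set R := [set t | 0 <= t /\ X x0 t \in `[0, 1]].

Lemma stay_val x0 (t : R) : stay x0 t -> itv01_val (pflow w t x0) = X x0 t.
Proof. by move=> [_ ?]; exact: clampK. Qed.

Lemma stay_le x0 (s t : R) : 0 <= s -> s <= t -> stay x0 t -> stay x0 s.
Proof.
move=> s0 st [t0]; rewrite in_itv/= => /andP[Xt0 Xt1]; split => //.
have ts : 0 <= t - s by rewrite subr_ge0.
have Et : X x0 t = flow (ext w) (X x0 s) (t - s).
  by rewrite -(flowD (ext_bound wK) (ext_lip wL))// subrKC.
rewrite in_itv/=; apply/andP; split; rewrite leNgt; apply/negP => Xs.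
- have w0 := flow_lt0_itv wK wL s0 Xs.
  move: Xt0; rewrite leNgt Et (flow_from_le0 wK wL (ltW Xs) ts (ltW w0)) => /negP; apply.
  by have := mulr_ge0_le0 ts (ltW w0); lra.
- have w1 := flow_gt1 wK wL s0 Xs.
  move: Xt1; rewrite leNgt Et (flow_from_ge1 wK wL (ltW Xs) ts (ltW w1)) => /negP; apply.
  by have := mulr_ge0 ts (ltW w1); lra.
Qed.

Lemma stay_solution x0 : is_solution w x0 (stay x0) (pflow w ^~ x0).
Proof.
split.
- move=> s t /= Is It r /andP[sr rt]; apply: stay_le rt It.
  by case: Is => s0 _; exact: le_trans sr.
- by move=> t [t0 _]; rewrite /= in_itv/= t0.
- by split => //; rewrite flow0; exact: valP.
- exact: pflow0.
- move=> t It; have t0 : 0 <= t by case: It.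
  apply/cvgrPdist_le => /= e e0.
  have LK0 : 0 <= L * K by exact: mulr_ge0.
  have near_t : \forall s \near t, `|s - t| < e / (2 * (L * K) + 1).
    have := @nbhsx_ballx R R t (e / (2 * (L * K) + 1)); rewrite divr_gt0 ?ltr_wpDl ?mulr_ge0// => /(_ isT).
    by apply: filterS => s; rewrite /ball/= distrC.
  suff : \forall s \near t, s != t -> stay x0 s ->
     `|w (pflow w t x0) -
    (itv01_val (pflow w s x0) - itv01_val (pflow w t x0)) / (s - t)| <= e by exact.
  apply: filterS near_t => s st_e st Is; have s0 : 0 <= s by case: Is.
  rewrite !stay_val// -[w (pflow w t x0)]/(ext w (X x0 t)).
  have st0 : s - t != 0 by rewrite subr_eq0.
  rewrite -(ler_pM2r (x := `|s - t|)) ?normr_gt0// -normrM mulrBl mulfVK//.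
  have D := flow_defect (ext_bound wK) (ext_lip wL) (itv01_val x0).
  apply: (@le_trans _ _ (2 * (L * K) * `|s - t| * `|s - t|)); last first.
    rewrite ler_wpM2r//; move: st_e; rewrite ltr_pdivlMr ?ltr_wpDl ?mulr_ge0//.
    by have := normr_ge0 (s - t); lra.
  have sq0 : 0 <= L * K * (`|s - t| * `|s - t|) by rewrite !mulr_ge0.
  have [ts|/ltW ts] := leP t s.
    have := D t s t0 ts; rewrite -normrN expr2.
    rewrite -[(s - t) * (s - t)]ger0_norm -?expr2 ?sqr_ge0// normrX expr2.
    have -> : - (X x0 s - X x0 t - (s - t) * ext w (X x0 t)) =
       ext w (X x0 t) * (s - t) - (X x0 s - X x0 t) by ring.
    by lra.
  (* For s < t the defect is based at s; replacing the field at s by its value at t costs a second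
     [L * K], whence the factor 2 in the choice of the neighbourhood. *)
  have := D s t s0 ts; rewrite expr2.
  rewrite -[(t - s) * (t - s)]ger0_norm -?expr2 ?sqr_ge0// normrX expr2 (distrC t s) => H.
  have Hw : `|(ext w (X x0 t) - ext w (X x0 s)) * (s - t)| <= L * K * (`|s - t| * `|s - t|).
    rewrite normrM mulrA ler_wpM2r//; apply: (le_trans (ext_lip wL _ _)).
    rewrite -mulrA ler_wpM2l//; apply: (le_trans (flow_lip (ext_bound wK) (ext_lip wL) _ _ _)).
    by rewrite distrC.
  have -> : ext w (X x0 t) * (s - t) - (X x0 s - X x0 t) =
    (X x0 t - X x0 s - (t - s) * ext w (X x0 s)) + (ext w (X x0 t) - ext w (X x0 s)) * (s - t) by ring.
  by have := le_trans (ler_normD _ _) (lerD H Hw); lra.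
Qed.

Lemma is_solution_stay x0 I x : is_solution w x0 I x ->
  I `<=` stay x0 /\ {in I, x =1 (pflow w ^~ x0)}.
Proof.
move=> sol; have [_ Ige _ _ _] := sol.
have H t : I t -> stay x0 t.
  move=> It; split; last by rewrite (is_solution_flow sol It); exact: valP.
  by have := Ige t It; rewrite /= in_itv/= andbT.
split=> // t /set_mem It; apply: val_inj.
by rewrite -[RHS]/(itv01_val _) (stay_val (H t It)) (is_solution_flow sol It).
Qed.

(** Every solution is a restriction of the projected flow on [stay x0], which is itself a solution;
    a maximal one is therefore defined on all of it. *)
Lemma maximal_solutionE x0 : (maximal_solution w x0).1 = stay x0 /\
  {in stay x0, (maximal_solution w x0).2 =1 (pflow w ^~ x0)}.
Proof.
have : is_maximal_solution w x0 (maximal_solution w x0).1 (maximal_solution w x0).2.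
  apply: (@xgetPex {classic (set R * (R -> I01 R))} ([set 0], fun=> x0)
    [set Ix | is_maximal_solution w x0 Ix.1 Ix.2]).
  exists (stay x0, pflow w ^~ x0); split; first exact: stay_solution.
  by move=> J y solJ _ _; have [] := is_solution_stay solJ.
case: (maximal_solution w x0) => J y /= [sol mx].
have [JI yx] := is_solution_stay sol.
have IJ : stay x0 `<=` J by apply: mx JI yx; exact: stay_solution.
by have E : J = stay x0 by [apply/seteqP]; rewrite -E.
Qed.

(** Let t be past the exit time [tau], which lies in the closed set [stay x0]. Between [tau] and t
    the trajectory takes the value of the endpoint beyond which it lies at t; it does so at a time
    of [stay x0], hence at [tau], and the stopped position is the projection. *)
Lemma stopped_flowE (t : R) x0 : 0 <= t -> stopped_flow w t x0 = pflow w t x0.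
Proof.
move=> t0; rewrite /stopped_flow /exit_time.
have [] := maximal_solutionE x0; case: (maximal_solution w x0) => J y /= -> yx.
case: ifPn => [/set_mem It|tI]; first by rewrite yx ?inE.
have {tI} : ~ stay x0 t by move=> It; move: tI; rewrite mem_set.
move=> tI.
have I0 : stay x0 0 by split => //; rewrite flow0; exact: valP.
have ubI : ubound (stay x0) t.
  by move=> s Is; rewrite leNgt; apply/negP => /ltW ts; apply: tI; exact: stay_le ts Is.
have hsI : has_sup (stay x0) by split; [exists 0|exists t].
pose tau := sup (stay x0).
have -> : fine (ereal_sup [set s%:E | s in stay x0]) = tau by rewrite ereal_sup_EFin//; case: hsI.
have cX : continuous (X x0).
  exact: (lipschitz_continuous (flow_lip (ext_bound wK) (ext_lip wL) _)).
have tau_in : stay x0 tau.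
  have clI : closed (stay x0).
    have -> : stay x0 = `[0, +oo[ `&` (X x0 @^-1` `[0, 1]).
      by apply/seteqP; split => s /=; rewrite [s \in `[0, +oo[]in_itv/= andbT.
    apply: closedI; first exact: interval_closed.
    by apply: closed_comp => [s _|]; [exact: cX|exact: interval_closed].
  by have [nI uI] := hsI; have := closure_sup nI uI; rewrite -((closure_id _).1 clI).
rewrite yx ?inE//; apply: val_inj; rewrite -[LHS]/(itv01_val _) (stay_val tau_in) /=.
have taut : tau <= t by apply: ge_sup => //; exists 0.
have [_ ] := tau_in; rewrite in_itv/= => /andP[Xtau0 Xtau1].
have last_in c : c \in `[tau, t] -> X x0 c \in `[0, 1] -> c = tau.
  rewrite in_itv/= => /andP[tauc ct] Xc; apply/eqP; rewrite eq_le tauc andbT.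
  apply: ub_le_sup; first by exists t.
  by split => //; apply: le_trans tauc; case: tau_in.
have cXt : {within `[tau, t], continuous (X x0)} by exact: continuous_subspaceT.
have [Xt1|Xt1] := ltP 1 (X x0 t).
  rewrite clamp_ge1 ?ltW//.
  have [|c cin Xc1] := IVT (v := 1) taut cXt.
    by rewrite ge_min Xtau1/= le_max (ltW Xt1) orbT.
  by rewrite -(last_in c cin)// Xc1 in_itv/= ler01 lexx.
have [Xt0|Xt0] := ltP (X x0 t) 0; last first.
  by exfalso; apply: tI; split => //; rewrite in_itv/= Xt0.
rewrite clamp_le0 ?ltW//.
have [|c cin Xc1] := IVT (v := 0) taut cXt.
  by rewrite ge_min (ltW Xt0) orbT/= le_max Xtau0.
by rewrite -(last_in c cin)// Xc1 in_itv/= ler01 lexx.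
Qed.

End stopped_flow.

(** * Weighted push-forwards *)

Section exponential_bounds.
Context {R : realType}.
Implicit Types x y B : R.

Lemma expR_sub_le x y : expR x - expR y <= (x - y) * expR x.
Proof.
have := expR_ge1Dx (y - x); rewrite expRD expRN => H.
have e0 := expR_gt0 x.
have : (1 + (y - x)) * expR x <= expR y / expR x * expR x by rewrite ler_pM2r.
rewrite mulfVK ?gt_eqF//; lra.
Qed.

Lemma expR_dist x y B : x <= B -> y <= B ->
  `|expR x - expR y| <= expR B * `|x - y|.
Proof.
wlog xy : x y / y <= x.
  move=> H xB yB; have [yx|/ltW xy] := leP y x; first exact: H.
  by rewrite distrC (distrC x); exact: H.
move=> xB _; rewrite !ger0_norm ?subr_ge0 ?ler_expR//.
by apply: (le_trans (expR_sub_le _ _)); rewrite mulrC ler_wpM2r ?ler_expR// subr_ge0.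
Qed.

(** The tangent inequalities at x and at y place the defect between 0 and (x - y)(exp x - exp y). *)
Lemma expR_defect x y B : x <= B -> y <= B ->
  `|expR x - expR y - (x - y) * expR y| <= expR B * (x - y) ^+ 2.
Proof.
move=> xB yB.
have H := expR_sub_le x y.
have H' : (x - y) * expR y <= expR x - expR y.
  have := expR_ge1Dx (x - y); rewrite expRD expRN => K.
  have e0 := expR_gt0 y.
  have : (1 + (x - y)) * expR y <= expR x / expR y * expR y by rewrite ler_pM2r.
  by rewrite mulfVK ?gt_eqF//; lra.
rewrite ger0_norm ?subr_ge0//; apply: (@le_trans _ _ ((x - y) * (expR x - expR y))); first by lra.
apply: (le_trans (ler_norm _)); rewrite normrM -[(x - y) ^+ 2]ger0_norm ?sqr_ge0// normrX expr2 mulrCA ler_wpM2l//.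
exact: expR_dist.
Qed.

End exponential_bounds.

Section weighted_pushforward.
Context {R : realType}.
Implicit Types (nu : Meas R) (F : I01 R -> I01 R) (A : I01 R -> R) (phi : I01 R -> R).

Definition wpush F A nu : Meas R :=
  mkMeas (pushforward (densityM (expR \o A) nu) F).

Lemma bounded_mfun_expR A : bounded_mfun A -> bounded_mfun (expR \o A).
Proof.
move=> [mA [B AB]]; split; first by apply: measurableT_comp => //; exact: measurable_expR.
exists (expR B) => x /=; rewrite ger0_norm ?expR_ge0// ler_expR.
exact: le_trans (ler_norm _) (AB x).
Qed.

Lemma pairing_wpush F A nu phi : measurable_fun setT F -> bounded_mfun A ->
  bounded_mfun phi ->
  pairing (wpush F A nu) phi = pairing nu (fun x => expR (A x) * phi (F x)).
Proof.
move=> mF bA bphi; rewrite /wpush pairing_pushforward// pairing_density//.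
- exact: bounded_mfun_expR.
- exact: bounded_mfun_comp.
Qed.

Lemma normTV_wpush F A nu (B : R) : measurable_fun setT F -> measurable_fun setT A ->
  (forall x, `|A x| <= B) ->
  (normTV (wpush F A nu) <= (fine (normTV nu) * expR B)%:E)%E.
Proof.
move=> mF mA AB; have bA : bounded_mfun A by split=> //; exists B.
apply: normTV_le => psi bpsi psi1; rewrite pairing_wpush//.
apply: (le_trans (ler_norm _)); apply: le_normr_pairing => [|x].
  apply: bounded_mfunM; first exact: bounded_mfun_expR.
  exact: (bounded_mfun_comp bpsi mF).
rewrite normrM -[leRHS]mulr1 ler_pM// ger0_norm ?expR_ge0// ler_expR.
exact: le_trans (ler_norm _) (AB x).
Qed.

Lemma positive_wpush F A nu : measurable_fun setT F -> bounded_mfun A ->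
  positiveM nu -> positiveM (wpush F A nu).
Proof.
move=> mF bA nu0 C mC; rewrite -(fineK (fin_num_measure _ _ mC)) lee_fin.
rewrite -pairing_indic// pairing_wpush//; last exact: bounded_mfun_indic.
apply: positive_pairing_ge0 => //.
  apply: bounded_mfunM; first exact: bounded_mfun_expR.
  exact: (bounded_mfun_comp (bounded_mfun_indic R mC) mF).
Qed.

(** The Lipschitz constant of a test function multiplies the displacement of points and its sup norm
    the change of weight; both are at most 1, which is why the two distances are added. *)
Lemma distBL_wpush F A F' A' nu (B d : R) :
  measurable_fun setT F -> measurable_fun setT A ->
  measurable_fun setT F' -> measurable_fun setT A' ->
  (forall x, `|A x| <= B) -> (forall x, `|A' x| <= B) ->
  (forall x, `|itv01_val (F x) - itv01_val (F' x)| + `|A x - A' x| <= d) ->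
  (distBL (wpush F A nu) (wpush F' A' nu) <= (fine (normTV nu) * (expR B * d))%:E)%E.
Proof.
move=> mF mA mF' mA' AB AB' Hd.
have bA : bounded_mfun A by split=> //; exists B.
have bA' : bounded_mfun A' by split=> //; exists B.
apply: dual_norm_le => phi /BL_le1P[a [b [a0 b0 ab fa fb]]].
have bf := lip_bounded_mfun fa fb.
rewrite /= !pairing_wpush// -bounded_linear_onB//; last 3 first.
- exact: bounded_linear_pairing.
- by apply: bounded_mfunM; [exact: bounded_mfun_expR|exact: (bounded_mfun_comp bf mF)].
- by apply: bounded_mfunM; [exact: bounded_mfun_expR|exact: (bounded_mfun_comp bf mF')].
apply: le_normr_pairing.
  apply: bounded_mfunB.
  - by apply: bounded_mfunM; [exact: bounded_mfun_expR|exact: (bounded_mfun_comp bf mF)].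
  - by apply: bounded_mfunM; [exact: bounded_mfun_expR|exact: (bounded_mfun_comp bf mF')].
move=> x.
have -> : expR (A x) * phi (F x) - expR (A' x) * phi (F' x) =
  expR (A x) * (phi (F x) - phi (F' x)) + (expR (A x) - expR (A' x)) * phi (F' x) by ring.
have Ax : A x <= B by apply: le_trans (ler_norm _) (AB x).
have Ax' : A' x <= B by apply: le_trans (ler_norm _) (AB' x).
apply: (le_trans (ler_normD _ _)); rewrite !normrM (ger0_norm (expR_ge0 _)).
have E1 : expR (A x) * `|phi (F x) - phi (F' x)| <=
    expR B * (b * `|itv01_val (F x) - itv01_val (F' x)|).
  by apply: ler_pM; rewrite ?expR_ge0// ler_expR.
have E2 : `|expR (A x) - expR (A' x)| * `|phi (F' x)| <= expR B * `|A x - A' x| * a.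
  by apply: ler_pM => //; exact: expR_dist.
apply: (le_trans (lerD E1 E2)); rewrite -mulrA -mulrDr ler_wpM2l ?expR_ge0//.
apply: le_trans (Hd x); apply: lerD.
  by rewrite ler_piMl//; lra.
by rewrite ler_piMr//; lra.
Qed.

End weighted_pushforward.

(** * The logarithmic weight along characteristics *)

Section growth_weight.
Context {R : realType}.
Variables (w f : I01 R -> R) (K L F Lf : R).
Hypotheses (wK : forall x, `|w x| <= K) (wL : lip_with L w).
Hypotheses (fF : forall x, `|f x| <= F) (fL : lip_with Lf f) (Lf0 : 0 <= Lf).

Definition weight (w f : I01 R -> R) (t : R) (x : I01 R) : R :=
  prim (fun s => f (pflow w s x)) t.

Lemma continuous_pflow_obs x : continuous (fun s : R => f (pflow w s x)).
Proof.
apply: (@lipschitz_continuous _ _ (Lf * K)) => r s; apply: (le_trans (fL _ _)).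
by rewrite -mulrA ler_wpM2l//; exact: pflow_time_lip.
Qed.

Lemma weight0 x : weight w f 0 x = 0.
Proof. exact: prim0. Qed.

Lemma weight_time_lip (s t : R) x : `|weight w f s x - weight w f t x| <= F * `|s - t|.
Proof. by apply: prim_lip; [exact: continuous_pflow_obs|move=> r; exact: fF]. Qed.

Lemma weight_bound (t : R) x : 0 <= t -> `|weight w f t x| <= F * t.
Proof. by move=> t0; have := weight_time_lip t 0 x; rewrite weight0 !subr0 (ger0_norm t0). Qed.

Lemma weight_defect (s t : R) x : 0 <= s -> s <= t ->
  `|weight w f t x - weight w f s x - (t - s) * f (pflow w s x)| <=
     Lf * K * (t - s) ^+ 2.
Proof.
move=> s0 st; have -> : Lf * K * (t - s) ^+ 2 = (t - s) * (Lf * (K * (t - s))) by ring.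
apply: prim_dist => //; first exact: continuous_pflow_obs.
move=> r /andP[sr rt]; apply: (le_trans (fL _ _)); rewrite ler_wpM2l//.
apply: (le_trans (pflow_time_lip wK wL _ _ _)).
have K0 : 0 <= K by apply: le_trans (wK point).
by rewrite ler_wpM2l// ger0_norm; lra.
Qed.

(** D is compared with the constant curve [D 0] by Gronwall, both fields being zero. *)
Lemma quadratic_increments_constant (D : R -> R) (C t : R) : 0 <= t ->
  (forall s r, 0 <= s -> s <= r -> r <= t -> `|D r - D s| <= C * (r - s) ^+ 2) ->
  D t = D 0.
Proof.
move=> t0 HD; apply/eqP; rewrite -subr_eq0 -normr_le0.
have := @defect_gronwall _ (cst 0) (cst 0) D (cst (D 0)) 0 `|C| 0 t (lexx _) t0 _ _ _ _.
rewrite subrr normr0 mulr0 addr0 mulr0; apply.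
- by move=> x y; rewrite subrr normr0 mul0r.
- move=> s r s0 sr rt; rewrite mulr0 subr0 (le_trans (HD _ _ s0 sr rt))//.
  by rewrite ler_wpM2r ?sqr_ge0// ler_norm.
- by move=> s r s0 sr rt; rewrite /= mulr0 subr0 normr0 mulr_ge0// sqr_ge0.
- by move=> s _; rewrite subrr normr0.
Qed.

(** By the semigroup property, the increments in t of [weight w f (s + t) x] and of the last summand
    are given by [f] at the same point, up to quadratic errors; their difference is constant. This
    replaces a change of variables in the integral. *)
Lemma weightD (s t : R) x : 0 <= s -> 0 <= t ->
  weight w f (s + t) x = weight w f s x + weight w f t (pflow w s x).
Proof.
move=> s0 t0.
pose D r := weight w f (s + r) x - weight w f r (pflow w s x).
have := @quadratic_increments_constant D (2 * (Lf * K)) t t0.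
rewrite /D addr0 weight0 subr0 => H; rewrite -[LHS](subrK (weight w f t (pflow w s x))).
rewrite H// => q r q0 qr rt.
have := @weight_defect (s + q) (s + r) x (addr_ge0 s0 q0).
rewrite lerD2l opprD addrACA subrr add0r => /(_ qr).
have := weight_defect (pflow w s x) q0 qr.
rewrite (pflowD wK wL)// => W1 W2.
have := le_trans (ler_normB _ _) (lerD W2 W1).
have -> : weight w f (s + r) x - weight w f (s + q) x - (r - q) * f (pflow w q (pflow w s x)) -
  (weight w f r (pflow w s x) - weight w f q (pflow w s x) -
   (r - q) * f (pflow w q (pflow w s x))) =
   weight w f (s + r) x - weight w f r (pflow w s x) -
   (weight w f (s + q) x - weight w f q (pflow w s x)) by ring.
by move=> /le_trans; apply; lra.
Qed.

Lemma weight_dist w' x y (d t : R) : 0 <= t -> (forall x, `|w' x| <= K) -> lip_with L w' ->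
  (forall x, `|w x - w' x| <= d) ->
  `|weight w f t x - weight w' f t y| <=
    t * Lf * (expR (L * t) * (`|itv01_val x - itv01_val y| + t * d)).
Proof.
move=> t0 w'K w'L ww'.
have d0 : 0 <= d by apply: le_trans (ww' point).
have L0 : 0 <= L.
  have := wL (proj01 1) (proj01 0).
  rewrite [itv01_val _]clampK ?[itv01_val (proj01 0)]clampK ?in_itv/= ?lexx ?ler01//.
  by rewrite subr0 normr1 mulr1; exact: le_trans.
have c' : continuous (fun s : R => f (pflow w' s y)).
  apply: (@lipschitz_continuous _ _ (Lf * K)) => r s; apply: (le_trans (fL _ _)).
  by rewrite -mulrA ler_wpM2l//; exact: pflow_time_lip.
rewrite /weight -primB//; last exact: continuous_pflow_obs.
have cd : continuous (fun s : R => f (pflow w s x) - f (pflow w' s y)).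
  by move=> r; apply: continuousB; [exact: continuous_pflow_obs|exact: c'].
have := @prim_dist _ _ 0 t 0 (Lf * (expR (L * t) * (`|itv01_val x - itv01_val y| + t * d))) cd (lexx _) t0 _.
rewrite prim0 mulr0 !subr0 -mulrA; apply => r /andP[r0 rt]; rewrite subr0.
apply: (le_trans (fL _ _)); rewrite ler_wpM2l//.
apply: (le_trans (pflow_dist wK wL _ _ r0 w'K w'L ww')).
by apply: ler_pM; rewrite ?expR_ge0 ?addr_ge0 ?mulr_ge0// ?ler_expR ?lerD2l ?ler_wpM2l ?ler_wpM2r.
Qed.

Lemma measurable_weight (t : R) : 0 <= t -> measurable_fun setT (weight w f t).
Proof.
move=> t0; apply: (@measurable_lip _ _ (t * Lf * expR (L * t))) => x y.
have := @weight_dist w x y 0 t t0 wK wL; rewrite mulr0 addr0 mulrA; apply => z.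
by rewrite subrr normr0.
Qed.

Lemma bounded_mfun_weight (t : R) : 0 <= t -> bounded_mfun (weight w f t).
Proof.
by move=> t0; split; [exact: measurable_weight|exists (F * t) => x; exact: weight_bound].
Qed.

End growth_weight.

(** * Solution operator for a fixed velocity *)

(** The integral of a nonnegative function is a supremum over the simple functions below it, hence
    monotone without measurability. It is applied to dual norms, which are suprema over an
    uncountable family and whose measurability is not established. *)
Lemma ge0_le_integral_nonmeasurable d (T : measurableType d) (R : realType)
    (m : {measure set T -> \bar R}) (D : set T) (g h : T -> \bar R) :
  (forall x, D x -> 0 <= g x)%E -> (forall x, D x -> g x <= h x)%E ->
  (\int[m]_(x in D) g x <= \int[m]_(x in D) h x)%E.
Proof.
move=> g0 gh; rewrite !ge0_integralE//; last by move=> x Dx; apply: le_trans (gh x Dx); exact: g0.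
apply: le_ereal_sup => _ /= [s sg <-]; exists s => // x; apply: (le_trans (sg x)).
by rewrite !patchE; case: ifPn => // /set_mem; exact: gh.
Qed.

Section continuity_criteria.
Context {R : realType}.

Lemma squeeze_cvge0 (X : Type) (Fi : set_system X) (g : X -> \bar R) (h : X -> R) :
  Filter Fi -> (forall x, 0 <= g x)%E -> (\forall x \near Fi, g x <= (h x)%:E)%E ->
  h x @[x --> Fi] --> 0 -> g x @[x --> Fi] --> 0%E.
Proof.
move=> FFi g0 gh h0; apply: (@squeeze_cvge _ _ _ _ (cst 0%E) _ (EFin \o h)).
- by apply: filterS gh => x ->; rewrite g0.
- exact: cvg_cst.
- by apply: cvg_EFin => //; exact: nearW.
Qed.

Lemma lipschitz_continuousBL (T C : R) (mu : R -> Meas R) :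
  (forall s t : R, s \in `[0, T] -> t \in `[0, T] ->
    (distBL (mu s) (mu t) <= (C * `|s - t|)%:E)%E) ->
  continuousBL T mu.
Proof.
move=> H t tT; apply: (@squeeze_cvge0 _ _ _ (fun s => C * `|s - t|)).
- by move=> s; exact: dual_norm_ge0.
- by near=> s; apply: H => //; near: s; exact: withinT.
- have cn : C * `|s - t| @[s --> t] --> C * `|t - t|.
    apply: cvgM; first exact: cvg_cst.
    by apply: cvg_norm; apply: cvgB; [exact: cvg_id|exact: cvg_cst].
  rewrite subrr normr0 mulr0 in cn; exact: cvg_within_filter.
Unshelve. all: by end_near. Qed.

End continuity_criteria.

(** * Existence for a fixed velocity *)

Section fixed_velocity.
Context {R : realType}.
Variables (w f : I01 R -> R) (K L F Lf : R).
Hypotheses (wK : forall x, `|w x| <= K) (wL : lip_with L w).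
Hypotheses (fF : forall x, `|f x| <= F) (fL : lip_with Lf f) (Lf0 : 0 <= Lf).
Variable nu : Meas R.

Let K0 : 0 <= K. Proof. exact: le_trans (wK point). Qed.
Let F0 : 0 <= F. Proof. exact: le_trans (fF point). Qed.

Definition fvsol (w f : I01 R -> R) (nu : Meas R) (t : R) : Meas R :=
  wpush (pflow w t) (weight w f t) nu.

Let mpflow (t : R) : 0 <= t -> measurable_fun setT (pflow w t).
Proof. exact: (measurable_pflow wK wL). Qed.

Let bweight (t : R) : 0 <= t -> bounded_mfun (weight w f t).
Proof. exact: (bounded_mfun_weight wK wL fF fL Lf0). Qed.

Let bf : bounded_mfun f. Proof. exact: (lip_bounded_mfun fF fL). Qed.

Lemma fvsol_dist (T s t : R) : s \in `[0, T] -> t \in `[0, T] ->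
  (distBL (fvsol w f nu s) (fvsol w f nu t) <=
    (fine (normTV nu) * (expR (F * T) * (K + F)) * `|s - t|)%:E)%E.
Proof.
rewrite !in_itv/= => /andP[s0 sT] /andP[t0 tT].
rewrite -!mulrA; apply: distBL_wpush.
- exact: mpflow.
- by case: (bweight s0).
- exact: mpflow.
- by case: (bweight t0).
- move=> x; apply: (le_trans (weight_bound wK wL fF fL Lf0 x s0)).
  by rewrite ler_wpM2l.
- move=> x; apply: (le_trans (weight_bound wK wL fF fL Lf0 x t0)).
  by rewrite ler_wpM2l.
- move=> x; rewrite mulrDl; apply: lerD.
    exact: pflow_time_lip.
  exact: (weight_time_lip wK wL fF fL Lf0).
Qed.

Lemma transportE (t : R) mu : 0 <= t -> transport w t mu = mkMeas (pushforward mu (pflow w t)).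
Proof.
move=> t0; rewrite /transport; congr (mkMeas (pushforward _ _)).
by apply/funext => x; exact: (stopped_flowE wK wL).
Qed.

Lemma pairing_transport_density (t : R) mu phi : 0 <= t -> bounded_mfun phi ->
  pairing (transport w t (densityM f mu)) phi =
  pairing mu (fun x => f x * phi (pflow w t x)).
Proof.
move=> t0 bphi; rewrite transportE// pairing_pushforward//; last exact: mpflow.
by rewrite pairing_density//; apply: bounded_mfun_comp => //; exact: mpflow.
Qed.

(** The time derivative of [expR (weight w f s x)]. *)
Definition wrate (s : R) (x : I01 R) : R := expR (weight w f s x) * f (pflow w s x).

Let bwrate (s : R) : 0 <= s -> bounded_mfun (wrate s).
Proof.
move=> s0; apply: bounded_mfunM.
  exact: (bounded_mfun_expR (bweight s0)).
exact: (bounded_mfun_comp bf (mpflow s0)).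
Qed.

(** Flowing for time s and then t - s amounts to flowing for time t, so the test function is
    evaluated at a point independent of s. What remains to integrate is the scalar [wrate s x]. *)
Lemma duhamel_integrandE (s t : R) phi : 0 <= s -> s <= t -> bounded_mfun phi ->
  pairing (transport w (t - s) (densityM f (fvsol w f nu s))) phi =
  pairing nu (fun x => wrate s x * phi (pflow w t x)).
Proof.
move=> s0 st bphi; have ts0 : 0 <= t - s by rewrite subr_ge0.
rewrite pairing_transport_density// /fvsol pairing_wpush//; first last.
- by apply: bounded_mfunM => //; exact: (bounded_mfun_comp bphi (mpflow ts0)).
- exact: bweight.
- exact: mpflow.
congr pairing; apply/funext => x; rewrite /wrate mulrA -(pflowD wK wL)//.
by rewrite subrKC.
Qed.

Let B t := expR (F * t) * (F ^+ 2 + Lf * K).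

Let B0 t : 0 <= B t.
Proof. by rewrite mulr_ge0 ?expR_ge0// addr_ge0 ?sqr_ge0// mulr_ge0. Qed.

Let weight_le (s t : R) x : 0 <= s -> s <= t -> weight w f s x <= F * t.
Proof.
move=> s0 st; apply: le_trans (ler_norm _) _.
by apply: (le_trans (weight_bound wK wL fF fL Lf0 x s0)); rewrite ler_wpM2l.
Qed.

Lemma wrate_lip (t r q : R) x : 0 <= r -> r <= t -> 0 <= q -> q <= t ->
  `|wrate r x - wrate q x| <= B t * `|r - q|.
Proof.
move=> r0 rt q0 qt; rewrite /wrate.
have -> : expR (weight w f r x) * f (pflow w r x) - expR (weight w f q x) * f (pflow w q x) =
  (expR (weight w f r x) - expR (weight w f q x)) * f (pflow w r x) +
  expR (weight w f q x) * (f (pflow w r x) - f (pflow w q x)).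
  by move: (expR _) (expR _) (f _) (f _) => a b c d; ring.
apply: (le_trans (ler_normD _ _)).
rewrite /B !normrM (ger0_norm (expR_ge0 _)) -mulrA mulrDl mulrDr; apply: lerD.
  have -> : expR (F * t) * (F ^+ 2 * `|r - q|) = expR (F * t) * (F * `|r - q|) * F by ring.
  apply: ler_pM => //; apply: (le_trans (expR_dist (weight_le x r0 rt) (weight_le x q0 qt))).
  by rewrite ler_wpM2l ?expR_ge0//; exact: (weight_time_lip wK wL fF fL Lf0).
apply: ler_pM; rewrite ?expR_ge0//; first by rewrite ler_expR weight_le.
apply: (le_trans (fL _ _)); rewrite -mulrA ler_wpM2l//; exact: pflow_time_lip.
Qed.

Lemma expR_weight_defect (t q r : R) x : 0 <= q -> q <= r -> r <= t ->
  `|expR (weight w f r x) - expR (weight w f q x) - (r - q) * wrate q x| <= B t * (r - q) ^+ 2.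
Proof.
move=> q0 qr rt; rewrite /wrate.
set a := weight w f r x; set b := weight w f q x.
have -> : expR a - expR b - (r - q) * (expR b * f (pflow w q x)) =
  (expR a - expR b - (a - b) * expR b) + expR b * (a - b - (r - q) * f (pflow w q x)).
  by move: (expR a) (expR b) (f _) => u v c; ring.
have aB := weight_le x (le_trans q0 qr) rt; have bB := weight_le x q0 (le_trans qr rt).
have -> : B t * (r - q) ^+ 2 =
    expR (F * t) * (F * (r - q)) ^+ 2 + expR (F * t) * (Lf * K * (r - q) ^+ 2).
  by rewrite /B; move: (expR _) => u; ring.
apply: (le_trans (ler_normD _ _)); apply: lerD.
  apply: (le_trans (expR_defect aB bB)); rewrite ler_wpM2l ?expR_ge0//.
  have := weight_time_lip wK wL fF fL Lf0 r q x; rewrite -/a -/b.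
  have rq0 : 0 <= r - q by rewrite subr_ge0.
  rewrite -[(a - b) ^+ 2]ger0_norm ?sqr_ge0// normrX (ger0_norm rq0) => H.
  by rewrite lerXn2r// nnegrE mulr_ge0.
rewrite normrM (ger0_norm (expR_ge0 _)); apply: ler_pM; rewrite ?expR_ge0 ?ler_expR//.
by apply: (weight_defect wK wL fL Lf0).
Qed.

Section riemann_sums.
Variable t : R.
Hypothesis t0 : 0 <= t.

Let g (s : R) : @dualBL R := pairing (transport w (t - s) (densityM f (fvsol w f nu s))).

(** With t + 1 instead of t, the step is positive even for t = 0, and the [n.+1] half-open cells
    cover [0, t] with its right end. Nodes are truncated at t. *)
Let h (n : nat) : R := (t + 1) / n.+1%:R.

Let h0 n : 0 < h n. Proof. by rewrite divr_gt0// ltr_wpDl. Qed.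

Let node n (i : nat) : R := Num.min (i%:R * h n) t.

Let node_ge0 n i : 0 <= node n i.
Proof. by rewrite le_min t0 mulr_ge0// ltW. Qed.

Let node_le n i : node n i <= t.
Proof. by rewrite ge_min lexx orbT. Qed.

Let node_step n i : node n i <= node n i.+1 /\ node n i.+1 - node n i <= h n.
Proof.
have := h0 n; rewrite /node -natr1 mulrDl mul1r; move: (i%:R * h n) (h n) => a b b0.
by rewrite /Num.min; do ! case: ifPn; rewrite -?leNgt => *; split; lra.
Qed.

Let node_last n : node n n.+1 = t.
Proof. by rewrite /node /h mulrC mulfVK ?pnatr_eq0// min_r// lerDl. Qed.

Let node0 n : node n 0 = 0.
Proof. by rewrite /node mul0r min_l. Qed.

Let cell n (i : 'I_n.+1) : set R := `[i%:R * h n, i.+1%:R * h n[%classic.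

Lemma pairing_in_completion mu : in_completion (@pairing R mu).
Proof.
move=> e e0; exists mu; apply: (@le_lt_trans _ _ 0%E); last by rewrite lte_fin.
by apply: dual_norm_le => phi _ /=; rewrite subrr normr0.
Qed.

Let step_fun n : @simple_fun R :=
  @SimpleFun R n.+1 (@cell n) (fun i => g (node n i))
    (fun i => measurable_itv _) (fun i => pairing_in_completion _).

Let step_fun_eval n (r : R) : 0 <= r <= t -> exists q,
  [/\ 0 <= q, q <= t, `|r - q| <= h n & sf_eval (step_fun n) r = g q].
Proof.
move=> /andP[r0 rt].
pose k := Num.truncn (r / h n).
have rh0 : 0 <= r / h n by rewrite divr_ge0// ltW.
have /andP[k1 k2] : k%:R <= r / h n < k.+1%:R by exact: truncn_itv.
rewrite ler_pdivlMr// in k1; rewrite ltr_pdivrMr// in k2.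
have kn : (k < n.+1)%N.
  rewrite -(ltr_nat R) -(ltr_pM2r (h0 n)); apply: (le_lt_trans k1).
  by rewrite /h mulrC mulfVK ?pnatr_eq0//; lra.
exists (node n k); split => //.
  have -> : node n k = k%:R * h n by rewrite /node min_l// (le_trans k1).
  by rewrite ger0_norm ?subr_ge0//; move: k2; rewrite -natr1 mulrDl mul1r; lra.
apply/funext => phi; rewrite /sf_eval (bigD1 (Ordinal kn))//= big1 ?addr0 => [|i /eqP ik].
  by rewrite indicE mem_set ?mul1r//= /cell/= in_itv/= k1 k2.
rewrite indicE memNset ?mul0r// /cell/= in_itv/= => /andP[i1 i2].
apply: ik; apply: val_inj => /=; apply/eqP; rewrite eqn_leq -ltnS -[(k <= i)%N]ltnS.
have : i%:R * h n < k.+1%:R * h n by apply: le_lt_trans k2.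
have : k%:R * h n < i.+1%:R * h n by apply: le_lt_trans i2.
by rewrite !ltr_pM2r// !ltr_nat => -> ->.
Qed.

Let itv_measure (a b : R) : 0 <= a -> 0 < b ->
  fine (lebesgue_measure (`[a, a + b[%classic `&` `[0, t]%classic)) =
  Num.min (a + b) t - Num.min a t.
Proof.
move=> a0 b0.
have [abt|tab] := leP (a + b) t.
  rewrite (_ : _ `&` _ = `[a, a + b[%classic); last first.
    apply/seteqP; split => x /=; rewrite !in_itv/=; first by case.
    by move=> /andP[ax xab]; rewrite ax xab; split => //; apply/andP; split; lra.
  rewrite lebesgue_measure_itv/= lte_fin ltrDl b0/= min_l//; lra.
have [at_|ta] := leP a t.
  rewrite (_ : _ `&` _ = `[a, t]%classic); last first.
    apply/seteqP; split => x /=; rewrite !in_itv/=.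
      by move=> [/andP[-> _] /andP[_ ->]].
    by move=> /andP[ax xt]; rewrite ax xt; split; [lra|apply/andP; split; lra].
  by rewrite lebesgue_measure_itv/= lte_fin; case: ltP => //= ?; lra.
rewrite (_ : _ `&` _ = set0); last first.
  by apply/seteqP; split => x //=; rewrite !in_itv/= => -[/andP[ax _] /andP[_ xt]]; lra.
by rewrite measure0 subrr.
Qed.

Let cell_measure n (i : 'I_n.+1) :
  fine (lebesgue_measure (cell i `&` `[0, t])) = node n i.+1 - node n i.
Proof.
have E : i.+1%:R * h n = i%:R * h n + h n by rewrite -natr1 mulrDl mul1r.
rewrite /node /cell E; apply: itv_measure => //.
by rewrite mulr_ge0// ltW.
Qed.

(** The integral of [wrate] over [0, t] is the increment of the exponential weight, which starts at
    1. *)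
Definition duhamel_limit : @dualBL R :=
  fun phi => pairing nu (fun x => (expR (weight w f t x) - 1) * phi (pflow w t x)).

Let C := fine (normTV nu) * B t.

Let C0 : 0 <= C.
Proof. by rewrite mulr_ge0// fine_ge0// normTV_ge0. Qed.

Let integrand_dist (r q : R) : 0 <= r -> r <= t -> 0 <= q -> q <= t ->
  (dual_norm (g r \- g q)%R <= (C * `|r - q|)%:E)%E.
Proof.
move=> r0 rt q0 qt; apply: dual_norm_le => phi /BL_le1P[a [b [a0 b0 ab fa fb]]].
have bp := lip_bounded_mfun fa fb.
have bpt := bounded_mfun_comp bp (mpflow t0).
have b1 (s : R) : 0 <= s -> bounded_mfun (fun x => wrate s x * phi (pflow w t x)).
  by move=> s0; apply: bounded_mfunM => //; exact: bwrate.
have -> : (g r \- g q) phi = pairing nu (fun x => wrate r x * phi (pflow w t x)) -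
    pairing nu (fun x => wrate q x * phi (pflow w t x)).
  by rewrite -(duhamel_integrandE r0 rt bp) -(duhamel_integrandE q0 qt bp).
rewrite -bounded_linear_onB; [|exact: bounded_linear_pairing|exact: b1|exact: b1].
rewrite /C -mulrA; apply: le_normr_pairing => [|x]; first by apply: bounded_mfunB; exact: b1.
rewrite -mulrBl normrM -[leRHS]mulr1; apply: ler_pM => //; first exact: wrate_lip.
by apply: (le_trans (fa _)); lra.
Qed.

Let step_fun_dist n (r : R) : r \in `[0, t] ->
  (dual_norm (g r \- sf_eval (step_fun n) r)%R <= (C * h n)%:E)%E.
Proof.
rewrite in_itv/= => rt; have /andP[r0 rt'] := rt.
have [q [q0 qt rq ->]] := step_fun_eval n rt.
apply: (le_trans (integrand_dist r0 rt' q0 qt)); rewrite lee_fin ler_wpM2l//.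
Qed.

Let cvg_h c : c * h n @[n --> \oo] --> 0.
Proof.
rewrite -(mulr0 c); apply: cvgM; first exact: cvg_cst.
rewrite -(mulr0 (t + 1)); apply: cvgM; first exact: cvg_cst.
exact: cvg_harmonic.
Qed.

(** The increments of the exponential weight telescope, and on each cell the increment differs from
    the Riemann term by a quadratic defect. *)
Let riemann_sum n x :
  `|\sum_(i < n.+1) (node n i.+1 - node n i) * wrate (node n i) x - (expR (weight w f t x) - 1)|
  <= B t * h n * t.
Proof.
have -> : expR (weight w f t x) - 1 =
    \sum_(i < n.+1) (expR (weight w f (node n i.+1) x) - expR (weight w f (node n i) x)).
  rewrite -(big_mkord xpredT (fun i => expR (weight w f (node n i.+1) x) - expR (weight w f (node n i) x))).
  by rewrite telescope_sumr// node_last node0 weight0 expR0.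
have -> : B t * h n * t = \sum_(i < n.+1) (B t * h n * (node n i.+1 - node n i)).
  rewrite -mulr_sumr -(big_mkord xpredT (fun i => node n i.+1 - node n i)).
  by rewrite telescope_sumr// node_last node0 subr0.
rewrite -sumrB; apply: (le_trans (ler_norm_sum _ _ _)); apply: ler_sum => i _.
have [s1 s2] := node_step n i.
rewrite distrC; apply: (le_trans (expR_weight_defect x (node_ge0 n i) s1 (node_le n i.+1))).
rewrite expr2 -(mulrA (B t)); apply: ler_wpM2l => //; apply: ler_wpM2r => //.
by rewrite subr_ge0.
Qed.

Lemma duhamel_bochner : is_bochner_integral t g duhamel_limit.
Proof.
exists step_fun; split.
- apply: aeW => r rt; apply: (@squeeze_cvge0 _ _ _ _ (fun n => C * h n)) => //.
  + by move=> n; exact: dual_norm_ge0.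
  + by apply: nearW => n; exact: step_fun_dist.
- apply: (@squeeze_cvge0 _ _ _ _ (fun n => C * t * h n)) => //.
  + by move=> n; apply: integral_ge0 => r _; exact: dual_norm_ge0.
  + apply: nearW => n; apply: (@le_trans _ _ (\int[lebesgue_measure]_(r in `[0%R, t]) (cst (C * h n)%:E r))%E).
      apply: ge0_le_integral_nonmeasurable => r rt; first exact: dual_norm_ge0.
      exact: step_fun_dist.
    rewrite integral_cst//= lebesgue_measure_itv/= lte_fin.
    case: ltP => [_|]; first by rewrite sube0 -EFinM lee_fin mulrAC.
    by rewrite mule0 lee_fin => _; apply: mulr_ge0; [exact: mulr_ge0|exact: ltW].
- apply: (@squeeze_cvge0 _ _ _ _ (fun n => fine (normTV nu) * (B t * t) * h n)) => //.
  + by move=> n; exact: dual_norm_ge0.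
  + apply: nearW => n; apply: dual_norm_le => phi /BL_le1P[a [b [a0 b0 ab fa fb]]].
    have bp := lip_bounded_mfun fa fb.
    have bpt := bounded_mfun_comp bp (mpflow t0).
    have bE : bounded_mfun (fun x => expR (weight w f t x) - 1).
      by apply: bounded_mfunB; [exact: (bounded_mfun_expR (bweight t0))|exact: bounded_mfun_cst].
    have b1 (i : 'I_n.+1) : bounded_mfun (fun x => wrate (node n i) x * phi (pflow w t x)).
      by apply: bounded_mfunM => //; exact: bwrate.
    have E : sf_integral t (step_fun n) phi = pairing nu
        (fun x => \sum_(i < n.+1) (node n i.+1 - node n i) * (wrate (node n i) x * phi (pflow w t x))).
      rewrite bounded_linear_on_sum//; last exact: bounded_linear_pairing.
      apply: eq_bigr => i _; rewrite cell_measure; congr (_ * _).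
      exact: (duhamel_integrandE (node_ge0 n i) (node_le n i) bp).
    have -> : (sf_integral t (step_fun n) \- duhamel_limit) phi =
      pairing nu (fun x => \sum_(i < n.+1) (node n i.+1 - node n i) *
        (wrate (node n i) x * phi (pflow w t x))) -
      pairing nu (fun x => (expR (weight w f t x) - 1) * phi (pflow w t x)).
      by rewrite -E.
    rewrite -bounded_linear_onB; last 3 first.
    * exact: bounded_linear_pairing.
    * by apply: bounded_mfun_sum => i; exact: bounded_mfunZ.
    * exact: bounded_mfunM.
    rewrite -mulrA (mulrAC (B t)); apply: le_normr_pairing => [|x].
      apply: bounded_mfunB; last exact: bounded_mfunM.
      by apply: bounded_mfun_sum => i; exact: bounded_mfunZ.
    under eq_bigr do rewrite mulrA.
    rewrite -mulr_suml -mulrBl normrM -[leRHS]mulr1; apply: ler_pM => //.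
    by apply: (le_trans (fa _)); lra.
Qed.

End riemann_sums.

(** The transported initial value carries the weight 1 and the Duhamel integral the weight
    [expR (weight w f t x) - 1]; they add up to the weight of [fvsol]. *)
Lemma fvsol_solution (T : R) : 0 < T -> is_fixed_velocity_solution w f nu T (fvsol w f nu).
Proof.
move=> T0; split.
- by apply: lipschitz_continuousBL => s t; exact: fvsol_dist.
- exists (fine (normTV nu) * expR (F * T)) => t; rewrite in_itv/= => /andP[t0 tT].
  apply: normTV_wpush; [exact: mpflow|by case: (bweight t0)|].
  move=> x; apply: (le_trans (weight_bound wK wL fF fL Lf0 x t0)).
  by rewrite ler_wpM2l.
- move=> t; rewrite in_itv/= => /andP[t0 tT].
  exists (duhamel_limit t); first exact: duhamel_bochner.
  apply/eqP; rewrite eq_le dual_norm_ge0 andbT.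
  apply: dual_norm_le => phi /BL_le1P[a [b [a0 b0 ab fa fb]]].
  have bp := lip_bounded_mfun fa fb.
  have bpt := bounded_mfun_comp bp (mpflow t0).
  have bE : bounded_mfun (fun x => expR (weight w f t x) - 1).
    by apply: bounded_mfunB; [exact: (bounded_mfun_expR (bweight t0))|exact: bounded_mfun_cst].
  rewrite /= transportE// pairing_pushforward//; last exact: mpflow.
  rewrite /fvsol pairing_wpush//; [|exact: mpflow|exact: bweight].
  have [pD _ _] := bounded_linear_pairing nu.
  rewrite /duhamel_limit -pD//; last exact: bounded_mfunM.
  rewrite normr_le0 subr_eq0; apply/eqP; congr pairing; apply/funext => x /=; ring.
Qed.

End fixed_velocity.

(** * Bochner integrals evaluated at a test function *)

Section bochner_pairing.
Context {R : realType}.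
Notation leb := (@lebesgue_measure R).

Lemma cvge0_lt (X : Type) (Fi : set_system X) (u : X -> \bar R) (e : R) :
  Filter Fi -> u x @[x --> Fi] --> 0%E -> 0 < e -> \forall x \near Fi, (u x < e%:E)%E.
Proof.
move=> FFi /fine_cvgP[ufin u0] e0.
have u_lt : \forall x \near Fi, `|fine (u x)| < e by exact: (cvgr0_norm_lt _ u0).
apply: filterS2 ufin u_lt => x ux; rewrite -(fineK ux) lte_fin /=.
by apply: le_lt_trans; exact: ler_norm.
Qed.

Lemma integrable_itv_bounded (t B : R) (g : R -> R) :
  measurable_fun `[0, t] g -> (forall r, r \in `[0, t] -> `|g r| <= B) ->
  leb.-integrable `[0, t] (EFin \o g).
Proof.
move=> mg gB; apply: measurable_bounded_integrable => //.
  have := lebesgue_measure_itv `[0, t]; rewrite /=; case: ifP => _ -> //.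
  by rewrite sube0 ltry.
exists B; split; first exact: num_real.
by move=> M BM r rt; apply: le_trans (gB r rt) _; exact: ltW.
Qed.

Lemma Rintegral_step_fun (t : R) n (A : 'I_n -> set R) (c : 'I_n -> R) :
  (forall i, measurable (A i)) ->
  leb.-integrable `[0, t] (EFin \o (fun r => \sum_(i < n) \1_(A i) r * c i)) /\
  \int[leb]_(r in `[0, t]) (\sum_(i < n) \1_(A i) r * c i) =
    \sum_(i < n) fine (leb (A i `&` `[0, t])) * c i.
Proof.
elim: n A c => [|n IH] A c mA.
  have -> : (fun r => \sum_(i < 0) \1_(A i) r * c i) = cst 0.
    by apply/funext => r; rewrite big_ord0.
  rewrite big_ord0 Rintegral_cst// mul0r; split => //.
  apply: (@integrable_itv_bounded t 0); first exact: measurable_cst.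
  by move=> r _ /=; rewrite normr0.
have [I1 I2] := IH (fun i => A (lift ord0 i)) (fun i => c (lift ord0 i)) (fun i => mA _).
have i0 : leb.-integrable `[0, t] (EFin \o (\1_(A ord0) : R -> R)).
  apply: (@integrable_itv_bounded t 1); first by apply: measurable_indic; exact: mA.
  by move=> r _; rewrite indicE normr_nat; case: (_ \in _); rewrite ?ler01.
have ic : leb.-integrable `[0, t] (EFin \o (fun r => (\1_(A ord0) r * c ord0) : R)).
  apply: (@integrable_itv_bounded t `|c ord0|).
    by apply: measurable_funM; [apply: measurable_indic; exact: mA|exact: measurable_cst].
  move=> r _; rewrite normrM ler_piMl// indicE normr_nat.
  by case: (_ \in _); rewrite ?ler01.
have -> : (fun r => \sum_(i < n.+1) \1_(A i) r * c i) = (fun r => \1_(A ord0) r * c ord0 +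
    \sum_(i < n) \1_(A (lift ord0 i)) r * c (lift ord0 i)).
  by apply/funext => r; rewrite big_ord_recl.
split; first by have := integrableD _ ic I1; exact.
rewrite RintegralD// I2 big_ord_recl RintegralZr//; congr (_ * _ + _).
by rewrite /Rintegral integral_indic//; exact: mA.
Qed.

(** Evaluation at a function of the unit ball is bounded by the dual norm, so both the integrals of
    the simple functions and their errors pass to scalar integrals. *)
Lemma bochner_pairing (t B : R) (g : R -> @dualBL R) (L : @dualBL R) phi :
  is_bochner_integral t g L -> (norm_BL phi <= 1)%E ->
  measurable_fun `[0, t] (fun r => g r phi) ->
  (forall r, r \in `[0, t] -> `|g r phi| <= B) ->
  L phi = \int[leb]_(r in `[0, t]) g r phi.
Proof.
move=> [s [_ s2 s3]] p1 mg gB.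
have ig := integrable_itv_bounded mg gB.
have c3 : sf_integral t (s n) phi @[n --> \oo] --> L phi.
  apply/cvgrPdist_le => e e0.
  have : \forall n \near \oo, (dual_norm (sf_integral t (s n) \- L)%R < e%:E)%E.
    exact: cvge0_lt s3 e0.
  apply: filterS => n H; rewrite distrC ltW// -lte_fin; apply: le_lt_trans H.
  exact: (le_dual_norm (sf_integral t (s n) \- L)).
have c2 : sf_integral t (s n) phi @[n --> \oo] --> \int[leb]_(r in `[0, t]) g r phi.
  apply/cvgrPdist_le => e e0.
  have : \forall n \near \oo, (\int[leb]_(r in `[0%R, t])
        dual_norm (g r \- sf_eval (s n) r)%R < e%:E)%E.
    exact: cvge0_lt s2 e0.
  apply: filterS => n H.
  have [is_ Es] := @Rintegral_step_fun t _ (sf_set (s n)) (fun i => sf_val (s n) i phi) (sf_setP (s := s n)).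
  have -> : sf_integral t (s n) phi = \int[leb]_(r in `[0, t]) sf_eval (s n) r phi by rewrite /sf_eval Es.
  rewrite -RintegralB//; rewrite -lee_fin EFin_normr_Rintegral//; last by have := integrableB _ ig is_; exact.
  apply: (le_trans (le_abse_integral _ _ _)) => //.
    by apply: (measurable_int leb); have := integrableB _ ig is_; exact.
  apply: le_trans (ltW H); apply: ge0_le_integral_nonmeasurable => r _; first exact: abse_ge0.
  exact: (le_dual_norm (g r \- sf_eval (s n) r)).
exact: cvg_unique c3 c2.
Qed.

End bochner_pairing.

(** * Uniqueness for a fixed velocity *)

Section fixed_velocity_uniqueness.
Context {R : realType}.
Variables (w f : I01 R -> R) (K L F Lf : R).
Hypotheses (wK : forall x, `|w x| <= K) (wL : lip_with L w).
Hypotheses (fF : forall x, `|f x| <= F) (fL : lip_with Lf f) (Lf0 : 0 <= Lf).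

Let K0 : 0 <= K. Proof. exact: le_trans (wK point). Qed.
Let F0 : 0 <= F. Proof. exact: le_trans (fF point). Qed.
Let L0 : 0 <= L.
Proof.
have := wL (proj01 1) (proj01 0).
rewrite [itv01_val _]clampK ?[itv01_val (proj01 0)]clampK ?in_itv/= ?lexx ?ler01//.
by rewrite subr0 normr1 mulr1; exact: le_trans.
Qed.
Let bf : bounded_mfun f. Proof. exact: (lip_bounded_mfun fF fL). Qed.

Let bpflow (phi : I01 R -> R) (t : R) : 0 <= t -> bounded_mfun phi -> bounded_mfun (phi \o pflow w t).
Proof. by move=> t0 bp; exact: (bounded_mfun_comp bp (measurable_pflow wK wL t0)). Qed.

Section test_function.
Variables (phi : I01 R -> R) (a b T : R).
Hypotheses (a0 : 0 <= a) (b0 : 0 <= b) (ab : a + b <= 1).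
Hypotheses (fa : forall x, `|phi x| <= a) (fb : lip_with b phi).

Let bphi : bounded_mfun phi. Proof. exact: (lip_bounded_mfun fa fb). Qed.

Let a1 : a <= 1. Proof. by have := ab; have := b0; lra. Qed.
Let b1 : b <= 1. Proof. by have := ab; have := a0; lra. Qed.

(** The image of [phi] under the adjoint of the map that multiplies a measure by [f] and transports
    it for time s. *)
Let psi (s : R) (x : I01 R) := f x * phi (pflow w s x).

Let bpsi (s : R) : 0 <= s -> bounded_mfun (psi s).
Proof. by move=> s0; apply: bounded_mfunM => //; exact: bpflow. Qed.

Let psi_bound s x : `|psi s x| <= F.
Proof.
rewrite normrM -[leRHS]mulr1; apply: ler_pM => //.
exact: (le_trans (fa _) a1).
Qed.

Let psi_lip s : 0 <= s -> s <= T -> lip_with (Lf + F * expR (L * T)) (psi s).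
Proof.
move=> s0 sT x y; rewrite /psi.
have -> : f x * phi (pflow w s x) - f y * phi (pflow w s y) =
  (f x - f y) * phi (pflow w s x) + f y * (phi (pflow w s x) - phi (pflow w s y)) by ring.
apply: (le_trans (ler_normD _ _)); rewrite !normrM mulrDl; apply: lerD.
  rewrite -[leRHS]mulr1; apply: ler_pM => //.
  exact: (le_trans (fa _) a1).
rewrite -mulrA; apply: ler_pM => //; apply: (le_trans (fb _ _)).
apply: (@le_trans _ _ `|itv01_val (pflow w s x) - itv01_val (pflow w s y)|).
  by rewrite ler_piMl.
have H := @pflow_dist _ w K L wK wL w x y 0 s s0 wK wL.
apply: (le_trans (H _)); first by move=> z; rewrite subrr normr0.
by rewrite mulr0 addr0 ler_wpM2r// ler_expR ler_wpM2l.
Qed.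

Let psi_dist s r x : `|psi s x - psi r x| <= F * K * `|s - r|.
Proof.
rewrite /psi -mulrBr normrM -mulrA; apply: ler_pM => //.
apply: (le_trans (fb _ _)).
apply: (@le_trans _ _ `|itv01_val (pflow w s x) - itv01_val (pflow w r x)|).
  by rewrite ler_piMl.
exact: pflow_time_lip.
Qed.

(** Sup bound plus Lipschitz bound of [psi s], uniform in s on [0, T]. *)
Let Cd := F + (Lf + F * expR (L * T)).

Lemma duhamel_test_dist (mu mu' : Meas R) (s : R) : 0 <= s -> s <= T ->
  `|pairing mu (psi s) - pairing mu' (psi s)| <= Cd * fine (distBL mu mu').
Proof.
move=> s0 sT.
have Ll0 : 0 <= Lf + F * expR (L * T) by rewrite addr_ge0// mulr_ge0// expR_ge0.
exact: (distBL_pairing mu mu' (psi_bound s) Ll0 (psi_lip s0 sT)).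
Qed.

(** Tested against [phi], the variation of constants equation becomes a scalar integral equation.
    Its integrand is measurable because it is continuous, although the measure and the test function
    both move. *)
Lemma duhamel_pairing (nu : Meas R) (mu : R -> Meas R) (t : R) :
  is_fixed_velocity_solution w f nu T mu -> t \in `[0, T] ->
  [/\ measurable_fun `[0, t] (fun r => pairing (mu r) (psi (t - r))),
      exists B, forall r, r \in `[0, t] -> `|pairing (mu r) (psi (t - r))| <= B &
   pairing (mu t) phi = pairing (transport w t nu) phi +
     \int[lebesgue_measure]_(r in `[0, t]) pairing (mu r) (psi (t - r))].
Proof.
move=> [cmu [B Bmu] dmu] tT; have := tT; rewrite in_itv/= => /andP[t0 tleT].
have rT r : r \in `[0, t] -> [/\ 0 <= r, r <= t & r \in `[0, T]].
  by rewrite !in_itv/= => /andP[r0 rt]; split=> //; rewrite r0 (le_trans rt).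
have gB r : r \in `[0, t] -> `|pairing (mu r) (psi (t - r))| <= B * F.
  move=> rt; have [r0 rt' rT'] := rT r rt.
  apply: (@le_trans _ _ (fine (normTV (mu r)) * F)).
    by apply: le_normr_pairing => //; apply: bpsi; rewrite subr_ge0.
  by rewrite ler_wpM2r// -lee_fin fineK ?normTV_fin// Bmu.
have mg : measurable_fun `[0, t] (fun r => pairing (mu r) (psi (t - r))).
  apply: subspace_continuous_measurable_fun => //.
  apply/subspace_continuousP => r /= rt; have [r0 rt' rT'] := rT r rt.
  have tr0 : 0 <= t - r by rewrite subr_ge0.
  have D0 : fine (distBL (mu s) (mu r)) @[s --> within `[0, t] (nbhs r)] --> 0.
    apply: fine_cvg; apply: cvg_trans (cmu r rT').
    apply: cvg_app; apply: within_subset => s /= st; by have [] := rT s st.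
  have N0 : `|s - r| @[s --> within `[0, t] (nbhs r)] --> 0.
    have cn : `|s - r| @[s --> r] --> `|r - r|.
      by apply: cvg_norm; apply: cvgB; [exact: cvg_id|exact: cvg_cst].
    by rewrite subrr normr0 in cn; exact: cvg_within_filter.
  (* The move of the measure is paid in the dual norm by the Lipschitz bound on [psi], that of [psi]
     in the sup norm by the bound B on the total variation. *)
  pose c s := Cd * fine (distBL (mu s) (mu r)) + B * (F * K) * `|s - r|.
  have c0 : c s @[s --> within `[0, t] (nbhs r)] --> 0.
    rewrite /c -[X in _ --> X]addr0 -[X in _ --> X + _](mulr0 Cd) -[X in _ --> _ + X](mulr0 (B * (F * K))).
    by apply: cvgD; apply: cvgM => //; exact: cvg_cst.
  apply/cvgrPdist_le => e e0; near=> s.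
  have st : s \in `[0, t] by near: s; exact: withinT.
  have [s0 st' sT'] := rT s st.
  have ts0 : 0 <= t - s by rewrite subr_ge0.
  have ts : t - s <= T by lra.
  apply: (@le_trans _ _ (c s)); last first.
    apply: le_trans (ler_norm _) _; near: s; exact: (cvgr0_norm_le _ c0).
  rewrite distrC -(subrKA (pairing (mu r) (psi (t - s)))).
  apply: (le_trans (ler_normD _ _)); apply: lerD.
    exact: duhamel_test_dist.
  rewrite -bounded_linear_onB; [|exact: bounded_linear_pairing|exact: bpsi|exact: bpsi].
  apply: (@le_trans _ _ (fine (normTV (mu r)) * (F * K * `|s - r|))).
    apply: le_normr_pairing => [|x]; first by apply: bounded_mfunB; exact: bpsi.
    apply: (le_trans (psi_dist _ _ _)).
    have -> : t - s - (t - r) = - (s - r) by ring.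
    by rewrite normrN.
  rewrite -(mulrA B) ler_wpM2r ?mulr_ge0//.
  by rewrite -lee_fin fineK ?normTV_fin// Bmu.
split => //; first by exists (B * F).
have [Lim bo E] := dmu t tT.
have p1 : (norm_BL phi <= 1)%E.
  by apply: (le_trans (norm_BL_le fa b0 fb)); rewrite lee_fin.
have gE r : r \in `[0, t] -> pairing (transport w (t - r) (densityM f (mu r))) phi =
    pairing (mu r) (psi (t - r)).
  move=> rt; have [r0 rt' _] := rT r rt.
  by rewrite (pairing_transport_density wK wL fF fL)// subr_ge0.
have -> : pairing (mu t) phi = pairing (transport w t nu) phi + Lim phi.
  apply/eqP; rewrite -subr_eq0 -normr_le0 -lee_fin.
  have := le_dual_norm (pairing (mu t) \- (pairing (transport w t nu) \+ Lim)) p1.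
  by rewrite E.
congr (_ + _); rewrite (@bochner_pairing _ t (B * F) _ _ _ bo p1).
- by apply: eq_Rintegral => r /set_mem; exact: gE.
- apply: (@eq_measurable_fun _ _ _ _ _ (fun r => pairing (mu r) (psi (t - r)))) mg.
  by move=> r /set_mem rt; rewrite gE.
- by move=> r rt; rewrite gE// gB.
Unshelve. all: by end_near. Qed.
End test_function.

(** Gronwall as a contraction for the norm weighted by exp(- a t): integrating Cd M exp(a r) over
    [0, t] gives at most (Cd / a) M exp(a t), and Cd / a <= 1/2. Only an explicit exponential is
    integrated, not the distance itself. *)
Lemma fixed_velocity_halving (nu : Meas R) (mu mu' : R -> Meas R) (T M a : R) :
  is_fixed_velocity_solution w f nu T mu ->
  is_fixed_velocity_solution w f nu T mu' ->
  0 < a -> 2 * (F + (Lf + F * expR (L * T))) <= a -> 0 <= M ->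
  (forall t, t \in `[0, T] -> fine (distBL (mu t) (mu' t)) <= M * expR (a * t)) ->
  forall t, t \in `[0, T] -> fine (distBL (mu t) (mu' t)) <= M / 2 * expR (a * t).
Proof.
move=> sol sol' a_gt0 Ca M0 HM t tT.
have := tT; rewrite in_itv/= => /andP[t0 tleT].
rewrite -lee_fin fineK ?distBL_fin//; apply: dual_norm_le => phi /BL_le1P[c [b [c0 b0 cb fc fb]]].
have [m1 [B1 H1] E1] := duhamel_pairing c0 b0 cb fc fb sol tT.
have [m2 [B2 H2] E2] := duhamel_pairing c0 b0 cb fc fb sol' tT.
have i1 := integrable_itv_bounded m1 H1; have i2 := integrable_itv_bounded m2 H2.
have -> : (pairing (mu t) \- pairing (mu' t)) phi =
    \int[lebesgue_measure]_(r in `[0, t])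
      (pairing (mu r) (fun x => f x * phi (pflow w (t - r) x)) -
       pairing (mu' r) (fun x => f x * phi (pflow w (t - r) x))).
  by rewrite RintegralB// /= E1 E2 opprD addrACA subrr add0r.
set Cd := F + _ in Ca.
have Cd0 : 0 <= Cd by rewrite !addr_ge0// mulr_ge0// expR_ge0.
have cexp : continuous (fun r => Cd * M * expR (a * r)).
  move=> r; apply: (@continuousM _ _ (cst (Cd * M)) (fun r => expR (a * r))).
    exact: cst_continuous.
  exact: continuous_expRM.
have i12 : lebesgue_measure.-integrable `[0, t] (EFin \o (fun r =>
      pairing (mu r) (fun x => f x * phi (pflow w (t - r) x)) -
       pairing (mu' r) (fun x => f x * phi (pflow w (t - r) x)))).
  by have := integrableB _ i1 i2; exact.
apply: (le_trans (le_normr_Rintegral _ i12)) => //.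
apply: (@le_trans _ _ (prim (fun r => Cd * M * expR (a * r)) t)).
  apply: le_Rintegral => //.
  - exact: integrable_norm.
  - exact: continuous_integrable_itv.
  - move=> r /=; rewrite in_itv/= => /andP[r0 rt].
    have tr0 : 0 <= t - r by rewrite subr_ge0.
    have trT : t - r <= T by rewrite lerBlDr (le_trans tleT)// lerDl.
    apply: (le_trans (duhamel_test_dist c0 b0 cb fc fb (mu r) (mu' r) tr0 trT)).
    by rewrite -mulrA ler_wpM2l// HM// in_itv/= r0 (le_trans rt).
rewrite prim_expR// ler_pdivrMr//.
have e1 : 1 <= expR (a * t) by apply: le_trans (expR_ge1Dx _); rewrite lerDl mulr_ge0// ltW.
set e := expR _ in e1 *.
have -> : M / 2 * e * a = a / 2 * (M * e) by field.
rewrite -mulrA; apply: ler_pM => //.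
- by rewrite mulr_ge0// subr_ge0.
- by rewrite ler_pdivlMr// mulrC.
- by rewrite ler_wpM2l// gerBl.
Qed.

Lemma fixed_velocity_unique (nu : Meas R) (mu mu' : R -> Meas R) (T : R) :
  is_fixed_velocity_solution w f nu T mu ->
  is_fixed_velocity_solution w f nu T mu' ->
  forall t, t \in `[0, T] -> eqM (mu t) (mu' t).
Proof.
move=> sol sol' t tT; apply: distBL0_eqM.
pose a := 2 * (F + (Lf + F * expR (L * T))) + 1.
have Cd0 : 0 <= F + (Lf + F * expR (L * T)) by rewrite !addr_ge0// mulr_ge0// expR_ge0.
have a0 : 0 < a by rewrite /a; lra.
have Ca : 2 * (F + (Lf + F * expR (L * T))) <= a by rewrite /a lerDl.
have [_ [B1 H1] _] := sol; have [_ [B2 H2] _] := sol'.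
have B10 : 0 <= B1 by rewrite -lee_fin; apply: le_trans (H1 t tT); exact: normTV_ge0.
have B20 : 0 <= B2 by rewrite -lee_fin; apply: le_trans (H2 t tT); exact: normTV_ge0.
(* The bounds on the total variation start the iteration, and each halving gains a factor 1/2. *)
have H m : forall s, s \in `[0, T] ->
    fine (distBL (mu s) (mu' s)) <= (B1 + B2) * 2^-1 ^+ m * expR (a * s).
  elim: m => [|m IH] s sT.
    rewrite expr0 mulr1; apply: (@le_trans _ _ (B1 + B2)); last first.
      rewrite ler_peMr ?addr_ge0//; apply: le_trans (expR_ge1Dx _).
      rewrite lerDl; apply: mulr_ge0; first exact: ltW.
      by move: sT; rewrite in_itv/= => /andP[].
    rewrite -lee_fin fineK ?distBL_fin//; apply: dual_norm_le => phi /BL_le1P[c [b [c0 b0 cb fc fb]]].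
    have bp := lip_bounded_mfun fc fb.
    have c1 x : `|phi x| <= 1 by apply: (le_trans (fc _)); lra.
    apply: (le_trans (ler_normB _ _)); apply: lerD.
      apply: (le_trans (le_normr_pairing (mu s) bp c1)).
      by rewrite mulr1 -lee_fin fineK ?normTV_fin// H1.
    apply: (le_trans (le_normr_pairing (mu' s) bp c1)).
    by rewrite mulr1 -lee_fin fineK ?normTV_fin// H2.
  rewrite exprSr mulrA; apply: (fixed_velocity_halving sol sol' a0 Ca) => //.
  by rewrite mulr_ge0 ?addr_ge0// exprn_ge0// invr_ge0.
rewrite -(fineK (distBL_fin _ _)); congr (_%:E); apply/eqP; rewrite eq_le.
rewrite fine_ge0 ?dual_norm_ge0// andbT.
have c0 : (B1 + B2) * 2^-1 ^+ m * expR (a * t) @[m --> \oo] --> (B1 + B2) * 0 * expR (a * t).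
  apply: cvgM; last exact: cvg_cst.
  apply: cvgM; first exact: cvg_cst.
  by apply: cvg_expr; rewrite ger0_norm; lra.
rewrite mulr0 mul0r in c0.
by apply: (ler_cvg_to (cvg_cst _) c0); apply: nearW => m; exact: H.
Qed.

Lemma QE (nu : Meas R) (t : R) : 0 <= t -> eqM (Q w f t nu) (fvsol w f nu t).
Proof.
move=> t0.
pose P := [set mu : R -> Meas R | forall T : R, 0 < T -> is_fixed_velocity_solution w f nu T mu].
have PQ : P (the (fun=> zeroM) P).
  apply: (@xgetPex {classic (R -> Meas R)} (fun=> zeroM) P).
  by exists (fvsol w f nu) => T T0; exact: (fvsol_solution wK wL fF fL Lf0).
(* A time horizon has to be positive, while t may be 0. *)
have T0 : 0 < t + 1 by rewrite ltr_wpDl.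
apply: (fixed_velocity_unique (PQ _ T0) (fvsol_solution wK wL fF fL Lf0 nu T0)).
by rewrite in_itv/= t0 lerDl ler01.
Qed.

End fixed_velocity_uniqueness.

(** * Euler approximations as states *)

Section eqM_congruence.
Context {R : realType}.
Implicit Types mu nu : Meas R.

Lemma eqM_normTV mu nu : eqM mu nu -> (normTV mu <= normTV nu)%E.
Proof.
move=> mn; rewrite -(fineK (normTV_fin nu)); apply: normTV_le => psi bpsi psi1.
rewrite (eq_pairing mn bpsi) (le_trans (ler_norm _))// -[leRHS]mulr1.
exact: le_normr_pairing.
Qed.

Lemma eqM_distBL mu mu' nu nu' : eqM mu mu' -> eqM nu nu' ->
  (distBL mu nu <= distBL mu' nu')%E.
Proof.
move=> mm nn; rewrite -(fineK (distBL_fin mu' nu')); apply: dual_norm_le => phi p1.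
have [a [b [_ _ _ fa fb]]] := BL_le1P p1; have bp := lip_bounded_mfun fa fb.
rewrite -lee_fin fineK ?distBL_fin// /= (eq_pairing mm bp) (eq_pairing nn bp).
exact: (le_dual_norm (pairing mu' \- pairing nu')).
Qed.

Lemma eqM_sym mu nu : eqM mu nu -> eqM nu mu.
Proof. by move=> H A mA; rewrite H. Qed.

Lemma eqM_trans mu nu rho : eqM mu nu -> eqM nu rho -> eqM mu rho.
Proof. by move=> H1 H2 A mA; rewrite H1// H2. Qed.

Lemma eqM_distBL0 mu nu : eqM mu nu -> distBL mu nu = 0%E.
Proof.
move=> mn; apply/eqP; rewrite eq_le dual_norm_ge0 andbT; apply: dual_norm_le => phi p1.
have [a [b [_ _ _ fa fb]]] := BL_le1P p1.
by rewrite /= (eq_pairing mn (lip_bounded_mfun fa fb)) subrr normr0.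
Qed.

Lemma distBL_triangle nu mu rho :
  (distBL mu rho <= distBL mu nu + distBL nu rho)%E.
Proof.
rewrite -(fineK (distBL_fin mu nu)) -(fineK (distBL_fin nu rho)) -EFinD.
apply: dual_norm_le => phi p1.
rewrite /= -(subrKA (pairing nu phi)); apply: (le_trans (ler_normD _ _)).
apply: lerD; rewrite -lee_fin fineK ?distBL_fin//.
  exact: (le_dual_norm (pairing mu \- pairing nu)).
exact: (le_dual_norm (pairing nu \- pairing rho)).
Qed.

Lemma distBLC mu nu : distBL mu nu = distBL nu mu.
Proof.
rewrite /distBL /dual_norm; congr ereal_sup.
by apply/seteqP; split => _ [phi p1 <-]; exists phi => //=; rewrite distrC.
Qed.

End eqM_congruence.

(* [state R] is a pair (Psi, A) standing for the measure Psi # (e^A mu0). *)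
Notation state R := ((I01 R -> I01 R) * (I01 R -> R))%type.

(** * Stability of one Euler step on states *)

Section states.
Context {R : realType}.
Variables (f : I01 R -> R) (F Lf K L : R).
Hypotheses (fF : forall x, `|f x| <= F) (fL : lip_with Lf f) (Lf0 : 0 <= Lf).
Hypotheses (K0 : 0 <= K) (L0 : 0 <= L).

Let F0 : 0 <= F. Proof. exact: le_trans (fF point). Qed.

Definition admissible_field (w : I01 R -> R) := (forall x, `|w x| <= K) /\ lip_with L w.

(** [c] is the elapsed time, during which the logarithmic weight grows at rate at most F. *)
Definition valid_state (c : R) (Y : state R) :=
  [/\ measurable_fun setT Y.1, measurable_fun setT Y.2 & forall x, `|Y.2 x| <= F * c].

Definition step (w : I01 R -> R) (h : R) (Y : state R) : state R :=
  (pflow w h \o Y.1, fun x => Y.2 x + weight w f h (Y.1 x)).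

Definition close (d : R) (Y Y' : state R) := forall x,
  `|itv01_val (Y.1 x) - itv01_val (Y'.1 x)| + `|Y.2 x - Y'.2 x| <= d.

Lemma close_sym d Y Y' : close d Y Y' -> close d Y' Y.
Proof. by move=> H x; rewrite distrC [X in _ + X]distrC. Qed.

Lemma close_trans d d' Y Y' Y'' : close d Y Y' -> close d' Y' Y'' -> close (d + d') Y Y''.
Proof.
move=> H H' x; apply: le_trans (lerD (H x) (H' x)); rewrite addrACA.
by apply: lerD; exact: ler_distD.
Qed.

Lemma close_le d d' Y Y' : d <= d' -> close d Y Y' -> close d' Y Y'.
Proof. by move=> dd H x; exact: le_trans (H x) dd. Qed.

Lemma valid_state_le c c' Y : c <= c' -> valid_state c Y -> valid_state c' Y.
Proof.
move=> cc [m1 m2 H]; split=> // x; apply: (le_trans (H x)).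
by rewrite ler_wpM2l.
Qed.

Lemma valid_step w (c h : R) Y : admissible_field w -> 0 <= h -> valid_state c Y ->
  valid_state (c + h) (step w h Y).
Proof.
move=> [wK wL] h0 [m1 m2 H]; split => /=.
- exact: (measurableT_comp (measurable_pflow wK wL h0) m1).
- apply: measurable_funD => //.
  exact: (measurableT_comp (measurable_weight wK wL fL Lf0 h0) m1).
- move=> x; rewrite mulrDr (le_trans (ler_normD _ _))//; apply: lerD => //.
  exact: (weight_bound wK wL fF fL Lf0).
Qed.

Lemma step0 w Y : admissible_field w -> step w 0 Y = Y.
Proof.
move=> [wK wL]; case: Y => Psi A; congr pair; apply/funext => x /=.
  exact: pflow0.
by rewrite weight0 addr0.
Qed.

Lemma stepD w (h k : R) Y : admissible_field w -> 0 <= h -> 0 <= k ->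
  step w (h + k) Y = step w k (step w h Y).
Proof.
move=> [wK wL] h0 k0; congr pair; apply/funext => x /=.
  exact: (pflowD wK wL).
by rewrite (weightD wK wL fL Lf0)// addrA.
Qed.

Lemma step_close w (h : R) Y : admissible_field w -> 0 <= h ->
  close ((K + F) * h) Y (step w h Y).
Proof.
move=> [wK wL] h0 x /=; rewrite mulrDl; apply: lerD.
  have := pflow_time_lip wK wL 0 h (Y.1 x).
  by rewrite pflow0 sub0r normrN (ger0_norm h0).
rewrite opprD addrA subrr add0r normrN.
exact: (weight_bound wK wL fF fL Lf0).
Qed.

(** The rate L comes from the stability of the flow, the rate Lf from that of the weight, whose
    factor 1 + Lf h is absorbed in an exponential. *)
Lemma step_stable w w' (h d e : R) Y Y' : admissible_field w -> admissible_field w' ->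
  0 <= h -> close d Y Y' -> (forall x, `|w x - w' x| <= e) ->
  close (expR ((L + Lf) * h) * (d + h * e)) (step w h Y) (step w' h Y').
Proof.
move=> [wK wL] [w'K w'L] h0 dY ww x /=.
have e0 : 0 <= e by apply: le_trans (ww point).
have P := pflow_dist wK wL (Y.1 x) (Y'.1 x) h0 w'K w'L ww.
have W := weight_dist wK wL fL Lf0 (Y.1 x) (Y'.1 x) h0 w'K w'L ww.
have D := dY x.
have E1 : 1 + Lf * h <= expR (Lf * h) by exact: expR_ge1Dx.
have E2 : 1 <= expR (L * h) by apply: le_trans (expR_ge1Dx _); rewrite lerDl mulr_ge0.
have A1 : `|Y.2 x + weight w f h (Y.1 x) - (Y'.2 x + weight w' f h (Y'.1 x))| <=
   `|Y.2 x - Y'.2 x| + `|weight w f h (Y.1 x) - weight w' f h (Y'.1 x)|.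
  by rewrite opprD addrACA ler_normD.
apply: (le_trans (lerD P A1)); apply: (le_trans (lerD (lexx _) (lerD (lexx _) W))).
rewrite [(L + Lf) * h]mulrDl expRD (mulrC h Lf).
(* Here u = exp(L h), z = exp(Lf h), l = Lf h and g = h e; p and q are the distances of the points
   and of the weights. *)
suff key (u z g l p q : R) : p + q <= d -> 1 + l <= z -> 1 <= u -> 0 <= p -> 0 <= q ->
    0 <= g -> 0 <= l -> u * (p + g) + (q + l * (u * (p + g))) <= u * z * (d + g).
  by apply: key; rewrite ?mulr_ge0.
move=> {P W A1 D E1 E2} D z1 u1 p0 q0 g0 l0.
have u0 : 0 <= u by apply: le_trans u1.
have z1' : 1 <= z by apply: le_trans z1; rewrite lerDl.
have pg0 : 0 <= u * (p + g) by rewrite mulr_ge0 ?addr_ge0.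
have H1 : (1 + l) * (u * (p + g)) <= z * (u * (p + g)) by rewrite ler_wpM2r.
have uz1 : 1 <= u * z by rewrite -[leLHS]mulr1; apply: ler_pM.
have H2 : 1 * q <= u * z * q by rewrite ler_wpM2r.
have H3 : u * z * (p + q + g) <= u * z * (d + g).
  by rewrite ler_wpM2l// ?lerD2r// (le_trans ler01).
apply: le_trans H3.
have -> : u * z * (p + q + g) = z * (u * (p + g)) + u * z * q by ring.
by apply: le_trans (lerD H1 H2); rewrite mul1r mulrDl mul1r; lra.
Qed.

Section measures_of_states.
Variable mu0 : Meas R.

Definition state_measure (Y : state R) : Meas R := wpush Y.1 Y.2 mu0.

Lemma pairing_state_measure (c : R) Y phi : valid_state c Y -> bounded_mfun phi ->
  pairing (state_measure Y) phi = pairing mu0 (fun x => expR (Y.2 x) * phi (Y.1 x)).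
Proof. by move=> [m1 m2 B] bp; rewrite pairing_wpush//; split=> //; exists (F * c). Qed.

Lemma normTV_state_measure (c T : R) Y : c <= T -> valid_state c Y ->
  (normTV (state_measure Y) <= (fine (normTV mu0) * expR (F * T))%:E)%E.
Proof.
move=> cT /(valid_state_le cT)[m1 m2 H].
exact: normTV_wpush.
Qed.

Lemma positive_state_measure (c : R) Y : valid_state c Y -> positiveM mu0 ->
  positiveM (state_measure Y).
Proof. by move=> [m1 m2 H]; apply: positive_wpush => //; split=> //; exists (F * c). Qed.

Lemma close_state_measure (T d : R) Y Y' : valid_state T Y -> valid_state T Y' ->
  close d Y Y' ->
  (distBL (state_measure Y) (state_measure Y') <=
    (fine (normTV mu0) * expR (F * T) * d)%:E)%E.
Proof.
move=> [m1 m2 H] [m1' m2' H'] dY; rewrite -mulrA.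
exact: distBL_wpush.
Qed.

Lemma eqM_Q_step w (h c : R) m Y : admissible_field w -> 0 <= h -> valid_state c Y ->
  eqM m (state_measure Y) -> eqM (Q w f h m) (state_measure (step w h Y)).
Proof.
move=> aw h0 vY mY; have [wK wL] := aw.
apply: eqM_trans (QE wK wL fF fL Lf0 m h0) _; apply: eqM_pairing => phi p1.
have [a [b [_ _ _ fa fb]]] := BL_le1P p1; have bp := lip_bounded_mfun fa fb.
have mp := measurable_pflow wK wL h0.
have bw := bounded_mfun_weight wK wL fF fL Lf0 h0.
have bE : bounded_mfun (fun x => expR (weight w f h x) * phi (pflow w h x)).
  by apply: bounded_mfunM; [exact: (bounded_mfun_expR bw)|exact: (bounded_mfun_comp bp mp)].
rewrite /fvsol pairing_wpush// (eq_pairing mY bE) (pairing_state_measure vY bE).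
rewrite (pairing_state_measure (valid_step aw h0 vY) bp).
by congr pairing; apply/funext => x /=; rewrite expRD mulrA.
Qed.

End measures_of_states.

End states.

(** * Comparison of Euler states along two partitions *)

Section euler_states.
Context {R : realType}.
Variables (f : I01 R -> R) (v : Meas R -> I01 R -> R) (mu0 : Meas R).
Variables (F Lf K L M r T : R).
Hypotheses (fF : forall x, `|f x| <= F) (fL : lip_with Lf f) (Lf0 : 0 <= Lf).
Hypotheses (K0 : 0 <= K) (L0 : 0 <= L) (M0 : 0 <= M).
Hypothesis mu0r : fine (normTV mu0) * expR (F * T) <= r.
Hypothesis vK : forall mu, (normTV mu <= r%:E)%E -> admissible_field K L (v mu).
Hypothesis vM : forall mu nu, (normTV mu <= r%:E)%E -> (normTV nu <= r%:E)%E ->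
  forall x, `|v mu x - v nu x| <= M * fine (distBL mu nu).

Let F0 : 0 <= F. Proof. exact: le_trans (fF point). Qed.

Notation meas := (state_measure mu0).

Definition state_velocity (Y : state R) : I01 R -> R := v (meas Y).

Notation vel := state_velocity.

Definition gap (m : R) : rel R := fun a b => (a <= b) && (b - a <= m).

Fixpoint euler_state (Y : state R) (tj : R) (s : seq R) (t : R) : state R :=
  if s is tj1 :: s' then
    if t <= tj1 then step f (vel Y) (t - tj) Y
    else euler_state (step f (vel Y) (tj1 - tj) Y) tj1 s' t
  else Y.

Lemma normTV_valid (c : R) Y : c <= T -> valid_state F c Y -> (normTV (meas Y) <= r%:E)%E.
Proof.
move=> cT vY; apply: (le_trans (normTV_state_measure fF mu0 cT vY)).
by rewrite lee_fin.
Qed.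

Lemma admissible_vel (c : R) Y : c <= T -> valid_state F c Y -> admissible_field K L (vel Y).
Proof. by move=> cT vY; apply: vK; exact: normTV_valid vY. Qed.

Let Mc := M * (fine (normTV mu0) * expR (F * T)).

Let Mc0 : 0 <= Mc.
Proof. by rewrite !mulr_ge0 ?fine_ge0 ?normTV_ge0 ?expR_ge0. Qed.

Lemma vel_close (c c' d : R) Y Y' : c <= T -> c' <= T -> valid_state F c Y -> valid_state F c' Y' ->
  close d Y Y' -> forall x, `|vel Y x - vel Y' x| <= Mc * d.
Proof.
move=> cT cT' vY vY' dY x.
apply: (le_trans (vM (normTV_valid cT vY) (normTV_valid cT' vY') x)).
rewrite /Mc -mulrA ler_wpM2l// -lee_fin fineK ?distBL_fin//.
exact: (close_state_measure mu0 (valid_state_le fF cT vY) (valid_state_le fF cT' vY') dY).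
Qed.

(** [v] takes a charge with all its values, also those on nonmeasurable sets. The Lipschitz bound
    [vM] in the dual norm makes it constant on the classes of [eqM]. *)
Lemma eqM_velocity (m : Meas R) (c : R) Y : c <= T -> valid_state F c Y ->
  eqM m (meas Y) -> v m = vel Y.
Proof.
move=> cT vY mY; apply/funext => x; apply/eqP; rewrite -subr_eq0 -normr_le0.
have nY := normTV_valid cT vY.
have nm : (normTV m <= r%:E)%E by apply: le_trans nY; exact: eqM_normTV.
by have := vM nm nY x; rewrite (eqM_distBL0 mY) mulr0.
Qed.

Lemma valid_euler_state (tj t : R) s Y m : tj <= t -> t <= T -> path (gap m) tj s ->
  valid_state F tj Y -> valid_state F t (euler_state Y tj s t).
Proof.
elim: s tj Y => [|tj1 s IH] tj Y /= tjt tT.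
  by move=> _; exact: valid_state_le.
move=> /andP[/andP[tj1j _] ps] vY.
have tjT : tj <= T by exact: le_trans tT.
have av := admissible_vel tjT vY.
case: ifPn => [ttj1|]; rewrite -?ltNge.
  rewrite -[X in valid_state _ X](subrKC tj).
  by apply: (valid_step fF fL Lf0 av) => //; rewrite subr_ge0.
move=> /ltW tj1t; apply: IH => //.
rewrite -[X in valid_state _ X](subrKC tj).
by apply: (valid_step fF fL Lf0 av) => //; rewrite subr_ge0.
Qed.

Lemma euler_fromE (tj t : R) s Y m' m : tj <= t -> t <= T -> path (gap m) tj s ->
  valid_state F tj Y -> eqM m' (meas Y) ->
  eqM (euler_from v f m' tj s t) (meas (euler_state Y tj s t)).
Proof.
elim: s tj Y m' => [//|tj1 s IH] tj Y m' /= tjt tT /andP[/andP[tj1j _] ps] vY mY.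
have tjT : tj <= T by exact: le_trans tT.
have av := admissible_vel tjT vY.
rewrite (eqM_velocity tjT vY mY).
case: ifPn => [ttj1|]; rewrite -?ltNge.
  by apply: (eqM_Q_step fF fL Lf0 av _ vY mY); rewrite subr_ge0.
move=> /ltW tj1t; apply: IH => //.
  rewrite -[X in valid_state _ X](subrKC tj).
  by apply: (valid_step fF fL Lf0 av) => //; rewrite subr_ge0.
by apply: (eqM_Q_step fF fL Lf0 av _ vY mY); rewrite subr_ge0.
Qed.

(** [head T s] is the next partition point, with default T: when no point is left, tj = t = T and
    the step has length 0. *)
Lemma euler_state_first (tj t : R) s Y : valid_state F tj Y -> tj <= T ->
  last tj s = T -> tj <= t -> t <= head T s ->
  euler_state Y tj s t = step f (vel Y) (t - tj) Y.
Proof.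
move=> vY tjT; case: s => [|tj1 s] /=; last by move=> _ _ ->.
move=> E tjt tT; have -> : t = tj by apply/eqP; rewrite eq_le tjt andbT [leRHS]E.
by rewrite subrr (step0 _ _ (admissible_vel tjT vY)).
Qed.

Lemma le_head_last (tj m : R) s : path (gap m) tj s -> last tj s = T -> tj <= T.
Proof.
elim: s tj => [|tj1 s IH] tj /=; first by move=> _ <-.
move=> /andP[/andP[tj1j _] ps] lT.
by apply: (le_trans tj1j); exact: IH.
Qed.

Lemma head_gap (tj m : R) s : 0 <= m -> path (gap m) tj s -> last tj s = T ->
  tj <= head T s /\ head T s - tj <= m.
Proof.
case: s => [|tj1 s] m0 /=; first by move=> _ ->; rewrite subrr lexx.
by move=> /andP[/andP[]].
Qed.

Lemma euler_state_time_lip (tj s t : R) l Y m : valid_state F tj Y ->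
  path (gap m) tj l -> last tj l = T -> tj <= s -> s <= t -> t <= T ->
  close ((K + F) * (t - s)) (euler_state Y tj l s) (euler_state Y tj l t).
Proof.
elim: l tj s Y => [|tj1 l IH] tj s Y vY /=.
  move=> _ tjT tjs st tT; have -> : s = t by apply/eqP; rewrite eq_le st (le_trans tT)// -tjT.
  by move=> x; rewrite !subrr mulr0 !normr0 addr0.
move=> /andP[/andP[tj1j _] pl] lT tjs st tT.
have tjT : tj <= T by rewrite (le_trans tjs)// (le_trans st).
have av := admissible_vel tjT vY.
have tj1T := le_head_last pl lT.
pose Z := step f (vel Y) (tj1 - tj) Y.
have vZ : valid_state F tj1 Z.
  rewrite -[X in valid_state _ X](subrKC tj).
  by apply: (valid_step fF fL Lf0 av) => //; rewrite subr_ge0.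
have adv (a b : R) : tj <= a -> a <= b ->
    close ((K + F) * (b - a)) (step f (vel Y) (a - tj) Y) (step f (vel Y) (b - tj) Y).
  move=> tja ab; have -> : b - tj = (a - tj) + (b - a) by ring.
  have a0 : 0 <= a - tj by rewrite subr_ge0.
  have b0 : 0 <= b - a by rewrite subr_ge0.
  rewrite (stepD fL Lf0 Y av a0 b0); exact: (step_close fF fL Lf0 _ av b0).
case: ifPn => [stj1|]; rewrite -?ltNge; last first.
  move=> tj1s; rewrite leNgt (lt_le_trans tj1s st)/=.
  by apply: IH => //; exact: ltW.
case: ifPn => [ttj1|]; rewrite -?ltNge; first exact: adv.
move=> /ltW tj1t.
have -> : (K + F) * (t - s) = (K + F) * (tj1 - s) + (K + F) * (t - tj1) by ring.
apply: (close_trans (adv s tj1 tjs stj1)); rewrite -/Z.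
(* At a partition point the recursion still belongs to the preceding step; restarting there with a
   step of length 0 gives the same state, so the induction hypothesis applies from [tj1] on. *)
have EZ : euler_state Z tj1 l tj1 = Z.
  rewrite (euler_state_first vZ tj1T lT (lexx _)).
    by rewrite subrr (step0 _ _ (admissible_vel tj1T vZ)).
  by case: l {IH} pl lT => [//|? ?] /= /andP[/andP[]].
by rewrite -{1}EZ; exact: IH.
Qed.

(** Growth rate of the error: L + Lf from the stability of a step, [Mc] from the dependence of the
    velocity on the state. *)
Let G := L + Lf + Mc.

Let G0 : 0 <= G. Proof. by rewrite !addr_ge0. Qed.

(** The velocities are frozen at [tj] and [tj'], but the distance d is known at the current time c.
    Going back from c, the two states move by at most (K + F) m and (K + F) m'. *)
Lemma current_velocity_dist (c tj tj' d m m' : R) Z Z' : c <= T ->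
  valid_state F tj Z -> valid_state F tj' Z' -> tj <= c -> tj' <= c ->
  c - tj <= m -> c - tj' <= m' ->
  close d (step f (vel Z) (c - tj) Z) (step f (vel Z') (c - tj') Z') ->
  forall x, `|vel Z x - vel Z' x| <= Mc * (d + (K + F) * (m + m')).
Proof.
move=> cT vZ vZ' tjc tjc' cm cm' dZ.
have tjT := le_trans tjc cT; have tjT' := le_trans tjc' cT.
apply: (vel_close tjT tjT' vZ vZ').
have cj0 : 0 <= c - tj by rewrite subr_ge0.
have cj0' : 0 <= c - tj' by rewrite subr_ge0.
have C1 := step_close fF fL Lf0 Z (admissible_vel tjT vZ) cj0.
have C2 := step_close fF fL Lf0 Z' (admissible_vel tjT' vZ') cj0'.
apply: close_le (close_trans (close_trans C1 dZ) (close_sym C2)).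
have -> : (K + F) * (c - tj) + d + (K + F) * (c - tj') =
   d + (K + F) * ((c - tj) + (c - tj')) by ring.
by rewrite lerD2l ler_wpM2l ?addr_ge0// lerD.
Qed.

(** [Z] and [Z'] are the states at the last partition points. The semigroup property splits both
    steps at c, so that only the advance from c to c + h is estimated. *)
Lemma step_compare (c h tj tj' d m m' : R) Z Z' : 0 <= h -> c <= T -> 0 <= m -> 0 <= m' ->
  valid_state F tj Z -> valid_state F tj' Z' -> tj <= c -> tj' <= c ->
  c - tj <= m -> c - tj' <= m' ->
  close d (step f (vel Z) (c - tj) Z) (step f (vel Z') (c - tj') Z') ->
  close (expR (G * h) * (d + h * (Mc * ((K + F) * (m + m')))))
    (step f (vel Z) (c + h - tj) Z) (step f (vel Z') (c + h - tj') Z').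
Proof.
move=> h0 cT m0 m0' vZ vZ' tjc tjc' cm cm' dZ.
have tjT := le_trans tjc cT; have tjT' := le_trans tjc' cT.
have av := admissible_vel tjT vZ; have av' := admissible_vel tjT' vZ'.
have d0 : 0 <= d by apply: le_trans (dZ point); rewrite addr_ge0.
have vd := current_velocity_dist cT vZ vZ' tjc tjc' cm cm' dZ.
have cj0 : 0 <= c - tj by rewrite subr_ge0.
have cj0' : 0 <= c - tj' by rewrite subr_ge0.
rewrite (addrAC c h (- tj)) (addrAC c h (- tj')).
rewrite (stepD fL Lf0 Z av cj0 h0) (stepD fL Lf0 Z' av' cj0' h0).
apply: close_le (step_stable fL Lf0 L0 av av' h0 dZ vd).
have e0 : 0 <= (K + F) * (m + m') by rewrite mulr_ge0 ?addr_ge0.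
have -> : G * h = (L + Lf) * h + Mc * h by rewrite /G; ring.
(* The part [Mc * h * d] of the velocity error goes into the exponential, leaving only the mesh term
   as a source. *)
have E : 1 + Mc * h <= expR (Mc * h) by exact: expR_ge1Dx.
rewrite expRD -mulrA ler_wpM2l ?expR_ge0//.
set eta := (K + F) * (m + m') in e0 *.
have p0 : 0 <= Mc * h by exact: (mulr_ge0 Mc0 h0).
have q0 : 0 <= h * (Mc * eta) by exact: (mulr_ge0 h0 (mulr_ge0 Mc0 e0)).
apply: le_trans (ler_wpM2r (addr_ge0 d0 q0) E).
have -> : (1 + Mc * h) * (d + h * (Mc * eta)) =
  (d + h * (Mc * (d + eta))) + Mc * h * (h * (Mc * eta)) by ring.
by rewrite lerDl; exact: mulr_ge0.
Qed.

Lemma euler_state_compare_first (c t tj tj' d m m' : R) s s' Z Z' :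
  0 <= m -> 0 <= m' ->
  path (gap m) tj s -> path (gap m') tj' s' -> last tj s = T -> last tj' s' = T ->
  valid_state F tj Z -> valid_state F tj' Z' ->
  tj <= c -> tj' <= c -> c <= head T s -> c <= head T s' -> c <= t -> t <= T ->
  t <= head T s -> t <= head T s' ->
  close d (step f (vel Z) (c - tj) Z) (step f (vel Z') (c - tj') Z') ->
  close (expR (G * (t - c)) * (d + (t - c) * (Mc * ((K + F) * (m + m')))))
    (euler_state Z tj s t) (euler_state Z' tj' s' t).
Proof.
move=> m0 m0' ps ps' lT lT' vZ vZ' tjc tjc' cs cs' ct tT ts ts' dZ.
have cT := le_trans ct tT; have tjT := le_trans tjc cT; have tjT' := le_trans tjc' cT.
have [_ gj] := head_gap m0 ps lT; have [_ gj'] := head_gap m0' ps' lT'.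
have cm : c - tj <= m by apply: le_trans gj; rewrite lerD2r.
have cm' : c - tj' <= m' by apply: le_trans gj'; rewrite lerD2r.
rewrite (euler_state_first vZ tjT lT (le_trans tjc ct) ts).
rewrite (euler_state_first vZ' tjT' lT' (le_trans tjc' ct) ts').
have tc0 : 0 <= t - c by rewrite subr_ge0.
by have := step_compare tc0 cT m0 m0' vZ vZ' tjc tjc' cm cm' dZ; rewrite subrKC.
Qed.

(** The current time c lies between the last and the next points of both partitions, and both
    trajectories may be in the middle of a step. The induction, on the number of points left in the
    two lists, advances c to the nearer next point, so the union of the partitions is never
    formed. *)
Lemma euler_state_compare n (c t tj tj' d m m' : R) s s' Z Z' :
  (size s + size s' <= n)%N -> 0 <= m -> 0 <= m' ->
  path (gap m) tj s -> path (gap m') tj' s' -> last tj s = T -> last tj' s' = T ->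
  valid_state F tj Z -> valid_state F tj' Z' ->
  tj <= c -> tj' <= c -> c <= head T s -> c <= head T s' -> c <= t -> t <= T ->
  close d (step f (vel Z) (c - tj) Z) (step f (vel Z') (c - tj') Z') ->
  close (expR (G * (t - c)) * (d + (t - c) * (Mc * ((K + F) * (m + m')))))
    (euler_state Z tj s t) (euler_state Z' tj' s' t).
Proof.
elim: n c tj tj' d m m' s s' Z Z' => [|n IH] c tj tj' d m m' s s' Z Z' ss m0 m0' ps ps'
    lT lT' vZ vZ' tjc tjc' cs cs' ct tT dZ.
  move: ss; rewrite leqn0 addn_eq0 !size_eq0 => /andP[/eqP s0 /eqP s0']; subst s s'.
  exact: (euler_state_compare_first (s := [::]) (s' := [::])).
(* By symmetry, the first partition has the nearer next point. *)
wlog hh : tj tj' m m' s s' Z Z' ss m0 m0' ps ps' lT lT' vZ vZ' tjc tjc' cs cs' dZ /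
    head T s <= head T s'.
  move=> W; have [hh|/ltW hh] := leP (head T s) (head T s'); first exact: W.
  apply: close_sym; rewrite (addrC m); apply: W => //; first by rewrite addnC.
  exact: close_sym.
have [ts|st] := leP t (head T s).
  by apply: euler_state_compare_first => //; exact: le_trans hh.
have cT := le_trans ct tT; have tjT := le_trans tjc cT.
case: s ss ps lT cs hh st => [|tj1 s] /= ss ps lT cs hh st.
  by move: st; rewrite ltNge tT.
move: ps => /andP[/andP[tj1j gj] ps]; have tj1T := le_head_last ps lT.
have c0 : 0 <= tj1 - c by rewrite subr_ge0.
have [_ gj'] := head_gap m0' ps' lT'.
have cm : c - tj <= m by apply: le_trans gj; rewrite lerD2r.
have cm' : c - tj' <= m' by apply: le_trans gj'; rewrite lerD2r.
have := step_compare c0 cT m0 m0' vZ vZ' tjc tjc' cm cm' dZ.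
rewrite subrKC; set d1 := expR _ * _ => D1.
rewrite leNgt st /=.
pose Z1 := step f (vel Z) (tj1 - tj) Z.
have vZ1 : valid_state F tj1 Z1.
  rewrite -[X in valid_state _ X](subrKC tj).
  by apply: (valid_step fF fL Lf0 (admissible_vel tjT vZ)) => //; rewrite subr_ge0.
have tj1h : tj1 <= head T s by have [] := head_gap m0 ps lT.
have Z1E : step f (vel Z1) (tj1 - tj1) Z1 = Z1.
  by rewrite subrr (step0 _ _ (admissible_vel tj1T vZ1)).
(* The current time becomes [tj1]: the first trajectory restarts there with a step of length 0, the
   second remains inside its step. *)
have := IH tj1 tj1 tj' d1 m m' s s' Z1 Z' ss m0 m0' ps ps' lT lT' vZ1 vZ' (lexx _)
  (le_trans tjc' cs) tj1h hh (ltW st) tT.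
rewrite Z1E => /(_ D1); apply: close_le.
have eta0 : 0 <= Mc * ((K + F) * (m + m')).
  by exact: (mulr_ge0 Mc0 (mulr_ge0 (addr_ge0 K0 F0) (addr_ge0 m0 m0'))).
have t10 : 0 <= t - tj1 by rewrite subr_ge0 ltW.
rewrite /d1; set eta := Mc * _ in eta0 *.
have -> : G * (t - c) = G * (t - tj1) + G * (tj1 - c) by ring.
rewrite expRD -mulrA ler_wpM2l ?expR_ge0//.
have E1 : 1 <= expR (G * (tj1 - c)) by apply: le_trans (expR_ge1Dx _); rewrite lerDl mulr_ge0.
move: (expR _) E1 => u u1.
(* The source term of the remaining interval is enlarged by u >= 1, which brings both intervals
   under one exponential. *)
have -> : u * (d + (t - c) * eta) = u * (d + (tj1 - c) * eta) + u * ((t - tj1) * eta) by ring.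
by rewrite lerD2l ler_peMl// mulr_ge0.
Qed.

End euler_states.

(** * Convergence of the Euler approximations *)

Section partitions.
Context {R : realType}.
Implicit Types (T : R) (a : seq R).

Lemma mesh_ge0 a : 0 <= mesh a.
Proof. exact: bigmax_ge_id. Qed.

Lemma partition_path T a : is_partition T a ->
  path (gap (mesh a)) 0 (behead a) /\ last 0 (behead a) = T.
Proof.
case: a => [|x s] [//= sa ssa x0 la]; subst x; split => //.
apply/(pathP 0) => i si; apply/andP; split.
  by apply/ltW; move/(pathP 0) : ssa; exact.
rewrite /mesh /=.
exact: (le_bigmax _ (fun j : 'I_(size s) => (0 :: s)`_j.+1 - (0 :: s)`_j) (Ordinal si)).
Qed.

(** A concrete admissible sequence: the limit is built along it, and it witnesses that the limit is
    a mild solution. *)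
Definition uniform_partition T (k : nat) : seq R :=
  mkseq (fun i => T * i%:R / k.+1%:R) k.+2.

Lemma mesh_uniform T k : 0 <= T -> mesh (uniform_partition T k) = T / k.+1%:R.
Proof.
move=> T0; rewrite /mesh size_mkseq /=.
have E (j : 'I_k.+1) : (uniform_partition T k)`_j.+1 - (uniform_partition T k)`_j = T / k.+1%:R.
  have j1 : (j.+1 < k.+2)%N by rewrite ltnS.
  rewrite nth_mkseq// nth_mkseq ?(ltnW j1)//.
  by rewrite -mulrBl -mulrBr -natrB// subSnn mulr1.
under eq_bigr do rewrite E.
apply/eqP; rewrite eq_le; apply/andP; split.
  by apply: bigmax_le => //; rewrite divr_ge0.
exact: (le_bigmax _ (fun _ : 'I_k.+1 => T / k.+1%:R) ord0).
Qed.

Lemma uniform_partitionP T k : 0 < T -> is_partition T (uniform_partition T k).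
Proof.
move=> T0; split.
- by rewrite size_mkseq.
- apply/(sortedP 0) => i; rewrite size_mkseq => ik.
  rewrite !nth_mkseq ?(ltnW ik)// ltr_pM2r ?invr_gt0 ?ltr0n//.
  by rewrite ltr_pM2l// ltr_nat.
- by rewrite /= mulr0 mul0r.
- by rewrite -nth_last size_mkseq nth_mkseq//= mulfK// pnatr_eq0.
Qed.

Lemma uniform_admissible T : 0 < T -> admissible T (uniform_partition T).
Proof.
move=> T0; split.
- by move=> k; exact: uniform_partitionP.
- move=> i j ij; rewrite !(mesh_uniform _ (ltW T0)) ler_pM2l//.
  by rewrite lef_pV2 ?posrE ?ltr0n// ler_nat ltnS.
- under eq_fun do rewrite (mesh_uniform _ (ltW T0)).
  rewrite -(mulr0 T); apply: cvgM; first exact: cvg_cst.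
  exact: cvg_harmonic.
Qed.

End partitions.

(** * The limit of the Euler states *)

Section euler_limit.
Context {R : realType}.
Variables (f : I01 R -> R) (v : Meas R -> I01 R -> R) (mu0 : Meas R).
Variables (F Lf K L M r T : R).
Hypotheses (fF : forall x, `|f x| <= F) (fL : lip_with Lf f) (Lf0 : 0 <= Lf).
Hypotheses (K0 : 0 <= K) (L0 : 0 <= L) (M0 : 0 <= M) (T0 : 0 < T).
Hypothesis mu0r : fine (normTV mu0) * expR (F * T) <= r.
Hypothesis vK : forall mu, (normTV mu <= r%:E)%E -> admissible_field K L (v mu).
Hypothesis vM : forall mu nu, (normTV mu <= r%:E)%E -> (normTV nu <= r%:E)%E ->
  forall x, `|v mu x - v nu x| <= M * fine (distBL mu nu).

Let F0 : 0 <= F. Proof. exact: le_trans (fF point). Qed.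

Definition initial_state : state R := (id, fun=> 0).

Lemma valid_initial_state : valid_state F 0 initial_state.
Proof. by split => //= x; rewrite normr0 mulr0. Qed.

Lemma initial_state_measure : eqM (state_measure mu0 initial_state) mu0.
Proof.
apply: eqM_pairing => phi /BL_le1P[a [b [_ _ _ fa fb]]].
rewrite (pairing_state_measure mu0 valid_initial_state (lip_bounded_mfun fa fb)).
by congr pairing; apply/funext => x /=; rewrite expR0 mul1r.
Qed.

Definition euler_path (a : seq R) (t : R) : state R :=
  euler_state f v mu0 initial_state 0 (behead a) t.

(** The comparison constant with initial distance 0, over the full time T. *)
Let rate := expR ((L + Lf + M * (fine (normTV mu0) * expR (F * T))) * T) *
  (T * (M * (fine (normTV mu0) * expR (F * T)) * (K + F))).

Let rate0 : 0 <= rate.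
Proof.
have n0 : 0 <= fine (normTV mu0) by rewrite fine_ge0 ?normTV_ge0.
have e0 : 0 <= expR (F * T) by exact: expR_ge0.
apply: (mulr_ge0 (expR_ge0 _)); apply: (mulr_ge0 (ltW T0)).
exact: (mulr_ge0 (mulr_ge0 M0 (mulr_ge0 n0 e0)) (addr_ge0 K0 F0)).
Qed.

Lemma valid_euler_path a t : is_partition T a -> 0 <= t -> t <= T ->
  valid_state F T (euler_path a t).
Proof.
move=> /partition_path[pa _] t0 tT; apply: (valid_state_le fF tT).
exact: (valid_euler_state fF fL Lf0 mu0r vK t0 tT pa valid_initial_state).
Qed.

Lemma euler_path_compare a b t : is_partition T a -> is_partition T b ->
  0 <= t -> t <= T -> close (rate * (mesh a + mesh b)) (euler_path a t) (euler_path b t).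
Proof.
move=> /partition_path[pa la] /partition_path[pb lb] t0 tT.
have [ha _] := head_gap (mesh_ge0 a) pa la; have [hb _] := head_gap (mesh_ge0 b) pb lb.
have H := euler_state_compare fF fL Lf0 K0 L0 M0 mu0r vK vM (leqnn _) (mesh_ge0 a) (mesh_ge0 b)
  pa pb la lb valid_initial_state valid_initial_state (lexx _) (lexx _) ha hb t0 tT (d := 0).
apply: close_le (H _); last by move=> x; rewrite !subrr !normr0 addr0.
rewrite subr0 add0r.
have n0 : 0 <= fine (normTV mu0) by rewrite fine_ge0 ?normTV_ge0.
have e0 : 0 <= expR (F * T) by exact: expR_ge0.
have ab0 : 0 <= mesh a + mesh b by rewrite addr_ge0 ?mesh_ge0.
have c0 : 0 <= M * (fine (normTV mu0) * expR (F * T)) by rewrite mulr_ge0// mulr_ge0.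
rewrite /rate; move: (M * _) c0 => c c0.
have q0 : 0 <= c * ((K + F) * (mesh a + mesh b)).
  by apply: mulr_ge0 => //; apply: mulr_ge0 => //; exact: addr_ge0.
have -> : expR ((L + Lf + c) * T) * (T * (c * (K + F))) * (mesh a + mesh b) =
  expR ((L + Lf + c) * T) * (T * (c * ((K + F) * (mesh a + mesh b)))) by rewrite -!mulrA.
apply: ler_pM; rewrite ?expR_ge0//.
- by rewrite mulr_ge0.
- by rewrite ler_expR ler_wpM2l// !addr_ge0.
- by rewrite ler_wpM2r.
Qed.

(** The limit is taken pointwise along the uniform partitions. An arbitrary partition is compared
    with the k-th of them before letting k grow, which leaves only its own mesh in the bound. *)
Lemma euler_path_limit : exists Y : R -> state R,
  (forall t, 0 <= t -> t <= T -> valid_state F T (Y t)) /\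
  forall a t, is_partition T a -> 0 <= t -> t <= T ->
    close (rate * mesh a) (euler_path a t) (Y t).
Proof.
pose u k t := euler_path (uniform_partition T k) t.
have pu k : is_partition T (uniform_partition T k) by exact: uniform_partitionP.
pose e k := rate * mesh (uniform_partition T k).
have e_cvg : e k @[k --> \oo] --> 0.
  rewrite -(mulr0 rate); apply: cvgM; first exact: cvg_cst.
  by have [_ _] := uniform_admissible T0.
have uc k l t x : 0 <= t -> t <= T ->
    `|itv01_val ((u k t).1 x) - itv01_val ((u l t).1 x)| +
    `|(u k t).2 x - (u l t).2 x| <= e k + e l.
  by move=> t0 tT; rewrite /e -mulrDr; exact: euler_path_compare.
have L1 t x : 0 <= t -> t <= T ->
    itv01_val ((u k t).1 x) @[k --> \oo] --> lim (itv01_val ((u k t).1 x) @[k --> \oo]) /\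
    forall k, `|itv01_val ((u k t).1 x) - lim (itv01_val ((u k t).1 x) @[k --> \oo])| <= e k.
  move=> t0 tT; have [|l [cl Hl]] := @cauchy_rate_lim _ (fun k => itv01_val ((u k t).1 x)) e _ e_cvg.
    by move=> k l; apply: le_trans (uc k l t x t0 tT); rewrite lerDl.
  by rewrite (cvg_lim _ cl).
have L2 t x : 0 <= t -> t <= T ->
    (u k t).2 x @[k --> \oo] --> lim ((u k t).2 x @[k --> \oo]) /\
    forall k, `|(u k t).2 x - lim ((u k t).2 x @[k --> \oo])| <= e k.
  move=> t0 tT; have [|l [cl Hl]] := @cauchy_rate_lim _ (fun k => (u k t).2 x) e _ e_cvg.
    by move=> k l; apply: le_trans (uc k l t x t0 tT); rewrite lerDr.
  by rewrite (cvg_lim _ cl).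
(* [proj01] only puts the limit in the type [itv01 R]; being 1-Lipschitz it preserves the
   estimates. *)
exists (fun t => (fun x => proj01 (lim (itv01_val ((u k t).1 x) @[k --> \oo])),
                  fun x => lim ((u k t).2 x @[k --> \oo]))); split.
  move=> t t0 tT; have vu k : valid_state F T (u k t) by exact: valid_euler_path.
  split => /=.
  - apply: measurable_to_itv01.
    have mc : measurable_fun setT (@clamp R).
      apply: continuous_measurable_fun; apply: (@lipschitz_continuous _ _ 1) => y z.
      by rewrite mul1r clamp_dist.
    apply: (measurableT_comp mc).
    apply: (@measurable_fun_cvg _ _ _ _ (fun k x => itv01_val ((u k t).1 x))).
      move=> k; have [m1 _ _] := vu k; exact: (measurableT_comp (@measurable_itv01_val R) m1).
    by move=> x _; have [] := L1 t x t0 tT.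
  - apply: (@measurable_fun_cvg _ _ _ _ (fun k x => (u k t).2 x)).
      by move=> k; have [] := vu k.
    by move=> x _; have [] := L2 t x t0 tT.
  - move=> x; have [c2 _] := L2 t x t0 tT.
    apply: (ler_cvg_to (cvg_norm c2) (cvg_cst (F * T))); apply: nearW => k.
    by have [_ _] := vu k; exact.
move=> a t pa t0 tT x /=.
have [_ H1] := L1 t x t0 tT; have [_ H2] := L2 t x t0 tT.
(* Three errors [e k]: one from the comparison with the k-th uniform partition, one from the limit
   of each component. *)
apply: (@ler_harmonicP _ _ _ (3 * (rate * T))) => k.
have := euler_path_compare pa (pu k) t0 tT x; rewrite mulrDr -/(e k) -/(u k t).
have ek : e k = rate * T * k.+1%:R^-1 by rewrite /e mesh_uniform ?ltW// mulrA.
have := H1 k; have := H2 k.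
rewrite -[3 * _ * _]mulrA -ek.
set l2 := lim _; set l1 := lim _ => D2 D1 D0.
have C1 : `|itv01_val ((euler_path a t).1 x) - clamp l1| <=
    `|itv01_val ((euler_path a t).1 x) - itv01_val ((u k t).1 x)| + `|itv01_val ((u k t).1 x) - l1|.
  apply: le_trans (ler_distD _ _ _).
  by rewrite -{1}[itv01_val _]clampK ?clamp_dist//; exact: valP.
have C2 : `|(euler_path a t).2 x - l2| <=
    `|(euler_path a t).2 x - (u k t).2 x| + `|(u k t).2 x - l2| by exact: ler_distD.
apply: (le_trans (lerD C1 C2)).
move: D0 D1 D2; move: `|_ - itv01_val _| `|_ - (u k t).2 x| `|_ - l1| `|_ - l2| => p q p' q'.
by move: (rate * mesh a) (e k) => y z; lra.
Qed.

End euler_limit.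

Section limit_uniqueness.
Context {R : realType}.

Lemma le_dist_traj (T t : R) (mu nu : R -> Meas R) : t \in `[0, T] ->
  (distBL (mu t) (nu t) <= dist_traj T mu nu)%E.
Proof. by move=> tT; apply: ereal_sup_ubound; exists t. Qed.

Lemma dist_traj_ge0 (T : R) (mu nu : R -> Meas R) : 0 <= T ->
  (0 <= dist_traj T mu nu)%E.
Proof.
move=> T0; apply: (@le_trans _ _ (distBL (mu 0) (nu 0))); first exact: dual_norm_ge0.
by apply: le_dist_traj; rewrite in_itv/= lexx.
Qed.

Lemma traj_limit_unique (T : R) (u : nat -> R -> Meas R) (mu nu : R -> Meas R) :
  dist_traj T (u k) mu @[k --> \oo] --> 0%E ->
  dist_traj T (u k) nu @[k --> \oo] --> 0%E -> eq_traj T nu mu.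
Proof.
move=> cmu cnu t tT; apply: distBL0_eqM; rewrite -(fineK (distBL_fin _ _)).
congr (_%:E); apply/eqP; rewrite eq_le fine_ge0 ?dual_norm_ge0// andbT.
apply/ler_addgt0Pl => e e0; rewrite addr0 -lee_fin fineK ?distBL_fin//.
have e2 : 0 < e / 2 by rewrite divr_gt0.
have [k _ /(_ k (leqnn k)) [H1 H2]] :
    \forall k \near \oo, (dist_traj T (u k) mu < (e / 2)%:E)%E /\
                         (dist_traj T (u k) nu < (e / 2)%:E)%E.
  have P1 : \forall k \near \oo, (dist_traj T (u k) mu < (e / 2)%:E)%E by exact: cvge0_lt cmu e2.
  have P2 : \forall k \near \oo, (dist_traj T (u k) nu < (e / 2)%:E)%E by exact: cvge0_lt cnu e2.
  by apply: filterS2 P1 P2 => k ? ?; split.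
apply: (le_trans (distBL_triangle (u k t) _ _)); rewrite distBLC.
have -> : e%:E = ((e / 2)%:E + (e / 2)%:E)%E :> \bar R by rewrite -EFinD -splitr.
by apply: leeD; [apply: le_trans (ltW H2)|apply: le_trans (ltW H1)]; exact: le_dist_traj.
Qed.

End limit_uniqueness.

(** * Convergence of the Euler approximations as measures *)

Section euler_convergence.
Context {R : realType}.
Variables (f : I01 R -> R) (v : Meas R -> I01 R -> R) (mu0 : Meas R).
Variables (F Lf K L M r T : R).
Hypotheses (fF : forall x, `|f x| <= F) (fL : lip_with Lf f) (Lf0 : 0 <= Lf).
Hypotheses (K0 : 0 <= K) (L0 : 0 <= L) (M0 : 0 <= M) (T0 : 0 < T).
Hypothesis mu0r : fine (normTV mu0) * expR (F * T) <= r.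
Hypothesis vK : forall mu, (normTV mu <= r%:E)%E -> admissible_field K L (v mu).
Hypothesis vM : forall mu nu, (normTV mu <= r%:E)%E -> (normTV nu <= r%:E)%E ->
  forall x, `|v mu x - v nu x| <= M * fine (distBL mu nu).

Let F0 : 0 <= F. Proof. exact: le_trans (fF point). Qed.

Let C := fine (normTV mu0) * expR (F * T).

Let C0 : 0 <= C.
Proof. by rewrite mulr_ge0 ?expR_ge0// fine_ge0 ?normTV_ge0. Qed.

Lemma eulerE a t : is_partition T a -> t \in `[0, T] ->
  eqM (euler v f mu0 a t) (state_measure mu0 (euler_path f v mu0 a t)).
Proof.
rewrite in_itv/= => pa /andP[t0 tT]; have [pp la] := partition_path pa.
rewrite /euler; case: ifPn => [t0'|_].
  have -> : t = 0 by apply/eqP; rewrite eq_le t0 t0'.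
  have [h0 _] := head_gap (mesh_ge0 a) pp la.
  rewrite /euler_path (euler_state_first fF mu0r vK (valid_initial_state _) (ltW T0) la (lexx _) h0).
  rewrite subrr (step0 _ _ (admissible_vel fF mu0r vK (ltW T0) (valid_initial_state _))).
  exact/eqM_sym/initial_state_measure.
apply: (euler_fromE fF fL Lf0 mu0r vK vM t0 tT pp (valid_initial_state _)).
exact/eqM_sym/initial_state_measure.
Qed.

Lemma euler_dist a s t : is_partition T a -> s \in `[0, T] -> t \in `[0, T] ->
  (distBL (euler v f mu0 a s) (euler v f mu0 a t) <= (C * (K + F) * `|s - t|)%:E)%E.
Proof.
move=> pa sT tT; apply: (le_trans (eqM_distBL (eulerE pa sT) (eulerE pa tT))).
wlog st : s t sT tT / s <= t.
  move=> H; have [st|/ltW st] := leP s t; first exact: H.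
  by rewrite distBLC distrC; exact: H.
move: sT tT; rewrite !in_itv/= => /andP[s0 sT] /andP[t0 tT].
have [pp la] := partition_path pa.
rewrite -mulrA; apply: close_state_measure.
- exact: (valid_euler_path fF fL Lf0 mu0r vK pa s0 sT).
- exact: (valid_euler_path fF fL Lf0 mu0r vK pa t0 tT).
- rewrite distrC ger0_norm ?subr_ge0//.
  exact: (euler_state_time_lip fF fL Lf0 mu0r vK (valid_initial_state _) pp la s0 st tT).
Qed.

Lemma euler_in_Cplus a : positiveM mu0 -> is_partition T a -> in_Cplus T (euler v f mu0 a).
Proof.
move=> pos0 pa; split.
  by apply: (@lipschitz_continuousBL _ _ (C * (K + F))) => s t; exact: euler_dist.
move=> t tT A mA; rewrite (eulerE pa tT mA).
move: tT; rewrite in_itv/= => /andP[t0 tT].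
exact: (positive_state_measure (valid_euler_path fF fL Lf0 mu0r vK pa t0 tT) pos0).
Qed.

(** A single [D] serves all partitions, so the limit depends on no sequence, and its distance to an
    approximation is controlled by the mesh alone. *)
Lemma euler_convergence : positiveM mu0 -> exists (mu : R -> Meas R) (D : R),
  [/\ in_Cplus T mu, eqM (mu 0) mu0 &
    forall a, is_partition T a -> (dist_traj T (euler v f mu0 a) mu <= (D * mesh a)%:E)%E].
Proof.
move=> pos0.
have [Y [vY HY]] := euler_path_limit fF fL Lf0 K0 L0 M0 T0 mu0r vK vM.
move: HY; set rate := _ * _ => HY.
exists (fun t => state_measure mu0 (Y t)), (C * rate).
have E2 a t : is_partition T a -> t \in `[0, T] ->
    (distBL (euler v f mu0 a t) (state_measure mu0 (Y t)) <= (C * rate * mesh a)%:E)%E.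
  move=> pa tT; apply: (le_trans (eqM_distBL (eulerE pa tT) (fun _ _ => erefl))).
  move: tT; rewrite in_itv/= => /andP[t0 tT]; rewrite -mulrA.
  apply: close_state_measure; [|exact: vY|exact: HY].
  exact: (valid_euler_path fF fL Lf0 mu0r vK pa t0 tT).
split.
- split; last first.
    move=> t; rewrite in_itv/= => /andP[t0 tT].
    exact: (positive_state_measure (vY t t0 tT) pos0).
  apply: (@lipschitz_continuousBL _ _ (C * (K + F))) => s t sT tT.
  rewrite -(fineK (distBL_fin _ _)) lee_fin.
  (* The Lipschitz bound in time is uniform in the partition; passing to the limit costs one
     approximation error at s and one at t. *)
  apply: (@ler_harmonicP _ _ _ (2 * (C * rate * T))) => k.
  have pk := @uniform_partitionP _ T k T0.
  have ek : C * rate * T * k.+1%:R^-1 = C * rate * mesh (uniform_partition T k).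
    by rewrite (mesh_uniform _ (ltW T0)) mulrA.
  rewrite -(mulrA 2) ek -lee_fin fineK ?distBL_fin//.
  apply: (le_trans (distBL_triangle (euler v f mu0 (uniform_partition T k) s) _ _)).
  apply: (le_trans (leeD (lexx _) (distBL_triangle (euler v f mu0 (uniform_partition T k) t) _ _))).
  rewrite distBLC.
  apply: (le_trans (leeD (E2 _ _ pk sT) (leeD (euler_dist pk sT tT) (E2 _ _ pk tT)))).
  rewrite -!EFinD lee_fin; move: (_ * mesh _) (_ * `|_|) => p q.
  by rewrite mulr_natl mulr2n addrCA.
- have z0 : (0 : R) \in `[0, T] by rewrite in_itv/= lexx ltW.
  apply/eqM_sym/distBL0_eqM; rewrite -(fineK (distBL_fin _ _)); congr (_%:E); apply/eqP.
  rewrite eq_le fine_ge0 ?dual_norm_ge0// andbT.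
  (* At time 0 every approximation is [mu0] itself, so the approximation error bounds the distance
     of the limit to [mu0]. *)
  apply: (@ler_harmonicP _ _ _ (C * rate * T)) => k; rewrite add0r.
  have pk := @uniform_partitionP _ T k T0.
  rewrite -mulrA -(mesh_uniform _ (ltW T0)) -lee_fin fineK ?distBL_fin//.
  by have := E2 _ _ pk z0; rewrite /euler lexx.
- move=> a pa; apply: ge_ereal_sup => _ [t tT <-].
  exact: E2.
Qed.

End euler_convergence.

Unset Implicit Arguments.

Theorem theorem3p10 (R : realType) (T : R) (f : I01 R -> R) (mu0 : Meas R)
    (v : Meas R -> I01 R -> R) :
  0 < T -> BL f -> positiveM mu0 -> velocity_assumption v ->
  exists mu : R -> Meas R,
    [/\ in_Cplus T mu,
        eqM (mu 0) mu0,
        is_mild_solution v f mu0 T mu,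
        forall nu, in_Cplus T nu -> eqM (nu 0) mu0 ->
          is_mild_solution v f mu0 T nu -> eq_traj T nu mu
      & forall alpha, admissible T alpha ->
          [/\ forall k, in_Cplus T (euler v f mu0 (alpha k)),
              dist_traj T (euler v f mu0 (alpha k)) mu @[k --> \oo] --> 0%E
            & forall nu, continuousBL T nu ->
                dist_traj T (euler v f mu0 (alpha k)) nu @[k --> \oo] --> 0%E ->
                eq_traj T nu mu]].
Proof.
move=> T0 /BLP[F [Lf [F0 Lf0 fF fL _]]] pos0 [_ vr].
(* A bound on the total variation of all Euler approximations on [0, T], so that one triple of
   constants serves throughout; the summand 1 makes it positive even if [mu0] vanishes. *)
pose r := fine (normTV mu0) * expR (F * T) + 1.
have r0 : 0 < r by rewrite /r ltr_wpDl// mulr_ge0 ?expR_ge0// fine_ge0 ?normTV_ge0.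
have [Kr [Lr [Mr Hv]]] := vr r r0.
have mu0r : fine (normTV mu0) * expR (F * T) <= r by rewrite /r lerDl.
(* The constants of the assumption come without sign, hence the absolute values. *)
have vK mu : (normTV mu <= r%:E)%E -> admissible_field `|Kr| `|Lr| (v mu).
  move=> mur; have [H1 H2 _] := Hv mu mu mur mur; split.
    by move=> x; apply: (le_trans (norm_supP H1 x)); exact: ler_norm.
  move=> x y; apply: (le_trans (lipP H2 x y)).
  by rewrite ler_wpM2r// ler_norm.
have vM mu nu : (normTV mu <= r%:E)%E -> (normTV nu <= r%:E)%E ->
    forall x, `|v mu x - v nu x| <= `|Mr| * fine (distBL mu nu).
  move=> mur nur x; have [_ _] := Hv mu nu mur nur.
  rewrite -{1}(fineK (distBL_fin mu nu)) -EFinM => /norm_supP/(_ x)/le_trans; apply.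
  by rewrite ler_wpM2r ?ler_norm// fine_ge0 ?dual_norm_ge0.
have Cp := euler_in_Cplus fF fL Lf0 T0 mu0r vK vM pos0.
have [mu [D [mu_C mu_0 mu_lim]]] :=
  euler_convergence fF fL Lf0 (normr_ge0 _) (normr_ge0 _) (normr_ge0 _) T0 mu0r vK vM pos0.
have cvg_mesh (alpha : nat -> seq R) : (forall k, is_partition T (alpha k)) ->
    mesh (alpha k) @[k --> \oo] --> 0 ->
    dist_traj T (euler v f mu0 (alpha k)) mu @[k --> \oo] --> 0%E.
  move=> pa ma; apply: (@squeeze_cvge0 _ _ _ _ (fun k => D * mesh (alpha k))).
  - by move=> k; apply: dist_traj_ge0; exact: ltW.
  - by apply: nearW => k; exact: mu_lim.
  - by rewrite -(mulr0 D); apply: cvgM => //; exact: cvg_cst.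
have sub_mesh (alpha : nat -> seq R) (n : nat -> nat) : admissible T alpha ->
    {homo n : i j / (i < j)%N} -> mesh (alpha (n k)) @[k --> \oo] --> 0.
  move=> [_ mono m0] hn.
  (* As the meshes are nonincreasing, those of a subsequence are bounded by those of the sequence
     itself. *)
  have nk k : (k <= n k)%N.
    by elim: k => // k IH; apply: leq_ltn_trans IH _; exact: hn.
  apply: (@squeeze_cvgr _ _ _ _ (cst 0) (fun k => mesh (alpha k))) => //; last exact: cvg_cst.
  by apply: nearW => k; rewrite mesh_ge0/=; exact: mono.
exists mu; split => //.
- split; first by case: mu_C.
  have ua := uniform_admissible T0; exists (uniform_partition T), id; split => //.
  by have [pu _ mu_] := ua; exact: cvg_mesh.
- move=> nu _ _ [_ [alpha [n [aa hn cnu]]]].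
  apply: traj_limit_unique cnu; apply: cvg_mesh; last exact: sub_mesh.
  by move=> k; case: aa.
- move=> alpha aa; have [pa _ ma] := aa; split.
  + by move=> k; exact: Cp.
  + exact: cvg_mesh.
  + by move=> nu _ cnu; apply: traj_limit_unique cnu; exact: cvg_mesh.
Qed.
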